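(* Let $G$ be a restricted Lie algebra over a perfect field $F$ of characteristic $p>0$, let $H$ be a (restricted) ideal of finite codimension in $G$ admitting a surjective homomorphism onto a nonabelian free restricted Lie algebra, and let $g_1,\dots,g_k$ be elements of $H$. For $n\in\mathbb{N}$ let $I_n$ be the restricted ideal of $G$ generated by $g_1^{[p^n]},\dots,g_k^{[p^n]}$. Then $G/I_n$ is large for all but finitely many $n\in\mathbb{N}$.
   Context: All subalgebras and ideals of restricted Lie algebras are understood to be restricted, i.e. closed under the $p$-operation $x\mapsto x^{[p]}$. For $g\in G$ put $g^{[p^0]}=g$ and $g^{[p^n]}=(g^{[p^{n-1}]})^{[p]}$ for $n\ge 1$. A restricted Lie algebra $G$ is called large if there is a (restricted) subalgebra of $G$ of finite codimension admitting a surjective homomorphism onto a nonabelian free restricted Lie algebra (i.e. one of rank at least 2). *)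

(* Defs.v *)
From HB Require Import structures.
From mathcomp Require Import all_boot all_algebra ring_quotient generic_quotient.
From mathcomp Require Import boolp classical_sets functions cardinality.

Set Implicit Arguments.
Unset Strict Implicit.
Unset Printing Implicit Defensive.

Import GRing.Theory.
Local Open Scope ring_scope.

Definition perfect_field (F : fieldType) : Prop :=
  forall p, p \in [pchar F] -> forall a : F, exists b : F, b ^+ p = a.

(** ** Restricted Lie algebras *)

HB.mixin Record isLieAlgebra (F : fieldType) L of GRing.Lmodule F L := {
  lie : L -> L -> L;
  lieDl : forall x y z, lie (x + y) z = lie x z + lie y z;
  lieDr : forall x y z, lie x (y + z) = lie x y + lie x z;
  lieZl : forall (a : F) x y, lie (a *: x) y = a *: lie x y;
  lieZr : forall (a : F) x y, lie x (a *: y) = a *: lie x y;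
  liexx : forall x, lie x x = 0;
  jacobi : forall x y z, lie x (lie y z) + lie y (lie z x) + lie z (lie x y) = 0
}.

#[short(type="lieAlgType")]
HB.structure Definition LieAlgebra (F : fieldType) :=
  {L of isLieAlgebra F L & GRing.Lmodule F L}.

(** [ad_coef x y n i] is the coefficient of [t ^ i] in [ad (t x + y) ^ n (x)]. *)
Fixpoint ad_coef (F : fieldType) (L : lieAlgType F) (x y : L) (n i : nat) : L :=
  match n with
  | 0 => if i is 0 then x else 0
  | n'.+1 => lie y (ad_coef x y n' i)
             + (if i is i'.+1 then lie x (ad_coef x y n' i') else 0)
  end.

(** Jacobson's [s_i (x, y)], for [0 < i < p]:  [i s_i (x, y)] is the
    coefficient of [t ^ (i - 1)] in [ad (t x + y) ^ (p - 1) (x)]. *)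
Definition jacobson_s (F : fieldType) (p : nat) (L : lieAlgType F)
    (i : nat) (x y : L) : L :=
  i%:R^-1 *: ad_coef x y p.-1 i.-1.

(** The axioms below are the usual ones when [p] is the positive
    characteristic of [F]; the structure is only used in that case. *)
HB.mixin Record isRestricted (F : fieldType) (p : nat) L of LieAlgebra F L := {
  ppow : L -> L;
  ppowZ : forall (a : F) x, ppow (a *: x) = a ^+ p *: ppow x;
  ppow_ad : forall x y : L, lie (ppow x) y = iter p (lie x) y;
  ppowD : forall x y : L,
    ppow (x + y) = ppow x + ppow y + \sum_(1 <= i < p) jacobson_s p i x y
}.

#[short(type="rlieAlgType")]
HB.structure Definition RestrictedLie (F : fieldType) (p : nat) :=
  {L of isRestricted F p L & LieAlgebra F L}.

Arguments ppow {F p s} x.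

Section BasicLemmas.
Variables (F : fieldType) (L : lieAlgType F).
Implicit Types x y z : L.

Lemma lie0r x : lie x 0 = 0.
Proof. by rewrite -[X in lie _ X](scale0r (0 : L)) lieZr scale0r. Qed.

Lemma lieC x y : lie x y = - lie y x.
Proof.
apply/eqP; rewrite -addr_eq0; apply/eqP.
by have := liexx (x + y); rewrite lieDl !lieDr !liexx add0r addr0.
Qed.

Lemma lieBr x y z : lie x (y - z) = lie x y - lie x z.
Proof. by rewrite lieDr -scaleN1r lieZr scaleN1r. Qed.

Lemma lieBl x y z : lie (x - y) z = lie x z - lie y z.
Proof. by rewrite lieDl -[- y]scaleN1r lieZl scaleN1r. Qed.

End BasicLemmas.

(** ** Homomorphisms and free restricted Lie algebras *)

Definition is_rlie_morphism (F : fieldType) (p : nat) (A B : rlieAlgType F p)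
    (f : {linear A -> B}) : Prop :=
  (forall x y, f (lie x y) = lie (f x) (f y)) /\
  (forall x, f (ppow x) = ppow (f x)).

Definition is_free_on (F : fieldType) (p : nat) (L : rlieAlgType F p)
    (X : Type) (iota : X -> L) : Prop :=
  forall (M : rlieAlgType F p) (h : X -> M),
  exists f : {linear L -> M},
    [/\ is_rlie_morphism f,
        forall x, f (iota x) = h x &
        forall g : {linear L -> M},
          is_rlie_morphism g -> (forall x, g (iota x) = h x) -> g =1 f].

(** Free of (possibly infinite) rank at least 2. *)
Definition is_nonabelian_free (F : fieldType) (p : nat)
    (L : rlieAlgType F p) : Prop :=
  exists (X : Type) (iota : X -> L),
    is_free_on iota /\ exists a b : X, a <> b.

Definition maps_onto_nonabelian_free (F : fieldType) (p : nat)
    (A : rlieAlgType F p) : Prop :=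
  exists (L : rlieAlgType F p) (f : {linear A -> L}),
    [/\ is_nonabelian_free L, is_rlie_morphism f & forall y, exists x, f x = y].

(** ** Restricted subalgebras *)

Record rsubalg (F : fieldType) (p : nat) (G : rlieAlgType F p) := RSubalg {
  rsub_pred :> {pred G};
  rsub_submod : submod_closed rsub_pred;
  rsub_lie : {in rsub_pred &, forall x y, lie x y \in rsub_pred};
  rsub_ppow : {in rsub_pred, forall x, ppow x \in rsub_pred}
}.

HB.instance Definition _ (F : fieldType) (p : nat) (G : rlieAlgType F p)
    (S : rsubalg G) :=
  GRing.isSubmodClosed.Build F G (rsub_pred S) (rsub_submod S).

Section SubalgebraType.
Variables (F : fieldType) (p : nat) (G : rlieAlgType F p) (S : rsubalg G).

Record subalg_type := SubalgElt {
  subalg_val :> G;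
  subalg_valP : subalg_val \in rsub_pred S
}.

HB.instance Definition _ := [isSub for subalg_val].
HB.instance Definition _ := [Choice of subalg_type by <:].
HB.instance Definition _ := [SubChoice_isSubLmodule of subalg_type by <:].

Definition sub_lie (x y : subalg_type) : subalg_type :=
  SubalgElt (rsub_lie (valP x) (valP y)).

Let sub_lieDl x y z : sub_lie (x + y) z = sub_lie x z + sub_lie y z.
Proof. apply: val_inj; exact: lieDl. Qed.
Let sub_lieDr x y z : sub_lie x (y + z) = sub_lie x y + sub_lie x z.
Proof. apply: val_inj; exact: lieDr. Qed.
Let sub_lieZl (a : F) x y : sub_lie (a *: x) y = a *: sub_lie x y.
Proof. apply: val_inj; exact: lieZl. Qed.
Let sub_lieZr (a : F) x y : sub_lie x (a *: y) = a *: sub_lie x y.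
Proof. apply: val_inj; exact: lieZr. Qed.
Let sub_liexx x : sub_lie x x = 0.
Proof. apply: val_inj; exact: liexx. Qed.
Let sub_jacobi x y z :
  sub_lie x (sub_lie y z) + sub_lie y (sub_lie z x) + sub_lie z (sub_lie x y) = 0.
Proof. apply: val_inj; exact: jacobi. Qed.

HB.instance Definition _ := isLieAlgebra.Build F subalg_type
  sub_lieDl sub_lieDr sub_lieZl sub_lieZr sub_liexx sub_jacobi.

Definition sub_ppow (x : subalg_type) : subalg_type :=
  SubalgElt (rsub_ppow (valP x)).

Let val_ad_coef x y n i :
  val (ad_coef x y n i : subalg_type) = ad_coef (val x) (val y) n i.
Proof.
by elim: n i => [|n IH] [|i] //=; rewrite IH ?addr0 ?IH.
Qed.

Let sub_ppowZ (a : F) x : sub_ppow (a *: x) = a ^+ p *: sub_ppow x.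
Proof. apply: val_inj; exact: ppowZ. Qed.
Let sub_ppow_ad x y : lie (sub_ppow x) y = iter p (lie x) y.
Proof.
apply: val_inj; rewrite /= ppow_ad.
suff val_iter n : val (iter n (lie x) y) = iter n (lie (val x)) (val y).
  by rewrite -val_iter.
by elim: n => //= n <-.
Qed.
Let sub_ppowD x y :
  sub_ppow (x + y)
  = sub_ppow x + sub_ppow y + \sum_(1 <= i < p) jacobson_s p i x y.
Proof.
apply: val_inj; rewrite /= ppowD; congr (_ + _).
rewrite -[RHS]/(val (\sum_(1 <= i < p) jacobson_s p i x y)) raddf_sum.
by apply: eq_bigr => i _; rewrite /jacobson_s -val_ad_coef.
Qed.

HB.instance Definition _ := isRestricted.Build F p subalg_type
  sub_ppowZ sub_ppow_ad sub_ppowD.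

End SubalgebraType.

Definition finite_codim (F : fieldType) (p : nat) (G : rlieAlgType F p)
    (S : rsubalg G) : Prop :=
  exists (m : nat) (b : 'I_m -> G),
    forall x : G, exists c : 'I_m -> F, x - \sum_(i < m) c i *: b i \in S.

Definition large (F : fieldType) (p : nat) (G : rlieAlgType F p) : Prop :=
  exists S : rsubalg G,
    finite_codim S /\ maps_onto_nonabelian_free (subalg_type S).

(** ** Restricted ideals and quotients *)

Record rideal (F : fieldType) (p : nat) (G : rlieAlgType F p) := RIdeal {
  rideal_rsubalg :> rsubalg G;
  rideal_lie : forall x y : G, y \in rideal_rsubalg -> lie x y \in rideal_rsubalg
}.

Section QuotientAlgebra.
Variables (F : fieldType) (p : nat) (G : rlieAlgType F p) (I : rideal G).
Local Open Scope quotient_scope.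

Definition rquot : Type := Quotient.quot (rsub_pred I).

HB.instance Definition _ := GRing.Zmodule.on rquot.
HB.instance Definition _ := EqQuotient.on rquot.

Let rq := rquot.

Let piP (x y : G) : (x - y \in rsub_pred I) -> \pi_rq x = \pi_rq y.
Proof. by move=> h; apply/eqP; rewrite -Quotient.idealrBE. Qed.

Let reprP (x : G) : repr (\pi_rq x) - x \in rsub_pred I.
Proof. by rewrite Quotient.idealrBE reprK. Qed.

Let rideal_liel (x y : G) : x \in rsub_pred I -> lie x y \in rsub_pred I.
Proof. by move=> h; rewrite lieC rpredN rideal_lie. Qed.

Definition rq_scale (a : F) (x : rquot) : rquot := \pi_rq (a *: repr x).
Definition rq_lie (x y : rquot) : rquot := \pi_rq (lie (repr x) (repr y)).
Definition rq_ppow (x : rquot) : rquot := \pi_rq (ppow (repr x)).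

Let pi_scale a x : rq_scale a (\pi_rq x) = \pi_rq (a *: x).
Proof. by apply: piP; rewrite -scalerBr rpredZ. Qed.

Let pi_lie x y : rq_lie (\pi_rq x) (\pi_rq y) = \pi_rq (lie x y).
Proof.
apply: piP; set x' := repr _; set y' := repr _.
have -> : lie x' y' - lie x y = lie (x' - x) y' + lie x (y' - y).
  by rewrite lieBl lieBr addrA subrK.
apply: rpredD; [exact/rideal_liel/reprP | exact/rideal_lie/reprP].
Qed.

Let ad_coef_mem (x u : G) n i :
  u \in rsub_pred I -> ad_coef x u n.+1 i \in rsub_pred I.
Proof.
move=> uI; elim: n i => [|n IH] i.
  rewrite /= rpredD ?rideal_liel //; case: i => [|[|i]]; rewrite ?rpred0 //.
    by rewrite liexx rpred0.
  by rewrite lie0r rpred0.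
rewrite [ad_coef _ _ _ _]/= -/(ad_coef x u n.+1) rpredD ?rideal_liel //.
by case: i => [|i]; rewrite ?rpred0 // rideal_lie // IH.
Qed.

Let ppow_mod (x u : G) :
  u \in rsub_pred I -> ppow (x + u) - ppow x \in rsub_pred I.
Proof.
move=> uI; rewrite ppowD -[X in X - _]addrA [X in X - _]addrC addrK.
rewrite rpredD ?rsub_ppow //.
rewrite big_nat rpred_sum // => i /andP[i1 ip]; rewrite rpredZ //.
have p1 : (0 < p.-1)%N by rewrite -subn1 subn_gt0 (leq_ltn_trans i1 ip).
by rewrite -(prednK p1) ad_coef_mem.
Qed.

Let pi_ppow x : rq_ppow (\pi_rq x) = \pi_rq (ppow x).
Proof.
apply: piP; set x' := repr _.
by have := ppow_mod x (reprP x); rewrite [x + _]addrC subrK.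
Qed.

Let rq_scalerA a b x : rq_scale a (rq_scale b x) = rq_scale (a * b) x.
Proof. by elim/quotW: x => x; rewrite (pi_scale b) !pi_scale scalerA. Qed.
Let rq_scale1r : left_id 1 rq_scale.
Proof. by elim/quotW => x; rewrite pi_scale scale1r. Qed.
Let rq_scalerDr : right_distributive rq_scale +%R.
Proof.
move=> a; elim/quotW => x; elim/quotW => y.
by rewrite -raddfD !pi_scale -raddfD scalerDr.
Qed.
Let rq_scalerDl x : {morph rq_scale^~ x : a b / a + b}.
Proof. by move=> a b; elim/quotW: x => x; rewrite !pi_scale -raddfD scalerDl. Qed.

HB.instance Definition _ := GRing.Zmodule_isLmodule.Build F rquot
  rq_scalerA rq_scale1r rq_scalerDr rq_scalerDl.

Let pi_linear : linear (\pi_rq : G -> rquot).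
Proof. by move=> a x y; rewrite raddfD; congr (_ + _); apply/esym/pi_scale. Qed.

HB.instance Definition _ :=
  GRing.isLinear.Build F G rquot _ (\pi_rq : G -> rquot) pi_linear.

Let rq_lieDl x y z : rq_lie (x + y) z = rq_lie x z + rq_lie y z.
Proof.
elim/quotW: x => x; elim/quotW: y => y; elim/quotW: z => z.
by rewrite -raddfD !pi_lie -raddfD lieDl.
Qed.
Let rq_lieDr x y z : rq_lie x (y + z) = rq_lie x y + rq_lie x z.
Proof.
elim/quotW: x => x; elim/quotW: y => y; elim/quotW: z => z.
by rewrite -raddfD !pi_lie -raddfD lieDr.
Qed.
Let rq_lieZl (a : F) x y : rq_lie (a *: x) y = a *: rq_lie x y.
Proof.
elim/quotW: x => x; elim/quotW: y => y.
by rewrite [a *: _]pi_scale !pi_lie [RHS]pi_scale lieZl.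
Qed.
Let rq_lieZr (a : F) x y : rq_lie x (a *: y) = a *: rq_lie x y.
Proof.
elim/quotW: x => x; elim/quotW: y => y.
by rewrite [a *: _]pi_scale !pi_lie [RHS]pi_scale lieZr.
Qed.
Let rq_liexx x : rq_lie x x = 0.
Proof. by elim/quotW: x => x; rewrite pi_lie liexx raddf0. Qed.
Let rq_jacobi x y z :
  rq_lie x (rq_lie y z) + rq_lie y (rq_lie z x) + rq_lie z (rq_lie x y) = 0.
Proof.
elim/quotW: x => x; elim/quotW: y => y; elim/quotW: z => z.
by rewrite (pi_lie y z) (pi_lie z x) (pi_lie x y) !pi_lie -!raddfD jacobi raddf0.
Qed.

HB.instance Definition _ := isLieAlgebra.Build F rquot
  rq_lieDl rq_lieDr rq_lieZl rq_lieZr rq_liexx rq_jacobi.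

Let pi_lieE x y : lie (\pi_rq x : rquot) (\pi_rq y) = \pi_rq (lie x y).
Proof. exact: pi_lie. Qed.

Let pi_ad_coef x y n i :
  ad_coef (\pi_rq x : rquot) (\pi_rq y) n i = \pi_rq (ad_coef x y n i).
Proof.
elim: n i => [|n IH] [|i] //=; first by rewrite raddf0.
  by rewrite IH pi_lieE !addr0.
by rewrite !IH !pi_lieE raddfD.
Qed.

Let rq_ppowZ (a : F) x : rq_ppow (a *: x) = a ^+ p *: rq_ppow x.
Proof.
elim/quotW: x => x.
by rewrite [a *: _]pi_scale !pi_ppow [RHS]pi_scale ppowZ.
Qed.
Let rq_ppow_ad x y : lie (rq_ppow x) y = iter p (lie x) y.
Proof.
elim/quotW: x => x; elim/quotW: y => y; rewrite pi_ppow pi_lieE ppow_ad.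
suff pi_iter n : iter n (lie (\pi_rq x : rquot)) (\pi_rq y)
                 = \pi_rq (iter n (lie x) y) by rewrite pi_iter.
by elim: n => //= n ->; rewrite pi_lieE.
Qed.
Let rq_ppowD x y :
  rq_ppow (x + y)
  = rq_ppow x + rq_ppow y + \sum_(1 <= i < p) jacobson_s p i x y.
Proof.
elim/quotW: x => x; elim/quotW: y => y.
rewrite -raddfD !pi_ppow ppowD !raddfD raddf_sum; congr (_ + _).
by apply: eq_bigr => i _; rewrite /jacobson_s pi_ad_coef [RHS]pi_scale.
Qed.

HB.instance Definition _ := isRestricted.Build F p rquot
  rq_ppowZ rq_ppow_ad rq_ppowD.

Lemma pi_is_rlie_morphism : is_rlie_morphism (\pi_rq : {linear G -> rquot}).
Proof. by split=> [x y|x] /=; rewrite ?pi_lieE // -pi_ppow. Qed.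

End QuotientAlgebra.

Section GeneratedIdeal.
Variables (F : fieldType) (p : nat) (G : rlieAlgType F p) (A : set G).

Definition rideal_gen_pred : {pred G} :=
  fun x => `[< forall J : rideal G, (forall a, A a -> a \in J) -> x \in J >].

Let gen_submod : submod_closed rideal_gen_pred.
Proof.
split=> [|a x y /asboolP hx /asboolP hy]; apply/asboolP => J AJ.
  exact: rpred0.
by rewrite rpredD ?rpredZ ?hx ?hy.
Qed.

Let gen_lie (x y : G) : y \in rideal_gen_pred -> lie x y \in rideal_gen_pred.
Proof.
by move=> /asboolP hy; apply/asboolP => J AJ; apply/rideal_lie/hy.
Qed.

Let gen_ppow : {in rideal_gen_pred, forall x, ppow x \in rideal_gen_pred}.
Proof. by move=> x /asboolP hx; apply/asboolP => J AJ; apply/rsub_ppow/hx. Qed.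

Definition rideal_gen : rideal G :=
  @RIdeal F p G (RSubalg gen_submod (fun x y _ => @gen_lie x y) gen_ppow) gen_lie.

End GeneratedIdeal.

(* Main.v *)
Require Import Defs.
From HB Require Import structures.
From mathcomp Require Import all_boot all_order all_algebra.
From mathcomp Require Import zify.
From mathcomp Require Import boolp classical_sets functions cardinality.

(** Throughout, [d / dx] and [d / dy] are partial derivatives, [ad (u)] is the map
    [lie u], and a word in [ad (G)] is a composite of such maps.

    Reduction to a free algebra. Let [N] be a restricted subalgebra of [H] that
    is stable under [ad (H)], and let [V_d] be the set of the elements of [H]
    that all words of length at most [d] in [ad (G)] send into [N]. The
    [p]-operation maps [V_d] into [V_(d + 1)], because one letter of a word is
    spent on turning the [p]-th power into a bracket ([killed_upto_ppow]). On
    the other hand [V_d] no longer depends on [d] once [d] is at least [p - 1]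
    times the codimension of [H]: modulo shorter words the letters of a word
    commute, letters from [H] preserve [N], and [p] equal letters make a single
    letter ([killed_upto_core]). So an element of [N] has an iterated [p]-th
    power in the largest ideal of [G] inside [N] ([core_absorbs]). If [phi] maps
    [H] onto the free algebra [L], it is therefore enough to find a restricted
    ideal of [L] which contains an iterated [p]-th power of each [phi (g i)] and
    which dies under a map of a subalgebra of finite codimension of [L] onto a
    nonabelian free algebra [P] ([free_wreath_relation]).

    The representation. Take for [P] the subalgebra of [L] generated by two of
    the free generators, [a] and [b]. It is free of rank two, and acts
    faithfully on a space [W], its two generators acting as operators [S] and
    [T]. Let [L] act on functions of two divided-power variables [x] and [y]
    with values in [W]: the generator [a] acts as [d / dx], the generator [b] as

      [c (x) d / dy + (y ^ e / e!) (S + x T)],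

    and the others as [0]. Every [h] in [L] then acts as
    [alpha (d / dx) + (beta (d / dx) c) d / dy], up to operators that raise the
    order in [y] by at least [e - D]; here the polynomials [alpha] and [beta]
    and the number [D] do not depend on [e], nor on [c] as long as [c] vanishes
    to order [D] at the origin ([wreath_formP]). The [p]-th power of
    [alpha (d / dx) + g (x) d / dy] is
    [alpha ^ p (d / dx) + (alpha ^ (p - 1) (d / dx) g) d / dy] when [g] vanishes
    at the origin, since the [p]-th power of a function of divided-power
    variables is the constant [g (0) ^ p]. Suppose that [c] has degree less than
    [p ^ s] in [x], and that all the functions
    [alpha ^ (p ^ i - 1) (d / dx) beta (d / dx) c] with [i <= s] vanish at the
    origin. On functions of degree less than [p ^ s] in [x], the [p ^ (s + 1)]-th
    power of [h] then only raises the order in [y], since [d / dx] is nilpotent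
    there; so [h] is nilpotent on the finite box of functions of degree less than
    [p ^ s] in [x] and less than [p ^ t] in [y]. For [k] elements [h] these are
    [k (s + 1)] linear conditions on a function [c] with about [p ^ s]
    coefficients, and for [s] large they have a nonzero solution
    ([wreath_parameters]). The elements of [L] that annihilate the box form the
    restricted ideal that was sought ([rep_box_nilpotent]).

    Finite codimension and surjectivity. The image of [L] lies in the wreath
    product spanned by the operators [(d / dx) ^ (p ^ i)],
    [g (x) (d / dy) ^ (p ^ j)] and [f (x, y) r] with [r] in [P]. The value at
    the origin of such an operator on a function [v] of the box is [r' v (0, 0)]
    with [r'] in [P], plus a combination of finitely many other coefficients of
    [v]. Hence the elements of [L] for which that combination is zero have finite
    codimension ([acts_at_origin_codim]); they form a subalgebra, mapped to [P]
    by taking [h] to [r']. The map is onto ([acts_at_origin_onto]): for some [j]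
    the element [ad (a) ^ j (b)] acts as [C (x) d / dy] with [C (0) != 0], and
    the [e]-th power of its adjoint map strips the factor [y ^ e / e!] off [b]
    and [ad (a) (b)], leaving nonzero multiples of [S] and of [T] at the origin.

    The faithful action of [P] is the embedding of the free restricted algebra
    into the free associative algebra ([free_embedding]), the latter being
    realized by operators on functions on words. The algebra [P] is spanned by
    the iterated [p]-th powers of the brackets attached to Hall trees
    ([hall_power_span]); their images have distinct leading words, namely powers
    of distinct Lyndon words ([leading_word_power], [lyndon_pow_inj]), and so are
    linearly independent. *)

Set Implicit Arguments.
Unset Strict Implicit.
Unset Printing Implicit Defensive.

Import Order.TTheory GRing.Theory.
Local Open Scope ring_scope.

(** * Jacobson's formula in an associative algebra *)

Section Jacobson.
Variables (R : nzRingType) (p : nat).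
Hypothesis charRp : p \in [pchar R].
Implicit Types a b x y : R.

Definition commutator a x := a * x - x * a.

Lemma commutatorC a x : commutator a x = - commutator x a.
Proof. by rewrite /commutator opprB. Qed.

Lemma commutatorDl a b x : commutator (a + b) x = commutator a x + commutator b x.
Proof. by rewrite /commutator mulrDl mulrDr opprD addrACA. Qed.

Lemma commutatorDr a x y : commutator a (x + y) = commutator a x + commutator a y.
Proof. by rewrite /commutator mulrDl mulrDr opprD addrACA. Qed.

Lemma signed_bin_pchar i : (i < p)%N ->
  (-1) ^+ i * 'C(p.-1, i)%:R = 1 :> R.
Proof.
have p_pr := pcharf_prime charRp.
elim: i => [|i IH] lt_ip; first by rewrite expr0 bin0 mul1r.
have : 'C(p, i.+1)%:R = 0 :> R.
  apply/eqP; rewrite -(dvdn_pcharf charRp).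
  by apply: prime_dvd_bin; rewrite ?lt_ip.
rewrite -{1}(prednK (prime_gt0 p_pr)) binS natrD => /eqP.
rewrite addr_eq0 => /eqP ->.
by rewrite exprS mulN1r mulrN mulNr opprK IH // ltnW.
Qed.

(** Left and right multiplications commute, so this is the binomial formula. *)
Lemma iter_two_sided a b x n :
  iter n (fun z => a * z + z * b) x
  = \sum_(i < n.+1) (a ^+ (n - i) * x * b ^+ i) *+ 'C(n, i).
Proof.
elim: n => [|n IH].
  by rewrite big_ord_recl big_ord0 /= !expr0 bin0 !mul1r mulr1 addr0.
rewrite iterS IH mulr_suml mulr_sumr big_ord_recl /= bin0 subn0 expr0 mulr1.
rewrite [X in _ + X]big_ord_recr /= [RHS]big_ord_recl subn0 expr0 mulr1 bin0.
rewrite big_ord_recr /= binn subnn expr0 mul1r !mulr1n.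
rewrite exprS mulrA -!addrA; congr (_ + _).
rewrite binn subnn expr0 mul1r mulr1n -mulrA -exprSr !addrA; congr (_ + _).
rewrite -big_split; apply: eq_bigr => i _ /=.
rewrite !/bump !add1n binS mulrnDr mulrnAr mulrnAl subSS; congr (_ *+ _ + _ *+ _).
  by rewrite !mulrA -exprS subnSK.
by rewrite -mulrA -exprSr.
Qed.

(** In characteristic [p] the signs cancel the binomial coefficients, which
    turns [ad (a) ^ (p - 1)] into the noncommutative derivative of [a ^ p]. *)
Lemma iter_commutator_pred a x :
  iter p.-1 (commutator a) x = \sum_(i < p) a ^+ (p.-1 - i) * x * a ^+ i.
Proof.
have p_gt0 : (0 < p)%N by apply/prime_gt0/(pcharf_prime charRp).
have -> : iter p.-1 (commutator a) x = iter p.-1 (fun z => a * z + z * - a) x.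
  by apply: eq_iter => z; rewrite mulrN.
rewrite iter_two_sided prednK //; apply: eq_bigr => i _.
by rewrite exprNn -mulrnAr -mulrnAl -[_ *+ _]mulr_natr signed_bin_pchar ?mul1r.
Qed.

Lemma commutator_sum a x n :
  commutator a (\sum_(i < n.+1) a ^+ (n - i) * x * a ^+ i)
  = commutator (a ^+ n.+1) x.
Proof.
rewrite /commutator mulr_suml mulr_sumr big_ord_recl [X in _ - X]big_ord_recr /=.
rewrite subn0 subnn !expr0 !mulr1 mul1r mulrA -exprS -mulrA -exprSr.
rewrite opprD addrA; congr (_ - _); rewrite -addrA -[RHS]addr0; congr (_ + _).
rewrite -sumrB big1 // => i _; rewrite /bump add1n !mulrA -exprS subnSK //.
by rewrite -!mulrA -exprSr subrr.
Qed.

Lemma iter_commutator_pchar a x :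
  iter p (commutator a) x = commutator (a ^+ p) x.
Proof.
have := iter_commutator_pred a x.
have := prime_gt0 (pcharf_prime charRp).
by case: (p) => [|n] //= _ ->; rewrite commutator_sum.
Qed.

End Jacobson.

Section JacobsonFormula.
Variables (R : nzRingType) (p : nat).
Hypothesis charRp : p \in [pchar R].
Implicit Types x y : R.

Fixpoint commutator_coef x y (n i : nat) : R :=
  match n with
  | 0 => if i is 0 then x else 0
  | n'.+1 => commutator y (commutator_coef x y n' i)
             + (if i is i'.+1 then commutator x (commutator_coef x y n' i') else 0)
  end.

Let E x y : {poly R} := x%:P * 'X + y%:P.

(** [E x y] is [t x + y] with the variable of the polynomials for [t]. *)
Lemma coef_iter_commutator x y n i :
  (iter n (fun z : {poly R} => E x y * z - z * E x y) x%:P)`_i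
  = commutator_coef x y n i.
Proof.
elim: n i => [|n IH] i; first by rewrite /= coefC; case: i.
rewrite iterS coefB mulrDl mulrDr !coefD -mulrA -commr_polyX !mulrA !coefMX.
rewrite coefCM coefMC.
case: i => [|i] /=; rewrite -!IH /commutator coefCM coefMC ?addr0 ?add0r //=.
by rewrite opprD addrACA addrC.
Qed.

Lemma deriv_exp_linear x y n :
  (E x y ^+ n)^`() = \sum_(i < n) E x y ^+ (n.-1 - i) * x%:P * E x y ^+ i.
Proof.
have dE : (E x y)^`() = x%:P.
  by rewrite derivD derivM derivX !derivC mul0r mulr1 add0r addr0.
elim: n => [|n IH]; first by rewrite expr0 derivC big_ord0.
rewrite exprSr derivM dE IH big_ord_recl subn0 expr0 mulr1 addrC; congr (_ + _).
rewrite mulr_suml; apply: eq_bigr => i _.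
rewrite -mulrA -exprSr lift0; congr (_ ^+ _ * _ * _).
by rewrite -subn1 -subnDA add1n.
Qed.

Lemma coef_exp_linear x y n i : (n <= i)%N ->
  (E x y ^+ n)`_i = if i == n then x ^+ n else 0.
Proof.
elim: n i => [|n IH] i le_ni; first by rewrite expr0 coef1 expr0; case: eqP.
rewrite exprS mulrDl -mulrA -commr_polyX !mulrA coefD coefMX !coefCM.
case: i le_ni => // i le_ni; rewrite /= !IH // ?(ltnW le_ni) //.
by rewrite eqSS (gtn_eqF le_ni) mulr0 addr0; case: eqP; rewrite ?mulr0 ?exprS.
Qed.

Lemma coef0_exp_linear x y n : (E x y ^+ n)`_0 = y ^+ n.
Proof.
elim: n => [|n IH]; first by rewrite !expr0 coef1.
by rewrite exprS mulrDl -mulrA -commr_polyX mulrA coefD coefMX !coefCM IH /= add0r exprS.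
Qed.

(** The derivative in [t] of [(t x + y) ^ p] is [ad (t x + y) ^ (p - 1) (x)], by
    [iter_commutator_pred] over the polynomials. *)
Lemma commutator_coef_exp x y i :
  (E x y ^+ p)`_i.+1 *+ i.+1 = commutator_coef x y p.-1 i.
Proof.
have charP : p \in [pchar {poly R}].
  by rewrite inE (pcharf_prime charRp) /= -polyC_natr (pcharf0 charRp).
rewrite -coef_iter_commutator -coef_deriv deriv_exp_linear.
by rewrite -(iter_commutator_pred charP).
Qed.

End JacobsonFormula.

Lemma jacobi_cancel (V : zmodType) (a b c d e f : V) :
  a - b - (c - d) + (c - e - (f - b)) + (f - d - (a - e)) = 0.
Proof.
rewrite !opprB !addrA !subrK (addrAC _ (- e) b) (addrAC _ d b) subrK (addrAC _ (- e) (- d)).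
by rewrite addrK subrK subrr.
Qed.

Lemma pchar_alg (F : fieldType) (A : algType F) (p : nat) :
  p \in [pchar F] -> p \in [pchar A].
Proof.
move=> charFp; rewrite inE (pcharf_prime charFp) /= -scaler_nat.
by rewrite (pcharf0 charFp) scale0r.
Qed.

(** The left side is the value at [t = 1] of [(t x + y) ^ p], whose coefficients of
    degree [0 < i < p] are recovered from its derivative. *)
Lemma exprD_jacobson (F : fieldType) (A : algType F) (p : nat)
    (charFp : p \in [pchar F]) (x y : A) :
  (x + y) ^+ p = x ^+ p + y ^+ p
    + \sum_(1 <= i < p) i%:R^-1 *: commutator_coef x y p.-1 i.-1.
Proof.
have charAp := pchar_alg A charFp.
have p_gt0 : (0 < p)%N := prime_gt0 (pcharf_prime charFp).
pose E : {poly A} := x%:P * 'X + y%:P.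
have E1 : (E ^+ p).[1] = (x + y) ^+ p.
  have cE1 : comm_poly E 1 by rewrite /comm_poly mulr1 mul1r.
  rewrite (horner_exp_comm _ cE1).
  by rewrite hornerD hornerMX !hornerC mulr1.
have szE : (size (E ^+ p) <= p.+1)%N.
  by apply/leq_sizeP => i lt_pi; rewrite coef_exp_linear ?(ltnW lt_pi) // gtn_eqF.
rewrite -E1 (horner_coef_wide _ szE) big_ord_recr /= expr1n mulr1.
rewrite coef_exp_linear // eqxx.
rewrite (eq_bigr (fun i : 'I_p => (E ^+ p)`_i)); last by move=> i _; rewrite expr1n mulr1.
rewrite -(big_mkord xpredT (fun i => (E ^+ p)`_i)) big_ltn // coef0_exp_linear.
rewrite addrC addrA; congr (_ + _); rewrite !big_nat.
apply: eq_bigr => [[|i]] // /andP[_ lt_ip].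
rewrite -(commutator_coef_exp charAp) -scaler_nat scalerA mulVf ?scale1r //.
by rewrite -(dvdn_pcharf charFp) gtnNdvd.
Qed.

(** An associative algebra, seen as a restricted Lie algebra under the
    commutator and the [p]-th power. *)
Definition assoc_rlie (F : fieldType) (p : nat) (charFp : p \in [pchar F])
  (A : algType F) : Type := A.

Section AssocRestrictedLie.
Variables (F : fieldType) (p : nat) (charFp : p \in [pchar F]) (A : algType F).
Local Notation L := (assoc_rlie charFp A).

HB.instance Definition _ := GRing.Lmodule.on L.

Let charAp : p \in [pchar A] := pchar_alg A charFp.

Let lieA (x y : L) : L := commutator (x : A) y.

Let lieA_Dl x y z : lieA (x + y) z = lieA x z + lieA y z.
Proof. exact: commutatorDl. Qed.
Let lieA_Dr x y z : lieA x (y + z) = lieA x y + lieA x z.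
Proof. exact: commutatorDr. Qed.
Let lieA_Zl (a : F) x y : lieA (a *: x) y = a *: lieA x y.
Proof.
rewrite /lieA /commutator -[X in X - _](scalerAl a (x : A) (y : A)).
by rewrite -[X in _ - X](scalerAr a (y : A) (x : A)) -scalerBr.
Qed.
Let lieA_Zr (a : F) x y : lieA x (a *: y) = a *: lieA x y.
Proof.
rewrite /lieA /commutator -[X in X - _](scalerAr a (x : A) (y : A)).
by rewrite -[X in _ - X](scalerAl a (y : A) (x : A)) -scalerBr.
Qed.
Let lieA_xx x : lieA x x = 0.
Proof. exact: subrr. Qed.
Let lieA_jacobi x y z :
  lieA x (lieA y z) + lieA y (lieA z x) + lieA z (lieA x y) = 0.
Proof.
rewrite /lieA /commutator !mulrBl !mulrBr !mulrA.
set a := x * y * z; set b := x * z * y; set c := y * z * x.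
set d := z * y * x; set e := y * x * z; set f := z * x * y.
exact: jacobi_cancel.
Qed.

HB.instance Definition _ := isLieAlgebra.Build F L
  lieA_Dl lieA_Dr lieA_Zl lieA_Zr lieA_xx lieA_jacobi.

Let ppowA (x : L) : L := (x : A) ^+ p.

Let ppowA_Z (a : F) x : ppowA (a *: x) = a ^+ p *: ppowA x.
Proof. exact: exprZn. Qed.
Let ppowA_ad x y : lie (ppowA x) y = iter p (lie x) y.
Proof. exact/esym/(iter_commutator_pchar charAp). Qed.

Let ad_coefA (x y : L) n i : ad_coef x y n i = commutator_coef (x : A) y n i.
Proof. by elim: n i => [|n IH] [|i] //=; rewrite !IH. Qed.

Let ppowA_D x y : ppowA (x + y)
  = ppowA x + ppowA y + \sum_(1 <= i < p) jacobson_s p i x y.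
Proof.
rewrite -[LHS]/((x + y : A) ^+ p) (exprD_jacobson charFp).
by congr (_ + _); apply: eq_bigr => i _; rewrite /jacobson_s ad_coefA.
Qed.

HB.instance Definition _ := isRestricted.Build F p L
  ppowA_Z ppowA_ad ppowA_D.
End AssocRestrictedLie.

(** * Algebras of linear operators *)

Section LinearOperators.
Variables (F : fieldType) (V : lmodType F).

Definition linear_pred : {pred V -> V} := fun f => `[< linear f >].

Lemma linear_pred_submod : submod_closed linear_pred.
Proof.
split=> [|a f g /asboolP lf /asboolP lg]; apply/asboolP => k x y.
  by rewrite /= /GRing.zero /= scaler0 addr0.
rewrite -[LHS]/(a *: f (k *: x + y) + g (k *: x + y)).
rewrite -[RHS]/(k *: (a *: f x + g x) + (a *: f y + g y)).
by rewrite lf lg !scalerDr !scalerA mulrC addrACA.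
Qed.

HB.instance Definition _ :=
  GRing.isSubmodClosed.Build F (V -> V) linear_pred linear_pred_submod.

(** The proof that [V] is nonzero is a parameter of the type because the ring of
    operators has to satisfy [1 != 0]. *)
Record linop (nzV : exists v : V, v != 0) := Linop {
  linop_fun :> V -> V;
  linop_funP : linop_fun \in linear_pred
}.

Variable nzV : exists v : V, v != 0.
Local Notation E := (linop nzV).

HB.instance Definition _ := [isSub for @linop_fun nzV].
HB.instance Definition _ := [Choice of E by <:].
HB.instance Definition _ := [SubChoice_isSubLmodule of E by <:].

Lemma linop_linear (f : E) : linear f.
Proof. exact/asboolP/linop_funP. Qed.

HB.instance Definition _ (f : E) :=
  GRing.isLinear.Build F V V *:%R f (linop_linear f).

Lemma linopP (f g : E) : f =1 g -> f = g.
Proof. by move=> fg; apply: val_inj; apply/funext. Qed.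

Lemma linop0E v : (0 : E) v = 0. Proof. by []. Qed.
Lemma linopDE (f g : E) v : (f + g) v = f v + g v. Proof. by []. Qed.
Lemma linopNE (f : E) v : (- f) v = - f v. Proof. by []. Qed.
Lemma linopZE a (f : E) v : (a *: f) v = a *: f v. Proof. by []. Qed.

Definition linop_of (f : V -> V) (lf : linear f) : E :=
  Linop nzV (asboolT lf).

Let one_linear : linear (@id V). Proof. by []. Qed.
Let comp_linear (f g : E) : linear (f \o g).
Proof. by move=> k x y; rewrite /= !linearP. Qed.

Let one : E := linop_of one_linear.
Let mul (f g : E) : E := linop_of (comp_linear f g).

Let mulA : associative mul. Proof. by move=> f g h; apply: linopP. Qed.
Let mul1 : left_id one mul. Proof. by move=> f; apply: linopP. Qed.
Let mulR1 : right_id one mul. Proof. by move=> f; apply: linopP. Qed.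
Let mulDl : left_distributive mul +%R.
Proof. by move=> f g h; apply: linopP. Qed.
Let mulDr : right_distributive mul +%R.
Proof. by move=> f g h; apply: linopP => v; exact: raddfD. Qed.
Let one_neq0 : one != 0.
Proof.
case: nzV => v; apply: contraNneq => one0.
by rewrite -[v]/(one v) one0.
Qed.

HB.instance Definition _ :=
  GRing.Zmodule_isNzRing.Build E mulA mul1 mulR1 mulDl mulDr one_neq0.

Lemma linopME (f g : E) v : (f * g) v = f (g v). Proof. by []. Qed.
Lemma linop1E v : (1 : E) v = v. Proof. by []. Qed.

Lemma linopXE (f : E) n v : (f ^+ n) v = iter n f v.
Proof. by elim: n => //= n IH; rewrite exprS linopME IH. Qed.

Let scaleAl (a : F) (f g : E) : a *: (f * g) = (a *: f) * g.
Proof. exact: linopP. Qed.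
HB.instance Definition _ := GRing.Lmodule_isLalgebra.Build F E scaleAl.

Let scaleAr (a : F) (f g : E) : a *: (f * g) = f * (a *: g).
Proof. by apply: linopP => v; rewrite !linopME linopZE linearZ. Qed.
HB.instance Definition _ := GRing.Lalgebra_isAlgebra.Build F E scaleAr.

End LinearOperators.

Section AssocLieOperations.
Variables (F : fieldType) (p : nat) (charFp : p \in [pchar F]) (A : algType F).
Lemma lie_assocE (x y : assoc_rlie charFp A) :
  lie x y = (x : A) * y - (y : A) * x.
Proof. by []. Qed.
Lemma ppow_assocE (x : assoc_rlie charFp A) : ppow x = (x : A) ^+ p.
Proof. by []. Qed.
End AssocLieOperations.

(** * Lyndon words and Hall trees *)

Section LyndonHall.
Local Notation word := (seqlexi bool).
Implicit Types u v w x y z : word.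

Lemma lt_cat2l u v w : ((u ++ v : word) < u ++ w)%O = (v < w)%O.
Proof. by elim: u => //= b u IH; rewrite ltxi_cons lexx IH. Qed.

Lemma le_cat2l u v w : ((u ++ v : word) <= u ++ w)%O = (v <= w)%O.
Proof. by elim: u => //= b u IH; rewrite lexi_cons lexx IH. Qed.

Lemma le_catr u v : (u <= u ++ v :> word)%O.
Proof. by rewrite -{1}[u : seq bool]cats0 le_cat2l lexi0s. Qed.

(** Unless [v] extends [u], the comparison of [u] and [v] is decided at a letter
    where they differ. *)
Lemma lt_cat_dec u v x y : (u < v)%O ->
  (exists2 v', v = u ++ v' & v' != [::]) \/ ((u ++ x : word) < v ++ y)%O.
Proof.
elim: u v => [|a u IH] [|b v] //; first by left; exists (b :: v).
rewrite ltxi_cons => /andP[le_ab lt_uv].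
have [eq_ab|ne_ab] := eqVneq a b; last first.
  right; rewrite /= neqhead_ltxiE // lt_neqAle ne_ab //.
subst b; move: lt_uv; rewrite lexx /= => /IH [[v' -> v'0]|lt_uv]; first by left; exists v'.
by right; rewrite ltxi_cons lexx.
Qed.

Definition lyndon w : Prop := w != [::] /\
  forall x y, w = x ++ y -> x != [::] -> y != [::] -> (w < y)%O.

Lemma lyndon_cat_lt u v : u != [::] -> lyndon v -> (u < v)%O -> ((u ++ v : word) < v)%O.
Proof.
move=> u0 [v0 lv] lt_uv.
have [[v' def_v v'0]|] := lt_cat_dec v [::] lt_uv; last by rewrite cats0.
by rewrite {2}def_v lt_cat2l (lv _ _ def_v).
Qed.

Lemma cat_eq_cat (T : Type) (s1 s2 t1 t2 : seq T) : s1 ++ s2 = t1 ++ t2 ->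
  (exists r, t1 = s1 ++ r /\ s2 = r ++ t2) \/
  (exists b r, s1 = t1 ++ b :: r /\ t2 = b :: r ++ s2).
Proof.
elim: s1 t1 => [|a s1 IH] [|b t1] /= => [|->|<-|[<- /IH]]; first by left; exists [::].
- by left; exists (b :: t1).
- by right; exists a, s1.
case=> [[r [-> ->]]|[c [r [-> ->]]]]; first by left; exists r.
by right; exists c, r.
Qed.

Lemma lyndon_suffix v x y : lyndon v -> v = x ++ y -> y != [::] -> (v <= y)%O.
Proof.
move=> [_ lv] def_v y0; have [x0|x0] := eqVneq x [::].
  by rewrite def_v x0.
exact/ltW/(lv _ _ def_v).
Qed.

Lemma lyndon_cat u v :
  lyndon u -> lyndon v -> (u < v)%O -> lyndon (u ++ v).
Proof.
move=> [u0 lu] lyv lt_uv.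
have lt_uvv := lyndon_cat_lt u0 lyv lt_uv.
split; first by case: (u : seq bool) u0.
move=> x y /cat_eq_cat[[z [_ def_v]]|[b [z [def_u ->]]]] x0 y0.
  exact: lt_le_trans lt_uvv (lyndon_suffix lyv def_v y0).
have lt_uz := lu _ _ def_u x0 isT.
have [[z' def_z _]|//] := lt_cat_dec v v lt_uz.
have x_gt0 : (0 < size x)%N by rewrite lt0n size_eq0.
have := congr1 size def_z; rewrite def_u !size_cat => /eqP.
rewrite (addnC (size x)) -addnA -[X in X == _]addn0 eqn_add2l eq_sym addn_eq0.
by rewrite eqn0Ngt x_gt0.
Qed.

Inductive tree := Leaf of bool | Node of tree & tree.

Fixpoint tree_word (t : tree) : word :=
  match t with
  | Leaf b => [:: b]
  | Node s t => tree_word s ++ tree_word t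
  end.

(** Trees are compared by their words; the last condition makes the right branch
    of a tree the least proper suffix of its word ([hall_min_suffix]). *)
Fixpoint hall (t : tree) : bool :=
  if t is Node s t then
    [&& hall s, hall t, (tree_word s < tree_word t)%O
      & if s is Node _ s2 then (tree_word t <= tree_word s2)%O else true]
  else true.

Lemma tree_word_neq0 t : tree_word t != [::].
Proof.
elim: t => // s IHs t _ /=.
by move: IHs; case: (tree_word s).
Qed.

Lemma tree_word_gt0 t : (0 < size (tree_word t))%N.
Proof. by rewrite lt0n size_eq0 tree_word_neq0. Qed.

Lemma hall_lyndon t : hall t -> lyndon (tree_word t).
Proof.
elim: t => [b _|s IHs t IHt /and4P[hs ht lt_st _]]; last first.
  by apply: lyndon_cat => //; [exact: IHs | exact: IHt].
by split=> // [[|c x]] [|d y] // [_]; case: x.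
Qed.

(** A tree is recovered from its word by cutting off the least proper suffix; the
    proof uses that [tree_word t] is at most the word of the right branch of [s]. *)
Lemma hall_min_suffix s t x y : hall (Node s t) ->
  tree_word s ++ tree_word t = x ++ y -> x != [::] -> y != [::] ->
  (tree_word t <= y)%O.
Proof.
elim: s t x y => [b|s1 IH s2 _] t x y /and4P[hs ht lt_st le_t];
    move=> /cat_eq_cat[[z [_ def_t]]|[c [z [def_s ->]]]] x0 y0;
    try exact: lyndon_suffix (hall_lyndon ht) def_t y0.
  by case: x x0 def_s => // a [|b'].
have le_s2 : (tree_word s2 <= c :: z :> word)%O by apply: (IH s2 x).
exact: le_trans le_t (le_trans le_s2 (le_catr _ _)).
Qed.

Lemma hall_tree_word_inj s t :
  hall s -> hall t -> tree_word s = tree_word t -> s = t.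
Proof.
elim: s t => [a|s1 IH1 s2 IH2] [b|t1 t2] hs ht.
- by case=> ->.
- move/(congr1 size); rewrite /= size_cat => sz.
  by have := leq_add (tree_word_gt0 t1) (tree_word_gt0 t2); rewrite -sz.
- move/(congr1 size); rewrite /= size_cat => sz.
  by have := leq_add (tree_word_gt0 s1) (tree_word_gt0 s2); rewrite sz.
move=> /= eq_w; have /and4P[hs1 hs2 _ _] := hs; have /and4P[ht1 ht2 _ _] := ht.
have eq2 : tree_word s2 = tree_word t2.
  apply/eqP; rewrite eq_le; apply/andP; split.
    exact: hall_min_suffix hs eq_w (tree_word_neq0 _) (tree_word_neq0 _).
  exact: hall_min_suffix ht (esym eq_w) (tree_word_neq0 _) (tree_word_neq0 _).
have eq1 : tree_word s1 = tree_word t1.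
  move/(congr1 rev): eq_w; rewrite eq2 !rev_cat.
  by move/(congr1 (drop (size (rev (tree_word t2))))); rewrite !drop_size_cat // => /(can_inj revK).
by congr Node; [exact: IH1 | exact: IH2].
Qed.

Definition word_pow w n : word := iter n (cat w) [::].

Lemma word_powSr w n : word_pow w n.+1 = word_pow w n ++ w.
Proof. by elim: n => [|n IH]; rewrite /= ?cats0 // -catA -IH. Qed.

Lemma prefix_cat_lt x y x' y' : x ++ x' = y ++ y' -> (size x < size y)%N ->
  (x < y)%O.
Proof.
move=> /cat_eq_cat[[z [-> _]]|[b [z [-> _]]]]; last first.
  by rewrite size_cat ltnNge leq_addr.
rewrite size_cat -[X in (X < _)%N -> _]addn0 ltn_add2l => z_gt0.
by rewrite -{1}[x : seq bool]cats0 lt_cat2l ltxi0s -size_eq0 -lt0n.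
Qed.

(** If [u] were shorter than [v], then [v = u ++ v'], where [v'] is larger than [v]
    as a suffix, and smaller as a proper prefix of the same periodic word. *)
Lemma lyndon_pow_size u v m n : lyndon u -> lyndon v ->
  word_pow u m.+1 = word_pow v n.+1 -> ~~ (size u < size v)%N.
Proof.
move=> [u0 lu] [v0 lv] eq_w; apply/negP => lt_uv.
have [[v' [def_v eq_w']]|[b [z [def_u _]]]] := cat_eq_cat eq_w; last first.
  by rewrite def_u size_cat ltnNge leq_addr in lt_uv.
have v'0 : v' != [::].
  by apply: contraTneq lt_uv => v'0; rewrite def_v v'0 cats0 ltnn.
have lt_vv' : (v < v')%O by apply: lv def_v u0 v'0.
have lt_v'v : (v' < v :> word)%O.
  apply: (@prefix_cat_lt _ _ (word_pow v n ++ u) (word_pow v n)).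
    have {}eq_w' : word_pow u m = v' ++ word_pow v n by [].
    by rewrite catA -eq_w' -word_powSr.
  by rewrite def_v size_cat -[X in (X < _)%N]add0n ltn_add2r lt0n size_eq0.
by have := lt_trans lt_vv' lt_v'v; rewrite ltxx.
Qed.

(** Lyndon words are primitive. *)
Lemma lyndon_pow_inj u v m n : lyndon u -> lyndon v ->
  word_pow u m.+1 = word_pow v n.+1 -> u = v /\ m = n.
Proof.
move=> lu lv eq_w.
have eq_sz : size u = size v.
  have := lyndon_pow_size lv lu (esym eq_w).
  by have := lyndon_pow_size lu lv eq_w; case: ltngtP.
have eq_uv : u = v.
  move/(congr1 (take (size u))): eq_w.
  by rewrite /= take_size_cat // eq_sz take_size_cat.
split=> //; move/(congr1 size): eq_w; rewrite eq_uv.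
have szP k : size (word_pow v k) = (k * size v)%N.
  by elim: k => //= k IH; rewrite size_cat IH mulSn.
have v_gt0 : (0 < size v)%N by rewrite lt0n size_eq0; case: lv.
by rewrite !szP => /eqP; rewrite eqn_pmul2r // => /eqP[].
Qed.

End LyndonHall.

(** * Spans of powers of Hall elements *)

Section Generation.
Variables (F : fieldType) (p : nat) (M : rlieAlgType F p).
Variables (X : Type) (g : X -> M).

Definition generated_by : Prop :=
  forall S : rsubalg M, (forall i, g i \in S) -> forall x, x \in S.

Lemma generated_ind (K : M -> Prop) : generated_by ->
  K 0 -> (forall a x y, K x -> K y -> K (a *: x + y)) ->
  (forall x y, K x -> K y -> K (lie x y)) -> (forall x, K x -> K (ppow x)) ->
  (forall i, K (g i)) -> forall x, K x.
Proof.
move=> gen K0 Klin Klie Kppow Kg x; pose S : {pred M} := fun y => `[< K y >].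
have subS : submod_closed S.
  split=> [|a y z /asboolP hy /asboolP hz]; apply/asboolP => //.
  exact: Klin.
have lieS : {in S &, forall y z, lie y z \in S}.
  by move=> y z /asboolP hy /asboolP hz; apply/asboolP/Klie.
have ppowS : {in S, forall y, ppow y \in S}.
  by move=> y /asboolP hy; apply/asboolP/Kppow.
have /asboolP // : x \in RSubalg subS lieS ppowS.
by apply: gen => i; apply/asboolP.
Qed.

End Generation.

Section Span.
Variables (F : fieldType) (V : lmodType F).
Implicit Types (B C : V -> Prop) (x y : V).

Inductive lspan B : V -> Prop :=
  | lspan0 : lspan B 0
  | lspan_cons a b x : B b -> lspan B x -> lspan B (a *: b + x).

Lemma lspan_gen B b : B b -> lspan B b.
Proof.
by move=> Bb; rewrite -[b]addr0 -[b]scale1r; apply: lspan_cons (lspan0 _).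
Qed.

Lemma lspanD B x y : lspan B x -> lspan B y -> lspan B (x + y).
Proof.
elim=> [|a b z Bb _ IH] By; first by rewrite add0r.
by rewrite -addrA; apply: lspan_cons (IH By).
Qed.

Lemma lspanZ B a x : lspan B x -> lspan B (a *: x).
Proof.
elim=> [|c b z Bb _ IH]; first by rewrite scaler0; left.
by rewrite scalerDr scalerA; apply: lspan_cons.
Qed.

Lemma lspanN B x : lspan B x -> lspan B (- x).
Proof. by rewrite -scaleN1r; apply: lspanZ. Qed.

Lemma lspan_sum B (I : Type) (r : seq I) (P : pred I) (f : I -> V) :
  (forall i, P i -> lspan B (f i)) -> lspan B (\sum_(i <- r | P i) f i).
Proof.
by move=> Bf; apply: big_ind => //; [left | move=> x y; apply: lspanD].
Qed.

Lemma lspan_bind B C x : (forall b, B b -> lspan C b) -> lspan B x -> lspan C x.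
Proof.
move=> BC; elim=> [|a b z Bb _ IH]; first by left.
by apply: lspanD IH; apply/lspanZ/BC.
Qed.

End Span.

Section SpanLie.
Variables (F : fieldType) (p : nat) (M : rlieAlgType F p).
Implicit Types (B C D : M -> Prop) (x y : M).

Lemma lie0l x : lie 0 x = 0.
Proof. by rewrite lieC lie0r oppr0. Qed.

Lemma lieNr x y : lie x (- y) = - lie x y.
Proof. by rewrite -scaleN1r lieZr scaleN1r. Qed.

Lemma lie_derivation x y z : lie x (lie y z) = lie (lie x y) z + lie y (lie x z).
Proof.
have /eqP := jacobi x y z; rewrite -addrA addr_eq0 => /eqP ->.
by rewrite opprD addrC -lieC -lieNr -lieC.
Qed.

Lemma lie_lie_left x y z : lie (lie x y) z = lie (lie x z) y + lie x (lie y z).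
Proof.
by rewrite (lie_derivation x y z) (lieC y (lie x z)) addrCA subrr addr0.
Qed.

Lemma ppow0 : (0 < p)%N -> ppow (0 : M) = 0.
Proof.
by move=> p_gt0; rewrite -[X in ppow X](scale0r (0 : M)) ppowZ expr0n gtn_eqF // scale0r.
Qed.

Lemma iter_ppow_ad x y n : lie (iter n ppow x) y = iter (p ^ n) (lie x) y.
Proof.
elim: n y => //= n IH y; rewrite ppow_ad expnS iterM.
exact: eq_iter.
Qed.

Lemma lspan_lie B C D x y : (forall b c, B b -> C c -> lspan D (lie b c)) ->
  lspan B x -> lspan C y -> lspan D (lie x y).
Proof.
move=> BCD; elim=> [|a b z Bb _ IH] Cy; first by rewrite lie0l; left.
rewrite lieDl lieZl; apply: lspanD (IH Cy); apply: lspanZ.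
elim: Cy {IH} => [|c d w Cd _ IH]; first by rewrite lie0r; left.
by rewrite lieDr lieZr; apply: lspanD IH; apply/lspanZ/BCD.
Qed.

(** Jacobson's formula makes it enough to test the [p]-operation on spanning
    vectors. *)
Lemma lspan_ppow B x : (0 < p)%N ->
  (forall b c, B b -> B c -> lspan B (lie b c)) ->
  (forall b, B b -> lspan B (ppow b)) -> lspan B x -> lspan B (ppow x).
Proof.
move=> p_gt0 lieB ppowB.
have lieS y z : lspan B y -> lspan B z -> lspan B (lie y z).
  exact: lspan_lie.
elim=> [|a b z Bb Bz IH]; first by rewrite ppow0 //; left.
have Bab : lspan B (a *: b) by apply/lspanZ/lspan_gen.
rewrite ppowD ppowZ; apply: lspanD; first apply: lspanD => //.
  exact/lspanZ/ppowB.
apply: lspan_sum => i _; apply: lspanZ.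
elim: p.-1 i.-1 => [|n IHn] [|j] //=; first by left.
- by apply: lspanD; [apply: lieS | left].
- by apply: lspanD; apply: lieS.
Qed.

End SpanLie.

Section HallSpan.
Variables (F : fieldType) (p : nat) (M : rlieAlgType F p) (m : bool -> M).
Local Notation word := (seqlexi bool).

Fixpoint tree_eval (t : tree) : M :=
  match t with
  | Leaf b => m b
  | Node s t => lie (tree_eval s) (tree_eval t)
  end.

Definition hall_elt_below (n : nat) (v : word) (x : M) : Prop :=
  exists h, [/\ hall h, size (tree_word h) = n, (tree_word h < v)%O
              & x = tree_eval h].

Let rank n (v : word) := #|[pred x : n.-bseq bool | ((x : seq bool) < v :> word)%O]|.

Lemma ltn_rank n (w v : word) : (size w <= n)%N -> (w < v)%O ->
  (rank n w < rank n v)%N.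
Proof.
move=> le_wn lt_wv; apply/proper_card/properP; split.
  by apply/fintype.subsetP => x; rewrite !inE => /lt_trans; apply.
by exists (Bseq le_wn); rewrite !inE /= ?ltxx.
Qed.

(** If [Node s t] is not a Hall tree, then [s = Node s1 s2] with [s2] below [t], and
    [lie (lie s1 s2) t = lie (lie s1 t) s2 + lie s1 (lie s2 t)]. By induction on the
    degree the inner brackets are combinations of Hall elements below [t], so that
    the outer ones involve only words below [t]: the induction runs over the degree,
    then over the larger of the two words, above finitely many words of length at
    most [n]. *)
Lemma hall_bracket n s t : hall s -> hall t ->
  (size (tree_word s) + size (tree_word t) = n)%N ->
  (tree_word s < tree_word t)%O ->
  lspan (hall_elt_below n (tree_word t)) (lie (tree_eval s) (tree_eval t)).
Proof.
elim/ltn_ind: n s t => n IHn s t.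
have [k] := ubnP (rank n (tree_word t)); elim: k s t => // k IHk s t lt_k.
move=> hs ht sz_st lt_st; set v := tree_word t in sz_st lt_st *.
have bracket_below x y : hall x -> hall y ->
    (size (tree_word x) + size (tree_word y) = n)%N ->
    (tree_word x < v)%O -> (tree_word y < v)%O ->
    lspan (hall_elt_below n v) (lie (tree_eval x) (tree_eval y)).
  move=> hx hy sz_xy lt_x lt_y.
  wlog lt_xy : x y hx hy sz_xy lt_x lt_y / (tree_word x < tree_word y)%O.
    move=> th; have [|lt_yx|eq_xy] := ltgtP (tree_word x) (tree_word y).
    - exact: th.
    - by rewrite lieC; apply/lspanN/th => //; rewrite addnC.
    - by rewrite (hall_tree_word_inj hx hy eq_xy) liexx; left.
  have lt_r : (rank n (tree_word y) < k)%N.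
    apply: leq_trans (ltn_rank _ lt_y) _ => //.
    by rewrite -sz_xy leq_addl.
  apply: lspan_bind (IHk x y lt_r hx hy sz_xy lt_xy) => _ [h [hh szh lth ->]].
  by apply: lspan_gen; exists h; split=> //; apply: lt_trans lth _.
have [hst|] := boolP (hall (Node s t)).
  apply: lspan_gen; exists (Node s t); split=> //=; first by rewrite size_cat.
  exact: lyndon_cat_lt (tree_word_neq0 s) (hall_lyndon ht) lt_st.
rewrite /= hs ht lt_st /=.
case: s hs sz_st lt_st => // s1 s2 /and4P[hs1 hs2 lt_s12 _] sz_st lt_st.
rewrite -ltNge => lt_s2.
have lt_s1 := lt_trans lt_s12 lt_s2.
have {}sz_st : (size (tree_word s1) + size (tree_word s2) + size v = n)%N.
  by rewrite -size_cat.
have -> : lie (tree_eval (Node s1 s2)) (tree_eval t) =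
    lie (lie (tree_eval s1) (tree_eval t)) (tree_eval s2)
    + lie (tree_eval s1) (lie (tree_eval s2) (tree_eval t)).
  exact: lie_lie_left.
apply: lspanD.
- apply: (@lspan_lie _ _ _ (hall_elt_below (size (tree_word s1) + size v) v)
            (fun x => x = tree_eval s2)).
  + move=> _ _ [h [hh szh lth ->]] ->; apply: bracket_below => //.
    by rewrite szh addnAC.
  + apply: (IHn (size (tree_word s1) + size v)%N) => //.
    by rewrite -sz_st ltn_add2r -[X in (X < _)%N]addn0 ltn_add2l tree_word_gt0.
  + exact: lspan_gen.
- apply: (@lspan_lie _ _ _ (fun x => x = tree_eval s1)
            (hall_elt_below (size (tree_word s2) + size v) v)).
  + move=> _ _ -> [h [hh szh lth ->]]; apply: bracket_below => //.
    by rewrite szh addnA.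
  + exact: lspan_gen.
  + apply: (IHn (size (tree_word s2) + size v)%N) => //.
    by rewrite -sz_st ltn_add2r -[X in (X < _)%N]add0n ltn_add2r tree_word_gt0.
Qed.

End HallSpan.

Section HallPowers.
Variables (F : fieldType) (p : nat) (M : rlieAlgType F p) (m : bool -> M).
Hypothesis p_gt0 : (0 < p)%N.

Definition hall_power (k : tree * nat) : M := iter k.2 ppow (tree_eval m k.1).

Definition is_hall_power (x : M) : Prop := exists2 k, hall k.1 & x = hall_power k.

Let is_hall_elt (x : M) : Prop := exists2 h, hall h & x = tree_eval m h.

Let hall_elt_lie x y : is_hall_elt x -> is_hall_elt y ->
  lspan is_hall_elt (lie x y).
Proof.
move=> [s hs ->] [t ht ->].
wlog lt_st : s t hs ht / (tree_word s < tree_word t)%O.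
  move=> th; have [|lt_ts|eq_st] := ltgtP (tree_word s) (tree_word t).
  - exact: th.
  - by rewrite lieC; apply/lspanN/th.
  - by rewrite (hall_tree_word_inj hs ht eq_st) liexx; left.
apply: lspan_bind (hall_bracket m hs ht erefl lt_st) => _ [h [hh _ _ ->]].
by apply: lspan_gen; exists h.
Qed.

Let iter_hall_elt_lie x n y : is_hall_elt x -> lspan is_hall_elt y ->
  lspan is_hall_elt (iter n (lie x) y).
Proof.
move=> hx hy; elim: n => //= n IH.
apply: lspan_lie IH; [exact: hall_elt_lie | exact: lspan_gen].
Qed.

Let hall_power_elt_lie k y : hall k.1 -> lspan is_hall_elt y ->
  lspan is_hall_elt (lie (hall_power k) y).
Proof.
move=> hk hy; rewrite /hall_power iter_ppow_ad.
by apply: iter_hall_elt_lie => //; exists k.1.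
Qed.

(** As [ad (h ^ [p ^ j])] is [ad (h) ^ (p ^ j)], the bracket of two powers of Hall
    elements is a combination of Hall elements. *)
Lemma hall_power_lie x y : is_hall_power x -> is_hall_power y ->
  lspan is_hall_power (lie x y).
Proof.
move=> [k hk ->] [[h j] hh ->].
have hall_elt_power z : lspan is_hall_elt z -> lspan is_hall_power z.
  apply: lspan_bind => _ [t ht ->]; apply: lspan_gen.
  by exists (t, 0%N).
apply: hall_elt_power; rewrite lieC /hall_power /= iter_ppow_ad.
apply: lspanN; have := expn_gt0 p j; rewrite p_gt0 /=.
case: (p ^ j)%N => // n _; rewrite iterSr; apply: iter_hall_elt_lie.
  by exists h.
rewrite lieC; apply: lspanN; apply: hall_power_elt_lie => //.
by apply: lspan_gen; exists h.
Qed.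

Lemma hall_power_ppow x : is_hall_power x -> lspan is_hall_power (ppow x).
Proof. by move=> [[h i] hh ->]; apply: lspan_gen; exists (h, i.+1). Qed.

Lemma hall_power_span : generated_by m -> forall x, lspan is_hall_power x.
Proof.
move=> gen; apply: (generated_ind gen) => [|a x y Bx By|x y|x|b].
- by left.
- by apply: lspanD By; apply: lspanZ.
- exact: lspan_lie hall_power_lie.
- exact: lspan_ppow p_gt0 hall_power_lie hall_power_ppow.
- by apply: lspan_gen; exists (Leaf b, 0%N).
Qed.

End HallPowers.

HB.instance Definition _ := gen_eqMixin tree.

Section UniqueCombination.
Variables (F : fieldType) (V : lmodType F) (I : eqType) (e : I -> V).

(** Collecting repeated terms: later on, the coefficient of a leading word must not
    be split over several terms. *)
Lemma lspan_uniq (P : I -> Prop) x :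
  lspan (fun y => exists2 k, P k & y = e k) x ->
  exists (s : seq I) (a : I -> F),
    [/\ uniq s, forall k, k \in s -> P k & x = \sum_(k <- s) a k *: e k].
Proof.
elim=> [|c _ y [k Pk ->] _ [s [a [us Ps ->]]]].
  by exists [::], (fun _ => 0); rewrite big_nil.
have [ks|ks] := boolP (k \in s); last first.
  exists (k :: s), (fun j => if j == k then c else a j); split=> /=.
  - by rewrite ks.
  - by move=> j; rewrite inE => /orP[/eqP->|/Ps].
  rewrite big_cons eqxx; congr (_ + _); rewrite !big_seq; apply: eq_bigr => j js.
  by case: eqP => // jk; rewrite -jk js in ks.
exists s, (fun j => if j == k then c + a j else a j); split=> //.
rewrite [in RHS](bigD1_seq k) //= eqxx scalerDl -addrA; congr (_ + _).
rewrite (bigD1_seq k) //=; congr (_ + _); apply: eq_bigr => j /negPf -> //.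
Qed.

End UniqueCombination.

Section WordShift.
Variable F : fieldType.
Local Notation word := (seqlexi bool).
Local Notation W := (seq bool -> F^o).

Lemma word_space_nontrivial : exists f : W, f != 0.
Proof.
exists (fun _ => 1); apply/eqP => /(congr1 (fun f : W => f [::])) /eqP.
by rewrite oner_eq0.
Qed.
Local Notation E := (linop word_space_nontrivial).

Let shift_linear (w : seq bool) : linear (fun (f : W) z => f (z ++ w)).
Proof. by []. Qed.

(** Right multiplication of the free monoid by [w], acting on functions: these
    operators multiply like words, so that they generate a copy of the free
    associative algebra. *)
Definition shift (w : seq bool) : E := linop_of word_space_nontrivial (shift_linear w).

Lemma shift_cat u v : shift (u ++ v) = shift u * shift v.
Proof. by apply: linopP => f; apply/funext => z; rewrite linopME /= catA. Qed.

Lemma shift_nil : shift [::] = 1.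
Proof. by apply: linopP => f; apply/funext => z; rewrite linop1E /= cats0. Qed.

(** The coefficient of [w] in a combination of shifts is read off at the empty word
    from the indicator function of [w]. *)
Definition word_coef (w : word) (Z : E) : F :=
  (Z (fun z => (z == w :> seq bool)%:R)) [::].

Lemma word_coef_shift (w v : word) : word_coef w (shift v) = (v == w)%:R.
Proof. by []. Qed.

Lemma word_coef0 w : word_coef w 0 = 0. Proof. by []. Qed.
Lemma word_coefD w (Y Z : E) :
  word_coef w (Y + Z) = word_coef w Y + word_coef w Z.
Proof. by []. Qed.
Lemma word_coefZ w a (Z : E) : word_coef w (a *: Z) = a * word_coef w Z.
Proof. by []. Qed.

Definition shift_above (w : word) (Z : E) : Prop :=
  exists y : word, [/\ size y = size w, (w < y)%O & Z = shift y].

(** [Z] is the word [w] plus larger words of the same length. *)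
Definition leading_word (Z : E) (w : word) : Prop :=
  lspan (shift_above w) (Z - shift w).

Lemma leading_word_coef Z w : leading_word Z w -> word_coef w Z = 1.
Proof.
move=> lead; rewrite -[Z](subrK (shift w)) word_coefD word_coef_shift eqxx.
elim: lead => [|a _ y [v [_ lt_wv ->]] _ IH]; first by rewrite word_coef0 add0r.
by rewrite word_coefD word_coefZ -addrA IH word_coef_shift gt_eqF // mulr0 add0r.
Qed.

Lemma leading_word_coef_lt Z v w : leading_word Z w -> (v < w)%O ->
  word_coef v Z = 0.
Proof.
move=> lead lt_vw; rewrite -[Z](subrK (shift w)) word_coefD word_coef_shift.
rewrite gt_eqF // addr0.
elim: lead => [|a _ y [u [_ lt_wu ->]] _ IH]; first by rewrite word_coef0.
by rewrite word_coefD word_coefZ IH word_coef_shift gt_eqF ?(lt_trans lt_vw) // mulr0 add0r.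
Qed.

Lemma lt_cat_size (u v x y : word) : size u = size v -> (u < v)%O ->
  ((u ++ x : word) < v ++ y)%O.
Proof.
move=> sz_uv lt_uv; have [[v' def_v v'0]|//] := lt_cat_dec x y lt_uv.
move: sz_uv; rewrite def_v size_cat => /eqP.
by rewrite -[X in X == _]addn0 eqn_add2l eq_sym size_eq0 (negPf v'0).
Qed.

Lemma lspan_mul (A : algType F) (B C D : A -> Prop) x y :
  (forall b c, B b -> C c -> lspan D (b * c)) ->
  lspan B x -> lspan C y -> lspan D (x * y).
Proof.
move=> BCD; elim=> [|a b z Bb _ IH] Cy; first by rewrite mul0r; left.
rewrite mulrDl -scalerAl; apply: lspanD (IH Cy); apply: lspanZ.
elim: Cy {IH} => [|c d w Cd _ IH]; first by rewrite mulr0; left.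
by rewrite mulrDr -scalerAr; apply: lspanD IH; apply/lspanZ/BCD.
Qed.

Lemma leading_word_mul Y Z u v : leading_word Y u -> leading_word Z v ->
  leading_word (Y * Z) (u ++ v).
Proof.
move=> leadY leadZ; rewrite /leading_word shift_cat.
have -> : Y * Z - shift u * shift v
    = (Y - shift u) * Z + shift u * (Z - shift v).
  by rewrite mulrBl mulrBr addrA subrK.
apply: lspanD.
  apply: (@lspan_mul _ _ (fun X => exists y : word, size y = size v /\ X = shift y)); last first.
  - rewrite -[Z](subrK (shift v)); apply: lspanD.
      by apply: lspan_bind leadZ => _ [y [sz _ ->]]; apply: lspan_gen; exists y.
    by apply: lspan_gen; exists v.
  - exact: leadY.
  move=> _ _ [y [szy lt_uy ->]] [z [szz ->]]; apply: lspan_gen.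
  exists (y ++ z); rewrite shift_cat; split=> //; last exact: lt_cat_size.
  by rewrite !size_cat szy szz.
apply: (@lspan_mul _ (fun X => X = shift u)) leadZ; last exact: lspan_gen.
move=> _ _ -> [z [szz lt_vz ->]]; apply: lspan_gen; exists (u ++ z).
by rewrite shift_cat lt_cat2l; split=> //; rewrite !size_cat szz.
Qed.

Lemma leading_word_commutator Y Z u v : leading_word Y u -> leading_word Z v ->
  ((u ++ v : word) < v ++ u)%O -> leading_word (Y * Z - Z * Y) (u ++ v).
Proof.
move=> leadY leadZ lt_w; rewrite /leading_word addrAC.
apply: lspanD; first exact: leading_word_mul.
rewrite -[Z * Y](subrK (shift (v ++ u))); apply: lspanN; apply: lspanD.
  apply: lspan_bind (leading_word_mul leadZ leadY) => _ [y [szy lt_y ->]].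
  apply: lspan_gen; exists y; split=> //; last exact: lt_trans lt_y.
  by rewrite szy !size_cat addnC.
by apply: lspan_gen; exists (v ++ u); split=> //; rewrite !size_cat addnC.
Qed.

Lemma leading_word_exp Z w n : leading_word Z w ->
  leading_word (Z ^+ n) (word_pow w n).
Proof.
move=> lead; elim: n => [|n IH].
  by rewrite /leading_word shift_nil expr0 subrr; left.
by rewrite exprS; apply: leading_word_mul.
Qed.

End WordShift.

(** * Embedding into the free associative algebra *)

Section FreeEmbedding.
Variables (F : fieldType) (p : nat) (charFp : p \in [pchar F]).
Local Notation E := (assoc_rlie charFp (linop (word_space_nontrivial F))).
Variables (P : rlieAlgType F p) (m : bool -> P) (pi : {linear P -> E}).
Hypothesis piM : is_rlie_morphism pi.
Hypothesis pi_gen : forall b, pi (m b) = shift F [:: b].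

Lemma leading_word_tree t : hall t ->
  leading_word (pi (tree_eval m t)) (tree_word t).
Proof.
elim: t => [b _|s IHs t IHt hst]; first by rewrite /leading_word /= pi_gen subrr; left.
have /and4P[hs ht lt_st _] := hst; rewrite /= piM.1 lie_assocE.
apply: leading_word_commutator; [exact: IHs | exact: IHt |].
apply: lt_le_trans (le_catr _ _).
exact: lyndon_cat_lt (tree_word_neq0 s) (hall_lyndon ht) lt_st.
Qed.

Let power_word (k : tree * nat) := word_pow (tree_word k.1) (p ^ k.2).

Lemma leading_word_power k : hall k.1 ->
  leading_word (pi (hall_power m k)) (power_word k).
Proof.
case: k => t i /= ht; rewrite /hall_power /=.
have -> : pi (iter i ppow (tree_eval m t)) =
    (pi (tree_eval m t) : linop _) ^+ (p ^ i) :> linop _.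
  by elim: i => //= i IH; rewrite piM.2 ppow_assocE IH expnSr exprM.
exact/leading_word_exp/leading_word_tree.
Qed.

Let power_word_inj k l : hall k.1 -> hall l.1 -> power_word k = power_word l ->
  k = l.
Proof.
have p_gt1 : (1 < p)%N := prime_gt1 (pcharf_prime charFp).
case: k l => [s i] [t j] /= hs ht; rewrite /power_word /=.
have := expn_gt0 p i; have := expn_gt0 p j; rewrite (ltnW p_gt1) /=.
case Ej: (p ^ j)%N => [//|b] _; case Ei: (p ^ i)%N => [//|a] _ eq_w.
have [eq_st eq_ab] := lyndon_pow_inj (hall_lyndon hs) (hall_lyndon ht) eq_w.
rewrite (hall_tree_word_inj hs ht eq_st); congr (_, _).
by apply/eqP; rewrite -(eqn_exp2l _ _ p_gt1) Ei Ej eq_ab.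
Qed.

(** In a combination of powers of Hall elements the leading words are distinct, so
    that the least of them occurs in a single term. *)
Lemma free_embedding : generated_by m -> injective pi.
Proof.
move=> gen; apply: raddf_inj => x pix0.
have p_gt0 : (0 < p)%N := prime_gt0 (pcharf_prime charFp).
have [s [a [us hs def_x]]] := lspan_uniq (hall_power_span p_gt0 gen x).
pose r := [seq k <- s | a k != 0].
have {}def_x : x = \sum_(k <- r) a k *: hall_power m k.
  rewrite def_x big_filter [LHS](bigID (fun k => a k != 0)) /=.
  by rewrite [X in _ + X]big1 ?addr0 // => k; rewrite negbK => /eqP ->; rewrite scale0r.
have [r0|[k0 k0r min_k0]] : r = [::] \/
    exists2 k0, k0 \in r & forall k, k \in r -> (power_word k0 <= power_word k)%O.
  elim: (r) => [|k r' [->|[k0 k0r' min_k0]]]; first by left.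
    by right; exists k; rewrite ?mem_head // => j; rewrite inE => /eqP ->.
  right; have [le_k|lt_k] := leP (power_word k0) (power_word k).
    exists k0; rewrite ?inE ?k0r' ?orbT // => j.
    by rewrite inE => /orP[/eqP->|/min_k0].
  exists k; rewrite ?mem_head // => j; rewrite inE => /orP[/eqP->|/min_k0] //.
  exact/le_trans/ltW.
- by rewrite def_x r0 big_nil.
have ur : uniq r by apply: filter_uniq.
have /andP[ak0 k0s] : (a k0 != 0) && (k0 \in s) by rewrite mem_filter in k0r.
suff : word_coef (power_word k0) (pi x) = a k0.
  by rewrite pix0 word_coef0 => /esym/eqP; rewrite (negPf ak0).
have coef_sum (q : seq (tree * nat)) (f : tree * nat -> P) :
    word_coef (power_word k0) (pi (\sum_(k <- q) f k))
    = \sum_(k <- q) word_coef (power_word k0) (pi (f k)).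
  apply: (big_morph (fun y => word_coef (power_word k0) (pi y))) => [y z|].
    by rewrite raddfD.
  by rewrite raddf0.
rewrite def_x coef_sum (bigD1_seq k0) //= linearZ word_coefZ.
rewrite (leading_word_coef (leading_word_power (hs _ k0s))) mulr1.
rewrite big_seq_cond big1 ?addr0 // => k /andP[kr ne_k].
have ks : k \in s by move: kr; rewrite mem_filter => /andP[].
rewrite linearZ word_coefZ (leading_word_coef_lt (leading_word_power (hs _ ks))).
  by rewrite mulr0.
rewrite lt_neqAle min_k0 // andbT; apply: contraNneq ne_k => eq_w.
by apply/eqP/power_word_inj => //; apply: hs.
Qed.

End FreeEmbedding.

(** * Functions and operators in two divided-power variables *)

Lemma scaler_comm (F : fieldType) (U : lmodType F) (a b : F) (v : U) :
  a *: (b *: v) = b *: (a *: v).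
Proof. by rewrite !scalerA mulrC. Qed.

Section HurwitzProduct.
Variables (F : fieldType) (U : lmodType F).
Implicit Types (f g : nat -> nat -> F^o) (v w : nat -> nat -> U).

Definition dx (T : Type) (v : nat -> nat -> T) : nat -> nat -> T :=
  fun i j => v i.+1 j.
Definition dy (T : Type) (v : nat -> nat -> T) : nat -> nat -> T :=
  fun i j => v i j.+1.

Fixpoint hprod0 f v (j : nat) : U :=
  if j is j'.+1 then hprod0 (dy f) v j' + hprod0 f (dy v) j'
  else f 0 0 *: v 0 0.

(** A function of [(i, j)] stands for the family of its coefficients in
    divided powers [x ^ i / i! * y ^ j / j!]: [dx] and [dy] are the partial
    derivatives, and [hprod] is the product, given by its value at the origin
    and by the Leibniz rules. *)
Fixpoint hprod f v (i j : nat) : U :=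
  if i is i'.+1 then hprod (dx f) v i' j + hprod f (dx v) i' j
  else hprod0 f v j.

Lemma hprod_00 f v : hprod f v 0 0 = f 0%N 0%N *: v 0%N 0%N.
Proof. by []. Qed.

Lemma dx_hprod f v : dx (hprod f v) = hprod (dx f) v + hprod f (dx v).
Proof. by []. Qed.

Lemma dy_hprod f v : dy (hprod f v) = hprod (dy f) v + hprod f (dy v).
Proof.
apply/funext => i; apply/funext => j.
elim: i f v => [//|i IH] f v.
rewrite -[LHS]/(hprod (dx f) v i j.+1 + hprod f (dx v) i j.+1).
rewrite -[hprod (dx f) v i j.+1]/(dy (hprod (dx f) v) i j).
rewrite -[hprod f (dx v) i j.+1]/(dy (hprod f (dx v)) i j) !IH.
exact: addrACA.
Qed.

Lemma hprodDr f v w : hprod f (v + w) = hprod f v + hprod f w.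
Proof.
apply/funext => i; apply/funext => j; elim: i f v w => [|i IH] f v w.
  elim: j f v w => [|j IH] f v w; first exact: scalerDr.
  rewrite -[LHS]/(hprod (dy f) (v + w) 0 j + hprod f (dy v + dy w) 0 j).
  by rewrite !IH; exact: addrACA.
rewrite -[LHS]/(hprod (dx f) (v + w) i j + hprod f (dx v + dx w) i j).
by rewrite !IH; exact: addrACA.
Qed.

Lemma hprodZr a f v : hprod f (a *: v) = a *: hprod f v.
Proof.
apply/funext => i; apply/funext => j; elim: i f v => [|i IH] f v.
  elim: j f v => [|j IH] f v; first exact: scaler_comm.
  rewrite -[LHS]/(hprod (dy f) (a *: v) 0 j + hprod f (a *: dy v) 0 j).
  by rewrite !IH -scalerDr.
rewrite -[LHS]/(hprod (dx f) (a *: v) i j + hprod f (a *: dx v) i j).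
by rewrite !IH -scalerDr.
Qed.

Lemma hprodDl f g v : hprod (f + g) v = hprod f v + hprod g v.
Proof.
apply/funext => i; apply/funext => j; elim: i f g v => [|i IH] f g v.
  elim: j f g v => [|j IH] f g v; first exact: scalerDl.
  rewrite -[LHS]/(hprod (dy f + dy g) v 0 j + hprod (f + g) (dy v) 0 j).
  by rewrite !IH; exact: addrACA.
rewrite -[LHS]/(hprod (dx f + dx g) v i j + hprod (f + g) (dx v) i j).
by rewrite !IH; exact: addrACA.
Qed.

Lemma hprodZl a f v : hprod (a *: f) v = a *: hprod f v.
Proof.
apply/funext => i; apply/funext => j; elim: i f v => [|i IH] f v.
  elim: j f v => [|j IH] f v; first exact/esym/scalerA.
  rewrite -[LHS]/(hprod (a *: dy f) v 0 j + hprod (a *: f) (dy v) 0 j).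
  by rewrite !IH -scalerDr.
rewrite -[LHS]/(hprod (a *: dx f) v i j + hprod (a *: f) (dx v) i j).
by rewrite !IH -scalerDr.
Qed.

End HurwitzProduct.

Section HurwitzAssoc.
Variables (F : fieldType) (U : lmodType F).
Implicit Types (f g : nat -> nat -> F^o) (v : nat -> nat -> U).

Lemma hprodA f g v : hprod f (hprod g v) = hprod (hprod f g) v.
Proof.
apply/funext => i; apply/funext => j; elim: i f g v => [|i IH] f g v.
  elim: j f g v => [|j IH] f g v; first by rewrite !hprod_00 scalerA.
  rewrite -[LHS]/(dy (hprod f (hprod g v)) 0 j).
  rewrite -[RHS]/(dy (hprod (hprod f g) v) 0 j).
  rewrite !dy_hprod hprodDr hprodDl.
  rewrite -[LHS]/(hprod (dy f) (hprod g v) 0 j +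
    (hprod f (hprod (dy g) v) 0 j + hprod f (hprod g (dy v)) 0 j)).
  by rewrite !IH addrA.
rewrite -[LHS]/(dx (hprod f (hprod g v)) i j).
rewrite -[RHS]/(dx (hprod (hprod f g) v) i j).
rewrite !dx_hprod hprodDr hprodDl.
rewrite -[LHS]/(hprod (dx f) (hprod g v) i j +
  (hprod f (hprod (dx g) v) i j + hprod f (hprod g (dx v)) i j)).
by rewrite !IH addrA.
Qed.

Lemma hprodC f g : hprod f g = hprod g f.
Proof.
apply/funext => i; apply/funext => j; elim: i f g => [|i IH] f g.
  elim: j f g => [|j IH] f g; first exact: mulrC.
  rewrite -[LHS]/(dy (hprod f g) 0 j) -[RHS]/(dy (hprod g f) 0 j) !dy_hprod.
  rewrite -[LHS]/(hprod (dy f) g 0 j + hprod f (dy g) 0 j) (IH (dy f)) (IH f).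
  exact: addrC.
rewrite -[LHS]/(dx (hprod f g) i j) -[RHS]/(dx (hprod g f) i j) !dx_hprod.
rewrite -[LHS]/(hprod (dx f) g i j + hprod f (dx g) i j) (IH (dx f)) (IH f).
exact: addrC.
Qed.

Definition dpow (a b : nat) : nat -> nat -> F^o :=
  fun i j => ((i == a) && (j == b))%:R.

Lemma dx_dpow0 b : dx (dpow 0 b) = 0. Proof. by []. Qed.
Lemma dy_dpow0 a : dy (dpow a 0) = 0.
Proof. by apply/funext => i; apply/funext => j; rewrite /dy /dpow andbF. Qed.

Lemma hprod0l v : hprod 0 v = 0.
Proof. by rewrite -(scale0r (0 : nat -> nat -> F^o)) hprodZl scale0r. Qed.

Lemma hprod1 v : hprod (dpow 0 0) v = v.
Proof.
apply/funext => i; apply/funext => j; elim: i v => [|i IH] v.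
  elim: j v => [|j IH] v; first by rewrite hprod_00 /dpow /= scale1r.
  rewrite -[LHS]/(dy (hprod (dpow 0 0) v) 0 j) dy_hprod dy_dpow0 hprod0l add0r.
  by rewrite IH.
rewrite -[LHS]/(dx (hprod (dpow 0 0) v) i j) dx_hprod dx_dpow0 hprod0l add0r.
by rewrite IH.
Qed.

(** Such an [f] is a multiple of the unit [dpow 0 0]. *)
Lemma hprod_const f v : dx f = 0 -> dy f = 0 -> hprod f v = f 0%N 0%N *: v.
Proof.
move=> fx fy; rewrite -{2}[v]hprod1 -hprodZl; congr (hprod _ v).
apply/funext => -[|i]; apply/funext => j; last first.
  by rewrite -[LHS]/(dx f i j) fx /dpow /= -[RHS]/(_ *: _) /= scaler0.
case: j => [|j]; first by rewrite -[RHS]/(_ * _) mulr1.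
by rewrite -[LHS]/(dy f 0 j) fy -[RHS]/(_ * _) mulr0.
Qed.

End HurwitzAssoc.

Section HurwitzOperators.
Variables (F : fieldType) (U : lmodType F) (nzU : exists u : U, u != 0).
Local Notation V := (nat -> nat -> U).
Local Notation coeff := (nat -> nat -> F^o).
Implicit Types (f g : coeff) (v : V).

Lemma fun2_nontrivial : exists v : V, v != 0.
Proof.
have [u u0] := nzU; exists (fun _ _ => u); apply: contraNneq u0 => v0.
by rewrite -[u]/((fun _ _ : nat => u) 0%N 0%N) v0.
Qed.
Local Notation E := (linop fun2_nontrivial).

Let dx_linear : linear (@dx U : V -> V). Proof. by []. Qed.
Let dy_linear : linear (@dy U : V -> V). Proof. by []. Qed.
Let hprod_linear f : linear (hprod f : V -> V).
Proof. by move=> a v w; rewrite hprodDr hprodZr. Qed.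
Let lift_linear (Z : linop nzU) : linear (fun v i j => Z (v i j)).
Proof.
move=> a v w; apply/funext => i; apply/funext => j.
exact: linearP.
Qed.

Definition opx : E := linop_of fun2_nontrivial dx_linear.
Definition opy : E := linop_of fun2_nontrivial dy_linear.
Definition opm f : E := linop_of fun2_nontrivial (hprod_linear f).
Definition oplift (Z : linop nzU) : E := linop_of fun2_nontrivial (lift_linear Z).

Lemma opyE v : opy v = dy v. Proof. by []. Qed.
Lemma opmE f v : opm f v = hprod f v. Proof. by []. Qed.
Lemma opliftE Z v i j : oplift Z v i j = Z (v i j). Proof. by []. Qed.

Lemma opxy : opx * opy = opy * opx. Proof. exact: linopP. Qed.

Lemma opx_opm f : opx * opm f = opm (dx f) + opm f * opx.
Proof. exact: linopP. Qed.

Lemma opy_opm f : opy * opm f = opm (dy f) + opm f * opy.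
Proof. by apply: linopP => v; apply: dy_hprod. Qed.

Lemma opmD f g : opm (f + g) = opm f + opm g.
Proof. by apply: linopP => v; apply: hprodDl. Qed.

Lemma opmZ a f : opm (a *: f) = a *: opm f.
Proof. by apply: linopP => v; apply: hprodZl. Qed.

Lemma opm0 : opm 0 = 0.
Proof. by apply: linopP => v; apply: hprod0l. Qed.

Lemma opm_hprod f g : opm (hprod f g) = opm f * opm g.
Proof. by apply: linopP => v; rewrite linopME !opmE hprodA. Qed.

Lemma opmC f g : opm f * opm g = opm g * opm f.
Proof. by rewrite -!opm_hprod hprodC. Qed.

Lemma opm1 : opm (dpow F 0 0) = 1.
Proof. by apply: linopP => v; apply: hprod1. Qed.

Lemma oplift_mul Z Z' : oplift (Z * Z') = oplift Z * oplift Z'.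
Proof. exact: linopP. Qed.

Lemma oplift_linear : linear oplift.
Proof. by move=> a Z Z'; apply: linopP. Qed.

Lemma oplift1 : oplift 1 = 1. Proof. exact: linopP. Qed.

Lemma oplift_exp Z n : oplift (Z ^+ n) = oplift Z ^+ n.
Proof. by elim: n => [|n IH]; rewrite ?expr0 ?oplift1 // !exprS oplift_mul IH. Qed.

Lemma opx_oplift Z : opx * oplift Z = oplift Z * opx.
Proof. exact: linopP. Qed.

Lemma opy_oplift Z : opy * oplift Z = oplift Z * opy.
Proof. exact: linopP. Qed.

Lemma opm_oplift f Z : opm f * oplift Z = oplift Z * opm f.
Proof.
apply: linopP => v; rewrite !linopME.
apply/funext => i; apply/funext => j.
have ZD a b : Z (a + b) = Z a + Z b by exact: raddfD.
change (hprod f (fun i j => Z (v i j)) i j = Z (hprod f v i j)).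
elim: i f v => [|i IH] f v; last first.
  rewrite -[hprod f v i.+1 j]/(hprod (dx f) v i j + hprod f (dx v) i j).
  by rewrite ZD -!IH.
elim: j f v => [|j IH] f v; first by rewrite hprod_00 linearZ.
rewrite -[hprod f v 0 j.+1]/(hprod (dy f) v 0 j + hprod f (dy v) 0 j).
by rewrite ZD -!IH.
Qed.

End HurwitzOperators.

Section HurwitzFrobenius.
Variables (F : fieldType) (p : nat) (charFp : p \in [pchar F]).
Variables (U : lmodType F) (nzU : exists u : U, u != 0).
Local Notation V := (nat -> nat -> U).
Local Notation coeff := (nat -> nat -> F^o).
Local Notation E := (linop (fun2_nontrivial nzU)).
Implicit Types (f g : coeff) (v : V).
Local Notation X := (opx nzU).
Local Notation Y := (opy nzU).
Local Notation M := (opm nzU).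

Let charE : p \in [pchar E] := pchar_alg _ charFp.

Lemma commutator_opx f : commutator X (M f) = M (dx f).
Proof. by rewrite /commutator opx_opm addrK. Qed.

Lemma commutator_opy f : commutator Y (M f) = M (dy f).
Proof. by rewrite /commutator opy_opm addrK. Qed.

Lemma iter_commutator_exp (R : nzRingType) (q n : nat) (a x : R) :
  q \in [pchar R] -> commutator (a ^+ (q ^ n)) x = iter (q ^ n) (commutator a) x.
Proof.
move=> charR; elim: n a x => [|n IH] a x; first by rewrite expr1.
rewrite expnSr exprM -(iter_commutator_pchar charR) mulnC iterM.
by apply: eq_iter => y; apply: IH.
Qed.

Lemma opx_exp_opm n f : X ^+ (p ^ n) * M f
  = M (iter (p ^ n) (@dx F) f) + M f * X ^+ (p ^ n).
Proof.
apply/eqP; rewrite -subr_eq; apply/eqP.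
rewrite -[LHS]/(commutator _ _) (iter_commutator_exp _ _ _ charE).
by elim: (p ^ n)%N => //= m ->; rewrite commutator_opx.
Qed.

Lemma opy_exp_opm n f : Y ^+ (p ^ n) * M f
  = M (iter (p ^ n) (@dy F) f) + M f * Y ^+ (p ^ n).
Proof.
apply/eqP; rewrite -subr_eq; apply/eqP.
rewrite -[LHS]/(commutator _ _) (iter_commutator_exp _ _ _ charE).
by elim: (p ^ n)%N => //= m ->; rewrite commutator_opy.
Qed.

Definition hpow f n : coeff := iter n (hprod f) (dpow F 0 0).

Lemma opm_hpow f n : M (hpow f n) = M f ^+ n.
Proof.
elim: n => [|n IH]; first by rewrite opm1.
by rewrite exprS -IH -opm_hprod.
Qed.

Lemma hpow_00 f n : hpow f n 0%N 0%N = f 0%N 0%N ^+ n.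
Proof. by elim: n => //= n IH; rewrite exprS -IH. Qed.

Let hpow_derivation (d : coeff -> coeff) f n :
  (forall g h, d (hprod g h) = hprod (d g) h + hprod g (d h)) ->
  d (dpow F 0 0) = 0 ->
  d (hpow f n.+1) = n.+1%:R *: hprod (hpow f n) (d f).
Proof.
move=> dM d1; elim: n => [|n IH].
  by rewrite scale1r /= dM d1 [X in _ + X]hprodC hprod0l addr0 hprodC.
rewrite -[hpow f n.+2]/(hprod f (hpow f n.+1)) dM IH hprodZr hprodC.
rewrite hprodA -[hprod f (hpow f n)]/(hpow f n.+1).
by rewrite -[n.+2]add1n natrD scalerDl scale1r.
Qed.

(** Its derivatives being divisible by [p], the [p]-th power of a function is
    the constant given by its value at the origin. *)
Lemma opm_exp_pchar f : M f ^+ p = ((f 0%N 0%N : F) ^+ p) *: 1.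
Proof.
have p_gt0 : (0 < p)%N := prime_gt0 (pcharf_prime charFp).
have p0 : p%:R = 0 :> F := pcharf0 charFp.
have pow0 d : (forall g h, d (hprod g h) = hprod (d g) h + hprod g (d h)) ->
    d (dpow F 0 0) = 0 -> d (hpow f p) = 0.
  by move=> dM d1; rewrite -(prednK p_gt0) hpow_derivation // prednK // p0 scale0r.
apply: linopP => v; rewrite -opm_hpow opmE hprod_const ?hpow_00 //.
  by apply: pow0 => //; exact: dx_hprod.
by apply: pow0 => //; [exact: dy_hprod | exact: dy_dpow0].
Qed.

End HurwitzFrobenius.

(** * Powers of sums, and the filtration by the order in y *)

Lemma horner_alg_coef (F : fieldType) (A : algType F) (a : A) (q : {poly F}) :
  horner_alg a q = \sum_(k < size q) q`_k *: a ^+ k.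
Proof.
rewrite /horner_alg /horner_morph horner_coef size_map_poly.
by apply: eq_bigr => k _; rewrite coef_map /= mulr_algl.
Qed.

Lemma horner_alg_comm (F : fieldType) (A : algType F) (a b : A) (q : {poly F}) :
  a * b = b * a -> horner_alg a q * b = b * horner_alg a q.
Proof.
move=> ab; rewrite horner_alg_coef mulr_suml mulr_sumr; apply: eq_bigr => k _.
by rewrite -scalerAl -scalerAr; congr (_ *: _); apply/esym/commrX/esym.
Qed.

Lemma iter_commutator_comm (R : nzRingType) (x y : R) n i :
  (forall k, commutator x (iter k (commutator y) x) = 0) ->
  commutator_coef x y n i = if i is 0 then iter n (commutator y) x else 0.
Proof.
move=> xy0; elim: n i => [|n IH] [|i] //=; rewrite !IH ?addr0 //.
case: i => [|i]; first by rewrite xy0 addr0 /commutator mulr0 mul0r subrr.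
by rewrite /commutator !mulr0 !mul0r subrr addr0.
Qed.

(** As [x] commutes with all the [ad (y) ^ k (x)], the only surviving term of
    Jacobson's formula is the one of degree [1] in [x]. *)
Lemma exprD_pchar_abelian (F : fieldType) (A : algType F) (p : nat)
    (charFp : p \in [pchar F]) (x y : A) :
  (forall k, commutator x (iter k (commutator y) x) = 0) ->
  (x + y) ^+ p = x ^+ p + y ^+ p + iter p.-1 (commutator y) x.
Proof.
move=> xy0; rewrite (exprD_jacobson charFp); congr (_ + _).
have p_gt1 := prime_gt1 (pcharf_prime charFp).
rewrite big_ltn // iter_commutator_comm //= invr1 scale1r.
rewrite big_nat big1 ?addr0 // => -[|[|i]] // _.
by rewrite iter_commutator_comm //= scaler0.
Qed.

Section Filtration.
Variables (F : fieldType) (U : lmodType F) (nzU : exists u : U, u != 0).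
Local Notation E := (linop (fun2_nontrivial nzU)).
Implicit Types (Z : E).

Definition ysupp (T : nmodType) k (v : nat -> nat -> T) :=
  forall i j, (j < k)%N -> v i j = 0.

(** [Z] raises the order in [y] by at least [d - l]. The gain [d] and the loss [l]
    are kept apart since the difference may be negative. *)
Definition yshift l d Z := forall k v, ysupp k v -> ysupp (k + d - l) (Z v).

Lemma yshift_weaken l l' d d' Z : (l <= l')%N -> (d' <= d)%N ->
  yshift l d Z -> yshift l' d' Z.
Proof.
move=> le_l le_d hZ k v kv i j lt_j; apply: (hZ k v kv).
by apply: leq_trans lt_j _; apply: leq_sub => //; rewrite leq_add2l.
Qed.

Lemma yshift0 l d : yshift l d 0.
Proof. by []. Qed.

Lemma yshiftD l d Z Z' : yshift l d Z -> yshift l d Z' -> yshift l d (Z + Z').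
Proof.
move=> hZ hZ' k v kv i j lt_j; rewrite linopDE.
by rewrite -[LHS]/(Z v i j + Z' v i j) (hZ k) // (hZ' k) // addr0.
Qed.

Lemma yshiftZ l d a Z : yshift l d Z -> yshift l d (a *: Z).
Proof.
move=> hZ k v kv i j lt_j; rewrite linopZE.
by rewrite -[LHS]/(a *: Z v i j) (hZ k) // scaler0.
Qed.

Lemma yshiftN l d Z : yshift l d Z -> yshift l d (- Z).
Proof. by rewrite -scaleN1r; apply: yshiftZ. Qed.

Lemma yshiftB l d Z Z' : yshift l d Z -> yshift l d Z' -> yshift l d (Z - Z').
Proof. by move=> hZ hZ'; apply: yshiftD => //; apply: yshiftN. Qed.

Lemma yshiftM l l' d d' Z Z' : yshift l d Z -> yshift l' d' Z' ->
  yshift (l + l') (d + d') (Z * Z').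
Proof.
move=> hZ hZ' k v kv i j lt_j; rewrite linopME.
apply: (hZ _ _ (hZ' _ _ kv)); apply: leq_trans lt_j _.
by lia.
Qed.

Lemma yshift_opx : yshift 0 0 (opx nzU).
Proof. by move=> k v kv i j lt_j; apply: kv; rewrite subn0 addn0 in lt_j. Qed.

Lemma yshift_opy : yshift 1 0 (opy nzU).
Proof. by move=> k v kv i j lt_j; apply: kv; lia. Qed.

Lemma yshift_oplift (Z : linop nzU) : yshift 0 0 (oplift Z).
Proof.
move=> k v kv i j lt_j; rewrite opliftE kv ?raddf0 //.
by rewrite subn0 addn0 in lt_j.
Qed.

Lemma ysupp_hprod a k (f : nat -> nat -> F^o) (v : nat -> nat -> U) :
  ysupp a f -> ysupp k v -> ysupp (k + a) (hprod f v).
Proof.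
move=> fa vk i; elim: i f fa v vk => [|i IH] f fa v vk j lt_j; last first.
  rewrite -[LHS]/(hprod (dx f) v i j + hprod f (dx v) i j).
  by rewrite !IH ?addr0 // => i' j'; [apply: vk | apply: fa].
elim: j a k f fa v vk lt_j => [|j IH] a k f fa v vk lt_j.
  rewrite hprod_00; case: a fa lt_j => [|a] fa lt_j; last by rewrite fa ?scale0r.
  by rewrite vk ?scaler0 // -[k]addn0.
rewrite -[LHS]/(hprod (dy f) v 0 j + hprod f (dy v) 0 j).
rewrite (IH a.-1 k) //; first 1 last.
- by move=> i' j' lt'; apply: fa; lia.
- by lia.
rewrite (IH a k.-1) ?addr0 //; first by move=> i' j' lt'; apply: vk; lia.
by lia.
Qed.

Lemma yshift_opm a f : ysupp a f -> yshift 0 a (opm nzU f).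
Proof. by move=> fa k v kv; rewrite subn0; apply: ysupp_hprod. Qed.

(** Every term of the expansion of [(T + R) ^ n] other than [T ^ n] has a factor
    [R], and its [n] factors lose at most [l.+1] each. *)
Lemma yshift_exp n l d (T R : E) : yshift 1 0 T -> yshift l d R ->
  yshift (n * l.+1) d ((T + R) ^+ n - T ^+ n).
Proof.
move=> hT hR.
have hTn m : yshift m 0 (T ^+ m).
  elim: m => [|m IH]; first by move=> k v kv; rewrite subn0 addn0.
  by rewrite exprS; apply: yshiftM hT IH.
elim: n => [|n IH]; first by rewrite subrr.
have -> : (T + R) ^+ n.+1 - T ^+ n.+1
    = (T + R) * ((T + R) ^+ n - T ^+ n) + R * T ^+ n.
  by rewrite !exprS mulrBr [(T + R) * T ^+ n]mulrDl opprD addrA subrK.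
apply: yshiftD.
  apply: (@yshift_weaken (l.+1 + n * l.+1) _ (0 + d)); rewrite ?mulSn //.
  apply: yshiftM => //; apply: yshiftD; first exact: (@yshift_weaken 1 _ 0).
  exact: (@yshift_weaken l _ d).
apply: (@yshift_weaken (l + n) _ (d + 0)); last exact: yshiftM.
  by rewrite mulSn leq_add // leq_pmulr.
by rewrite addn0.
Qed.

End Filtration.

(** * First-order differential operators *)

Section CoefficientAction.
Variable F : fieldType.
Local Notation coeff := (nat -> nat -> F^o).
Implicit Types (f g c : coeff) (a b : {poly F}).

Lemma field_nontrivial : exists u : F^o, u != 0.
Proof. by exists 1; apply: oner_neq0. Qed.

Definition pact a f : coeff := horner_alg (opx field_nontrivial) a f.

Lemma pactE a f i j : pact a f i j = \sum_(k < size a) a`_k * f (i + k)%N j.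
Proof.
rewrite /pact horner_alg_coef.
elim/big_ind2: _ => [|Z s Z' s' + +|k _] //.
  by move=> <- <-.
rewrite linopZE linopXE -[LHS]/(a`_k * _); congr (_ * _).
elim: (k : nat) i => [|n IH] i; first by rewrite addn0.
by rewrite iterS addnS -addSn -IH.
Qed.

Lemma pactM a b f : pact (a * b) f = pact a (pact b f).
Proof. by rewrite /pact rmorphM. Qed.
Lemma pactDl a b f : pact (a + b) f = pact a f + pact b f.
Proof. by rewrite /pact rmorphD. Qed.
Lemma pactNl a f : pact (- a) f = - pact a f.
Proof. by rewrite /pact rmorphN. Qed.
Lemma pactZl k a f : pact (k *: a) f = k *: pact a f.
Proof. by rewrite /pact linearZ. Qed.
Lemma pact0l f : pact 0 f = 0.
Proof. by rewrite /pact rmorph0. Qed.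
Lemma pact1 f : pact 1 f = f.
Proof. by rewrite /pact rmorph1. Qed.
Lemma pactX f : pact 'X f = dx f.
Proof. by rewrite /pact horner_algX. Qed.

Lemma dy_pact a f : dy f = 0 -> dy (pact a f) = 0.
Proof.
move=> fy; have := horner_alg_comm a (opxy field_nontrivial).
move/(congr1 (fun Z : linop _ => Z f)); rewrite !linopME !opyE fy raddf0.
by move=> <-.
Qed.

End CoefficientAction.

Section Twisted.
Variables (F : fieldType) (p : nat) (charFp : p \in [pchar F]).
Variables (U : lmodType F) (nzU : exists u : U, u != 0).
Local Notation coeff := (nat -> nat -> F^o).
Local Notation E := (linop (fun2_nontrivial nzU)).
Local Notation X := (opx nzU).
Local Notation Y := (opy nzU).
Local Notation M := (opm nzU).
Implicit Types (f g c : coeff) (a b : {poly F}).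

Let charE : p \in [pchar E] := pchar_alg _ charFp.

Definition diffop a g : E := horner_alg X a + M g * Y.

(** [a (X)] is a derivation: [a] is a combination of the [X ^ (p ^ i)]. *)
Definition derivation_poly a :=
  forall f, commutator (horner_alg X a) (M f) = M (pact a f).

Lemma derivation_poly0 : derivation_poly 0.
Proof.
by move=> f; rewrite rmorph0 /commutator mul0r mulr0 subrr pact0l opm0.
Qed.

Lemma derivation_polyX : derivation_poly 'X.
Proof. by move=> f; rewrite horner_algX commutator_opx pactX. Qed.

Lemma derivation_poly_lin k a b : derivation_poly a -> derivation_poly b ->
  derivation_poly (k *: a + b).
Proof.
move=> da db f; rewrite pactDl pactZl opmD opmZ -da -db /commutator.
rewrite linearP /= mulrDl mulrDr -!scalerAl !mul1r -!scalerAr.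
by rewrite opprD addrACA -scalerBr.
Qed.

Lemma iter_commutator_derivation n a f : derivation_poly a ->
  iter n (commutator (horner_alg X a)) (M f) = M (pact (a ^+ n) f).
Proof.
move=> da; elim: n => [|n IH]; first by rewrite pact1.
by rewrite iterS IH da exprS pactM.
Qed.

Lemma derivation_poly_exp a : derivation_poly a -> derivation_poly (a ^+ p).
Proof.
move=> da f; rewrite rmorphXn /= -(iter_commutator_pchar charE).
exact: iter_commutator_derivation.
Qed.

Let hornerY a : horner_alg X a * Y = Y * horner_alg X a.
Proof. by apply: horner_alg_comm; apply: opxy. Qed.

Let opm_Y g : dy g = 0 -> Y * M g = M g * Y.
Proof. by move=> gy; rewrite opy_opm gy opm0 add0r. Qed.

Lemma commutator_opm_opy a g : derivation_poly a ->
  commutator (horner_alg X a) (M g * Y) = M (pact a g) * Y.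
Proof.
move=> da; rewrite /commutator -[X in _ - X]mulrA -hornerY -da !mulrA -mulrBl.
by [].
Qed.

Lemma opm_opy_comm f g : dy f = 0 -> dy g = 0 ->
  commutator (M f * Y) (M g * Y) = 0.
Proof.
move=> fy gy; rewrite /commutator -!mulrA ![Y * (_ * _)]mulrA !opm_Y // !mulrA.
by rewrite opmC subrr.
Qed.

Lemma diffop_commutator a b f g : derivation_poly a -> derivation_poly b ->
  dy f = 0 -> dy g = 0 ->
  commutator (diffop a f) (diffop b g) = M (pact a g - pact b f) * Y.
Proof.
move=> da db fy gy.
rewrite /diffop commutatorDl !commutatorDr opm_opy_comm // addr0.
rewrite {1}/commutator -!rmorphM mulrC subrr add0r.
rewrite [X in _ + X]commutatorC !commutator_opm_opy //.
by rewrite -mulrBl -scaleN1r -opmZ -opmD scaleN1r.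
Qed.

(** The operators [f d / dy] with [f] a function of [x] commute, which leaves only the
    terms of [exprD_pchar_abelian]; and [(g d / dy) ^ p] is zero because [g ^ p] is the
    constant [g (0) ^ p = 0]. *)
Lemma diffop_exp a g : derivation_poly a -> dy g = 0 -> g 0%N 0%N = 0 ->
  diffop a g ^+ p = diffop (a ^+ p) (pact (a ^+ p.-1) g).
Proof.
move=> da gy g0.
have p_gt0 : (0 < p)%N := prime_gt0 (pcharf_prime charFp).
have iterP k : iter k (commutator (horner_alg X a)) (M g * Y)
    = M (pact (a ^+ k) g) * Y.
  elim: k => [|k IH]; first by rewrite pact1.
  by rewrite iterS IH commutator_opm_opy // exprS pactM.
rewrite /diffop addrC (exprD_pchar_abelian charFp); last first.
  by move=> k; rewrite iterP opm_opy_comm // dy_pact.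
rewrite iterP exprMn_comm; last by rewrite /GRing.comm opm_Y.
rewrite (opm_exp_pchar charFp) g0 expr0n gtn_eqF // scale0r mul0r add0r.
by rewrite rmorphXn.
Qed.

End Twisted.

(** * The representation of a free algebra *)

Section FreeGenerated.
Variables (F : fieldType) (p : nat) (L : rlieAlgType F p).
Variables (X : Type) (iota : X -> L).

(** The endomorphism of [L] that factors through [S] fixes the generators, hence is
    the identity. *)
Lemma free_generated : is_free_on iota -> generated_by iota.
Proof.
move=> free S iotaS x.
have [f [[fM fP] f_iota _]] := free (subalg_type S) (fun i => SubalgElt (iotaS i)).
have [h [_ _ h_uniq]] := free L iota.
pose f' : {linear L -> L} := \val \o f.
have -> : x = f' x.
  have f'h : f' =1 h.
    apply: h_uniq => [|i]; last by rewrite /= f_iota.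
    by split=> [y z|y]; rewrite /= ?fM ?fP.
  by rewrite f'h -(h_uniq idfun).
exact: subalg_valP.
Qed.

End FreeGenerated.

Section Representation.
Variables (F : fieldType) (p : nat) (charFp : p \in [pchar F]).
Variables (L : rlieAlgType F p) (X : Type) (iota : X -> L).
Hypothesis iota_gen : generated_by iota.
Variables (x0 y0 : X).
Local Notation nzW := (word_space_nontrivial F).
Local Notation A := (linop (fun2_nontrivial nzW)).
Local Notation E := (assoc_rlie charFp A).
Local Notation coeff := (nat -> nat -> F^o).
Local Notation letter b := (shift F [:: b]).
Implicit Types (c : coeff) (h : L).

Let p_gt0 : (0 < p)%N := prime_gt0 (pcharf_prime charFp).

(** The two letters appear with the factors [y ^ e / e!] and [x y ^ e / e!]: of high
    order in [y], hence negligible for [wreath_form], but within reach of derivatives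
    for [acts_at_origin_onto]. *)
Definition yimage c e : A :=
  opm nzW c * opy nzW
  + (opm nzW (dpow F 0 e) * oplift (letter false)
     + opm nzW (dpow F 1 e) * oplift (letter true)).

Definition gen_image c e (x : X) : E :=
  if `[< x = x0 >] then opx nzW else if `[< x = y0 >] then yimage c e else 0.

Definition is_wreath_rep c e (rho : {linear L -> E}) : Prop :=
  is_rlie_morphism rho /\ forall x, rho (iota x) = gen_image c e x.

(** Vanishing to order [D] makes [b (d / dx) c] vanish at the origin for every
    polynomial [b] of size at most [D], as the formula for [p]-th powers requires. *)
Definition good_coeff D c : Prop :=
  dy c = 0 /\ forall i, (i < D)%N -> c i 0%N = 0.

(** Up to terms of high order in [y], an element of [L] acts as
    [a (d / dx) + (b (d / dx) c) d / dy], where the polynomials [a] and [b] do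
    not depend on the parameters [c] and [e] of the representation. *)
Definition wreath_form h : Prop :=
  exists (D : nat) (a b : {poly F}), [/\ a`_0 = 0, derivation_poly nzW a, (size b <= D)%N &
    forall c e rho, is_wreath_rep c e rho -> good_coeff D c ->
      yshift D e ((rho h : A) - diffop nzW a (pact b c))].

Lemma good_coeff_weaken D D' c : (D <= D')%N -> good_coeff D' c -> good_coeff D c.
Proof. by move=> le_D [cy c0]; split=> // i lt_i; apply: c0 (leq_trans lt_i le_D). Qed.

Lemma diffop_lin k a b f g :
  diffop nzW (k *: a + b) (k *: f + g) = k *: diffop nzW a f + diffop nzW b g.
Proof.
rewrite /diffop linearP /= -scalerAl mul1r opmD opmZ mulrDl -scalerAl scalerDr.
exact: addrACA.
Qed.

Lemma wreath_form0 : wreath_form 0.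
Proof.
exists 0%N, 0, 0; split; rewrite ?size_poly0 ?coef0 //.
  exact: derivation_poly0.
move=> c e rho _ _; rewrite raddf0 pact0l /diffop rmorph0 opm0 mul0r addr0 subrr.
exact: yshift0.
Qed.

Lemma wreath_form_lin k h h' :
  wreath_form h -> wreath_form h' -> wreath_form (k *: h + h').
Proof.
move=> [D [a [b [a0 da sb hD]]]] [D' [a' [b' [a'0 da' sb' hD']]]].
exists (maxn D D'), (k *: a + a'), (k *: b + b'); split.
- by rewrite coefD coefZ a0 a'0 mulr0 addr0.
- exact: derivation_poly_lin.
- apply: leq_trans (size_polyD _ _) _; rewrite geq_max !leq_max sb' orbT andbT.
  by rewrite (leq_trans (size_scale_leq _ _) sb).
move=> c e rho rep cD.
have /(hD _ _ _ rep) h1 : good_coeff D c by apply: good_coeff_weaken cD; rewrite leq_maxl.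
have /(hD' _ _ _ rep) h2 : good_coeff D' c by apply: good_coeff_weaken cD; rewrite leq_maxr.
have -> : (rho (k *: h + h') : A) - diffop nzW (k *: a + a') (pact (k *: b + b') c)
   = k *: ((rho h : A) - diffop nzW a (pact b c))
     + ((rho h' : A) - diffop nzW a' (pact b' c)).
  by rewrite linearP pactDl pactZl diffop_lin scalerBr opprD addrACA.
apply: yshiftD.
  by apply: yshiftZ; apply: (yshift_weaken _ _ h1); rewrite ?leq_maxl.
by apply: (yshift_weaken _ _ h2); rewrite ?leq_maxr.
Qed.

Lemma yshift_diffop a g : yshift 1 0 (diffop nzW a g).
Proof.
apply: yshiftD; last first.
  have := yshiftM (@yshift_opm _ _ nzW 0 g _) (yshift_opy nzW).
  by apply => i j.
rewrite horner_alg_coef; elim/big_ind: _ => [|Z Z'|k _].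
- exact: yshift0.
- exact: yshiftD.
apply: yshiftZ; apply: (@yshift_weaken _ _ _ 0 _ 0) => //.
elim: (k : nat) => [|n IH]; first by move=> m v mv; rewrite subn0 addn0.
by rewrite exprS; apply: (yshiftM (yshift_opx nzW) IH).
Qed.

(** The bracket of the main terms is given by [diffop_commutator]. The size of the
    new polynomial is added to the order [D], which has to bound it. *)
Lemma wreath_form_lie h h' : wreath_form h -> wreath_form h' ->
  wreath_form (lie h h').
Proof.
move=> [D [a [b [a0 da sb hD]]]] [D' [a' [b' [a'0 da' sb' hD']]]].
exists (D + D' + 1 + size ((a * b' - a' * b)%R))%N, 0, (a * b' - a' * b); split.
- by rewrite coef0.
- exact: derivation_poly0.
- by rewrite leq_addl.
move=> c e rho rep cD.
have /(hD _ _ _ rep) h1 : good_coeff D c by apply: good_coeff_weaken cD; lia.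
have /(hD' _ _ _ rep) h2 : good_coeff D' c by apply: good_coeff_weaken cD; lia.
have [cy _] := cD; have [[rhoM _] _] := rep.
set T := diffop _ _ _ in h1; set T' := diffop _ _ _ in h2.
have -> : diffop nzW 0 (pact (a * b' - a' * b) c) = commutator T T'.
  rewrite diffop_commutator ?dy_pact // /diffop rmorph0 add0r.
  by rewrite pactDl pactNl !pactM.
have prod_shift (l l' : nat) (Z W S S' : A) : yshift 1 0 S -> yshift 1 0 S' ->
    yshift l e (Z - S) -> yshift l' e (W - S') ->
    yshift (l + l' + 1) e (Z * W - S * S').
  move=> hS hS' hZ hW.
  have -> : Z * W - S * S' = (Z - S) * W + S * (W - S').
    by rewrite mulrBl mulrBr addrA subrK.
  apply: yshiftD; last first.
    by apply: (@yshift_weaken _ _ _ (1 + l') _ (0 + e)); [lia | | exact: yshiftM].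
  apply: (@yshift_weaken _ _ _ (l + (1 + l')) _ (e + 0)); [lia | lia |].
  apply: yshiftM => //; rewrite -(subrK S' W) addrC; apply: yshiftD.
    by apply: (@yshift_weaken _ _ _ 1 _ 0) => //; lia.
  by apply: (@yshift_weaken _ _ _ l' _ e) => //; lia.
have hT1 : yshift 1 0 T := yshift_diffop _ _.
have hT2 : yshift 1 0 T' := yshift_diffop _ _.
have -> : (rho (lie h h') : A) - commutator T T'
  = ((rho h : A) * (rho h' : A) - T * T') - ((rho h' : A) * (rho h : A) - T' * T).
  have subrACA (x y u v : A) : x - y - (u - v) = x - u - (y - v).
    by rewrite !opprB addrACA [RHS]addrACA [- y - u]addrC.
  by rewrite rhoM lie_assocE subrACA.
apply: (@yshift_weaken _ _ _ (D + D' + 1) _ e) => //; first by lia.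
apply: yshiftB; first exact: prod_shift.
by rewrite (addnC D); apply: prod_shift.
Qed.

Lemma wreath_form_ppow h : wreath_form h -> wreath_form (ppow h).
Proof.
move=> [D [a [b [a0 da sb hD]]]].
pose b' := a ^+ p.-1 * b.
exists (p * D.+1 + size b')%N, (a ^+ p), b'; split.
- rewrite -horner_coef0 horner_exp horner_coef0 a0 expr0n gtn_eqF //.
- exact: derivation_poly_exp.
- by rewrite leq_addl.
move=> c e rho rep cD.
have cDD : good_coeff D c.
  apply: good_coeff_weaken cD; apply: leq_trans (leq_addr _ _).
  by apply: leq_trans (leqnSn D) _; rewrite leq_pmull.
have [[_ rhoP] _] := rep; have [cy c0] := cDD.
have := hD _ _ _ rep cDD; set T := diffop _ _ _ => hT.
have := @yshift_exp _ _ _ p _ _ _ _ (yshift_diffop a (pact b c)) hT.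
rewrite -/T [T + _]addrC subrK -[X in X - _]/(ppow (rho h : E)) -rhoP => hp.
have T_exp : T ^+ p = diffop nzW (a ^+ p) (pact b' c).
  rewrite (diffop_exp charFp) ?dy_pact ?pactM // pactE big1 // => k _.
  by rewrite add0n c0 ?mulr0 // (leq_trans _ sb).
by rewrite -T_exp; apply: yshift_weaken hp => //; rewrite leq_addr.
Qed.

Lemma wreath_form_gen x : wreath_form (iota x).
Proof.
have [xx0|xx0] := asboolP (x = x0).
  exists 0%N, 'X, 0; split; rewrite ?size_poly0 ?coefX //.
    exact: derivation_polyX.
  move=> c e rho [_ ->] _; rewrite /gen_image asboolT // /diffop pact0l opm0.
  by rewrite mul0r addr0 horner_algX subrr; exact: yshift0.
have [xy0|xy0] := asboolP (x = y0).
  exists 1%N, 0, 1; split; rewrite ?size_poly1 ?coef0 //.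
    exact: derivation_poly0.
  move=> c e rho [_ ->] _; rewrite /gen_image asboolF // asboolT //.
  rewrite /diffop pact1 rmorph0 add0r /yimage [X in X - _]addrC addrK.
  have dpow_shift i b : yshift 0 e (opm nzW (dpow F i e) * oplift (letter b)).
    have := @yshiftM _ _ nzW 0 0 e 0 _ _ _ (yshift_oplift (letter b)).
    rewrite !addn0; apply; apply: yshift_opm => j k lt_k.
    by rewrite /dpow (ltn_eqF lt_k) andbF.
  by apply: (@yshift_weaken _ _ _ 0 _ e) => //; apply: yshiftD.
exists 0%N, 0, 0; split; rewrite ?size_poly0 ?coef0 //.
  exact: derivation_poly0.
move=> c e rho [_ ->] _; rewrite /gen_image !asboolF // pact0l /diffop.
by rewrite rmorph0 opm0 mul0r addr0 subrr; exact: yshift0.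
Qed.

Lemma wreath_formP h : wreath_form h.
Proof.
move: h; apply: (generated_ind iota_gen).
- exact: wreath_form0.
- exact: wreath_form_lin.
- exact: wreath_form_lie.
- exact: wreath_form_ppow.
- exact: wreath_form_gen.
Qed.

End Representation.

(** * Choosing the coefficient of d / dy *)

Lemma left_kernel_exists (F : fieldType) (T : finType) (m : nat) (A : 'I_m -> T -> F) :
  (#|T| < m)%N -> exists x : 'I_m -> F,
    (exists u, x u != 0) /\ forall t, \sum_u x u * A u t = 0.
Proof.
move=> lt_Tm; pose B := \matrix_(u < m, t < #|T|) A u (enum_val t).
have : kermx B != 0.
  rewrite kermx_eq0 -row_leq_rank -ltnNge.
  exact: leq_ltn_trans (rank_leq_col B) lt_Tm.
move=> /rowV0Pn[x /sub_kermxP xB0 x0]; exists (fun u => x 0 u); split.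
  apply/existsP; apply: contraNT x0; rewrite negb_exists => /forallP x0.
  by apply/eqP/rowP => u; rewrite mxE; have /negbNE/eqP := x0 u.
move=> t; have /rowP/(_ (enum_rank t)) := xB0; rewrite !mxE => xBt.
by apply: etrans xBt; apply: eq_bigr => u _; rewrite mxE enum_rankK.
Qed.

Lemma expn_dominates (p D k : nat) : (1 < p)%N ->
  exists s, (D + k * s.+1 < p ^ s)%N.
Proof.
move=> p_gt1; exists ((D + 2 * k) * 2)%N; rewrite expnM.
have : (D + 2 * k < p ^ (D + 2 * k))%N by apply: ltn_expl.
by move: (p ^ _)%N => N; nia.
Qed.

Section WreathPowers.
Variables (F : fieldType) (p : nat) (charFp : p \in [pchar F]).
Variables (L : rlieAlgType F p) (X : Type) (iota : X -> L).
Hypothesis iota_gen : generated_by iota.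
Variables (x0 y0 : X).
Local Notation nzW := (word_space_nontrivial F).
Local Notation A := (linop (fun2_nontrivial nzW)).
Local Notation E := (assoc_rlie charFp A).
Local Notation coeff := (nat -> nat -> F^o).
Local Notation is_rep := (is_wreath_rep iota x0 y0).
Implicit Types (c : coeff) (h : L) (v : nat -> nat -> seq bool -> F^o).

Lemma pact_dpow (a : {poly F}) i : pact a (dpow F i 0) 0%N 0%N = a`_i.
Proof.
rewrite pactE /dpow.
have [lt_i|le_i] := ltnP i (size a).
  rewrite (bigD1 (Ordinal lt_i)) //= add0n eqxx mulr1 big1 ?addr0 // => k ne_k.
  by rewrite add0n -[_ == _]/(k == Ordinal lt_i) (negPf ne_k) mulr0.
rewrite nth_default // big1 // => k _; rewrite add0n ltn_eqF ?mulr0 //.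
exact: leq_trans (ltn_ord k) le_i.
Qed.

Lemma iter_dxE n (T : Type) (w : nat -> nat -> T) i j :
  iter n (@dx T) w i j = w (i + n)%N j.
Proof. by elim: n i => [|n IH] i; rewrite ?addn0 // iterS addnS -addSn -IH. Qed.

Lemma iter_dyE n (T : Type) (w : nat -> nat -> T) i j :
  iter n (@dy T) w i j = w i (j + n)%N.
Proof. by elim: n j => [|n IH] j; rewrite ?addn0 // iterS addnS -addSn -IH. Qed.

Let q_pred n : (p ^ n * p.-1 + (p ^ n).-1 = (p ^ n.+1).-1)%N.
Proof.
have p_gt0 : (0 < p)%N := prime_gt0 (pcharf_prime charFp).
have := expn_gt0 p n; rewrite p_gt0 expnSr /=.
by case: (p ^ n)%N => // m _; case: (p) p_gt0 => // r _ /=; lia.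
Qed.

(** The obstruction to iterating the formula of [wreath_form] is the value of
    the coefficient at the origin, whose [p]-th power would appear. *)
Lemma wreath_form_iter h (D : nat) (a b : {poly F}) c s :
  derivation_poly nzW a -> dy c = 0 ->
  (forall e (rho : {linear L -> E}), is_rep c e rho ->
     yshift D e ((rho h : A) - diffop nzW a (pact b c))) ->
  (forall i, (i <= s)%N -> pact (a ^+ (p ^ i).-1 * b) c 0%N 0%N = 0) ->
  forall n, (n <= s.+1)%N -> exists D', forall e (rho : {linear L -> E}),
    is_rep c e rho ->
    yshift D' e ((rho h : A) ^+ (p ^ n)
      - diffop nzW (a ^+ (p ^ n)) (pact (a ^+ (p ^ n).-1 * b) c)).
Proof.
move=> da cy hD cond; elim=> [|n IH] lt_n.
  by exists D => e rho /hD; rewrite expn0 !expr1 mul1r.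
have [D' hD'] := IH (ltnW lt_n); exists (p * D'.+1)%N => e rho rep.
set T := diffop _ _ _.
have dan m : derivation_poly nzW (a ^+ (p ^ m)).
  elim: m => [//|m IHm]; rewrite expnSr exprM.
  exact: derivation_poly_exp.
have -> : T = diffop nzW (a ^+ (p ^ n)) (pact (a ^+ (p ^ n).-1 * b) c) ^+ p.
  rewrite (diffop_exp charFp) ?dy_pact // ?cond // -pactM mulrA.
  by rewrite -!exprM -exprD -expnSr q_pred.
have := hD' _ _ rep; set T0 := diffop _ _ _ => hT0.
have := @yshift_exp _ _ _ p _ _ T0 _ (yshift_diffop _ _) hT0.
by rewrite [T0 + _]addrC subrK -exprM -expnSr.
Qed.

Let x_nilp (s : nat) (a : {poly F}) n : a`_0 = 0 -> (p ^ s <= n)%N ->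
  exists a', a ^+ n = a' * 'X^(p ^ s).
Proof.
move=> a0 le_n.
have /dvdpP[a1 ->] : 'X %| a.
  by rewrite -['X]subr0 -polyC0 dvdp_XsubCl /root horner_coef0 a0.
exists (a1 ^+ n * 'X^(n - p ^ s)).
by rewrite exprMn -mulrA -exprD subnK.
Qed.

(** One power of [p] beyond [p ^ s] makes both exponents at least [p ^ s], and
    [a ^ n] is divisible by ['X ^ n]. *)
Lemma diffop_kill (s : nat) (a b : {poly F}) c v :
  a`_0 = 0 -> iter (p ^ s) (@dx _) c = 0 -> iter (p ^ s) (@dx _) v = 0 ->
  diffop nzW (a ^+ (p ^ s.+1)) (pact (a ^+ (p ^ s.+1).-1 * b) c) v = 0.
Proof.
have p_gt1 : (1 < p)%N := prime_gt1 (pcharf_prime charFp).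
move=> a0 cx vx; have [a1 ->] := x_nilp a0 (leq_pexp2l (ltnW p_gt1) (leqnSn s)).
have [|a2 ->] := @x_nilp s a (p ^ s.+1).-1 a0.
  have : (0 < p ^ s)%N by rewrite expn_gt0 (ltnW p_gt1).
  by rewrite expnS; nia.
have pactXn : pact 'X^(p ^ s) c = 0.
  by rewrite /pact rmorphXn /= horner_algX linopXE.
rewrite /diffop mulrAC pactM pactXn [X in opm nzW X]raddf0 opm0 mul0r addr0.
by rewrite rmorphM linopME rmorphXn /= horner_algX linopXE vx raddf0.
Qed.

(** The functions [c] of [x] with exponents from [D0] to [p ^ s - 1] form a space of
    dimension [p ^ s - D0], on which [wreath_form_iter] imposes [k (s + 1)] linear
    conditions; [s] is chosen so that a nonzero solution exists. *)
Lemma wreath_parameters k (h : 'I_k -> L) : exists s c,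
  [/\ dy c = 0, iter (p ^ s) (@dx _) c = 0,
      exists2 j, (1 < j < p ^ s)%N & c j 0%N != 0
    & exists D, forall e (rho : {linear L -> E}), is_rep c e rho ->
        forall l, exists2 Z : A, yshift D e Z
          & forall v, iter (p ^ s) (@dx _) v = 0 ->
              ((rho (h l) : A) ^+ (p ^ s.+1)) v = Z v].
Proof.
have p_gt1 : (1 < p)%N := prime_gt1 (pcharf_prime charFp).
have /choice[D /choice[a /choice[b form]]] l := wreath_formP charFp iota_gen x0 y0 (h l).
(* The maximum serves [good_coeff]. The summand [2] makes the exponents of [c]
   at least [2], so that [(d / dx) ^ j] kills the factor [x] of the second letter in
   [acts_at_origin_onto]. *)
pose D0 := (2 + \max_l D l)%N.
have [s lt_s] := expn_dominates D0 k p_gt1.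
pose m := (p ^ s - D0)%N.
pose poly_of (t : 'I_k * 'I_s.+1) := a t.1 ^+ (p ^ t.2).-1 * b t.1.
have lt_m : (#|{: 'I_k * 'I_s.+1}| < m)%N.
  by rewrite card_prod !card_ord /m ltn_subRL.
have [x [[u xu] x_ker]] :=
  left_kernel_exists (fun (u : 'I_m) t => (poly_of t)`_(D0 + u)) lt_m.
pose c : coeff := \sum_(u < m) x u *: dpow F (D0 + u) 0.
have c_sum (f : {linear coeff -> coeff}) :
    f c = \sum_(u < m) x u *: f (dpow F (D0 + u) 0).
  by rewrite /c linear_sum; apply: eq_bigr => w _; exact: linearZ_LR.
have sumE (d : 'I_m -> coeff) i j : (\sum_(u < m) x u *: d u) i j
    = \sum_(u < m) x u * d u i j.
  by rewrite !fct_sumE.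
have cE i : c i 0%N = \sum_(u < m) x u * (i == D0 + u)%N%:R.
  by rewrite /c sumE; apply: eq_bigr => w _; rewrite /dpow andbT.
have cy : dy c = 0.
  apply: etrans (c_sum (opy (field_nontrivial F))) _; apply: big1 => w _.
  by rewrite [X in _ *: X]dy_dpow0 scaler0.
have c_low i : (i < D0)%N -> c i 0%N = 0.
  move=> lt_i; rewrite cE big1 // => w _; rewrite ltn_eqF ?mulr0 //.
  exact: leq_trans lt_i (leq_addr _ _).
have cx : iter (p ^ s) (@dx _) c = 0.
  apply/funext => i; apply/funext => j; rewrite iter_dxE /c sumE big1 // => w _.
  rewrite /dpow gtn_eqF ?mulr0 //; apply: leq_trans (leq_addl _ _).
  by rewrite -ltn_subRL.
exists s, c; split=> //.
  exists (D0 + u)%N.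
    apply/andP; split; first exact: leq_trans (leq_addr _ _) (leq_addr _ _).
    by rewrite -ltn_subRL.
  rewrite cE (bigD1 u) //= eqxx mulr1 big1 ?addr0 // => w ne_w.
  by rewrite eqn_add2l eq_sym (inj_eq val_inj) (negPf ne_w) mulr0.
have cond l i : (i <= s)%N -> pact (a l ^+ (p ^ i).-1 * b l) c 0%N 0%N = 0.
  rewrite -ltnS => lt_i; rewrite -[RHS](x_ker (l, Ordinal lt_i)).
  set r := a l ^+ _ * b l; set Z := horner_alg (opx (field_nontrivial F)) r.
  rewrite -[LHS]/(Z c 0%N 0%N) (c_sum Z) sumE.
  by apply: eq_bigr => w _; rewrite -[LHS]/(_ * pact _ _ 0%N 0%N) pact_dpow.
have good l : good_coeff (D l) c.
  split=> // i lt_i; apply: c_low; apply: leq_trans lt_i _.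
  by apply: leq_trans (leq_addl _ _); apply: leq_bigmax.
have power l : exists D', forall e (rho : {linear L -> E}), is_rep c e rho ->
    yshift D' e ((rho (h l) : A) ^+ (p ^ s.+1)
     - diffop nzW (a l ^+ (p ^ s.+1)) (pact (a l ^+ (p ^ s.+1).-1 * b l) c)).
  have [_ da _ hD] := form l.
  apply: (@wreath_form_iter _ (D l) _ _ _ s) => // [e rho rep|i]; last exact: cond.
  exact: hD.
have [D' hD'] := choice power.
exists (\max_l D' l) => e rho rep l.
exists ((rho (h l) : A) ^+ (p ^ s.+1)
  - diffop nzW (a l ^+ (p ^ s.+1)) (pact (a l ^+ (p ^ s.+1).-1 * b l) c)).
  by apply: yshift_weaken (hD' l e rho rep) => //; apply: leq_bigmax.
move=> v vx; rewrite linopDE linopNE diffop_kill ?subr0 //.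
by have [] := form l.
Qed.

End WreathPowers.

(** * The invariant box of functions *)

Section Box.
Variables (F : fieldType) (p : nat) (charFp : p \in [pchar F]).
Local Notation coeff := (nat -> nat -> F^o).

Definition in_box (T : nmodType) s t (v : nat -> nat -> T) : Prop :=
  iter (p ^ s) (@dx T) v = 0 /\ iter (p ^ t) (@dy T) v = 0.

Variables (U : lmodType F) (nzU : exists u : U, u != 0) (s t : nat).
Implicit Types (f : coeff) (v w : nat -> nat -> U).

Lemma in_box_lin a v w : in_box s t v -> in_box s t w -> in_box s t (a *: v + w).
Proof.
have lin (d : (nat -> nat -> U) -> nat -> nat -> U) n :
    (forall x y, d (a *: x + y) = a *: d x + d y) ->
    iter n d (a *: v + w) = a *: iter n d v + iter n d w.
  by move=> ld; elim: n => //= n ->; rewrite ld.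
by move=> [vx vy] [wx wy]; split; rewrite lin // ?vx ?vy ?wx ?wy scaler0 addr0.
Qed.

Lemma in_box_dx v : in_box s t v -> in_box s t (dx v).
Proof.
move=> [vx vy]; split; first by rewrite -iterSr iterS vx.
have -> : iter (p ^ t) (@dy U) (dx v) = dx (iter (p ^ t) (@dy U) v).
  by elim: (p ^ t)%N => //= n ->.
by rewrite vy.
Qed.

Lemma in_box_dy v : in_box s t v -> in_box s t (dy v).
Proof.
move=> [vx vy]; split; last by rewrite -iterSr iterS vy.
have -> : iter (p ^ s) (@dx U) (dy v) = dy (iter (p ^ s) (@dx U) v).
  by elim: (p ^ s)%N => //= n ->.
by rewrite vx.
Qed.

Lemma in_box_oplift (Z : linop nzU) v : in_box s t v -> in_box s t (oplift Z v).
Proof.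
move=> [vx vy]; split; apply/funext => i; apply/funext => j.
  rewrite iter_dxE opliftE -iter_dxE vx; exact: raddf0.
rewrite iter_dyE opliftE -iter_dyE vy; exact: raddf0.
Qed.

(** The operators [(d / dx) ^ (p ^ s)] and [(d / dy) ^ (p ^ t)] are derivations. *)
Lemma in_box_hprod f v : in_box s t f -> in_box s t v -> in_box s t (hprod f v).
Proof.
move=> [fx fy] [vx vy]; split.
  have := congr1 (fun Z : linop _ => Z v) (opx_exp_opm charFp nzU s f).
  rewrite linopDE !linopME !linopXE fx opm0 linop0E add0r.
  by rewrite [iter _ (opx nzU) v]vx raddf0.
have := congr1 (fun Z : linop _ => Z v) (opy_exp_opm charFp nzU t f).
rewrite linopDE !linopME !linopXE fy opm0 linop0E add0r.
by rewrite [iter _ (opy nzU) v]vy raddf0.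
Qed.

Lemma in_box_dpow i j : (i < p ^ s)%N -> (j < p ^ t)%N -> in_box s t (dpow F i j).
Proof.
move=> lt_i lt_j; split; apply/funext => a; apply/funext => b.
  by rewrite iter_dxE /dpow gtn_eqF // (leq_trans lt_i) ?leq_addl.
by rewrite iter_dyE /dpow andbC gtn_eqF // (leq_trans lt_j) ?leq_addl.
Qed.

Lemma ysupp_box v : in_box s t v -> ysupp (p ^ t) v -> v = 0.
Proof.
move=> [_ vy] v0; apply/funext => i; apply/funext => j.
have [lt_j|le_j] := ltnP j (p ^ t); first exact: v0.
by rewrite -(subnK le_j) -iter_dyE vy.
Qed.

End Box.

Section BoxRepresentation.
Variables (F : fieldType) (p : nat) (charFp : p \in [pchar F]).
Variables (L : rlieAlgType F p) (X : Type) (iota : X -> L).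
Hypothesis iota_gen : generated_by iota.
Variables (x0 y0 : X).
Local Notation nzW := (word_space_nontrivial F).
Local Notation A := (linop (fun2_nontrivial nzW)).
Local Notation E := (assoc_rlie charFp A).
Local Notation coeff := (nat -> nat -> F^o).
Local Notation box := (in_box p).
Variables (c : coeff) (e s t : nat) (rho : {linear L -> E}).
Hypotheses (cy : dy c = 0) (cx : iter (p ^ s) (@dx _) c = 0).
Hypotheses (rep : is_wreath_rep iota x0 y0 c e rho) (lt_e : (e < p ^ t)%N).
Hypothesis (lt_1 : (1 < p ^ s)%N).

Let p_gt0 : (0 < p)%N := prime_gt0 (pcharf_prime charFp).

Lemma iter_linop0 (V : lmodType F) (nzV : exists v : V, v != 0) (Z : linop nzV) n :
  iter n Z 0 = 0.
Proof. by elim: n => //= n ->; rewrite raddf0. Qed.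

Lemma rep_box (x : L) v : box s t v -> box s t ((rho x : A) v).
Proof.
have [[rhoM rhoP] rho_gen] := rep.
move: x v; apply: (generated_ind iota_gen).
- move=> w bw; rewrite raddf0 linop0E; split; first exact: (iter_linop0 (opx nzW)).
  exact: (iter_linop0 (opy nzW)).
- move=> k a b ha hb w bw.
  have -> : rho (k *: a + b) = k *: (rho a : A) + (rho b : A) :> A by exact: linearP.
  rewrite linopDE linopZE.
  by apply: in_box_lin; [apply: ha | apply: hb].
- move=> a b ha hb w bw.
  rewrite rhoM lie_assocE linopDE linopNE !linopME addrC -scaleN1r.
  by apply: in_box_lin; [apply/hb/ha | apply/ha/hb].
- move=> a ha w bw; rewrite rhoP ppow_assocE linopXE.
  have it m : box s t (iter m (rho a : A) w) by elim: m => // m; apply: ha.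
  exact: it.
move=> y w bw; rewrite rho_gen /gen_image.
have [_|_] := asboolP (y = x0); first exact: in_box_dx.
have [_|_] := asboolP (y = y0); last first.
  rewrite linop0E; split; first exact: (iter_linop0 (opx nzW)).
  exact: (iter_linop0 (opy nzW)).
have boxD a b : box s t a -> box s t b -> box s t (a + b : nat -> nat -> seq bool -> F^o).
  by rewrite -{2}[a]scale1r; apply: in_box_lin.
have box_dpow i Z : (i < p ^ s)%N -> box s t (opm nzW (dpow F i e) (oplift Z w)).
  by move=> lt_i; apply/(in_box_hprod charFp nzW)/in_box_oplift => //; apply: in_box_dpow.
rewrite /yimage !linopDE !linopME; apply: (@boxD _ _); last first.
  by apply: (@boxD _ _); apply: (@box_dpow nzW) => //; apply: ltnW.
apply: (in_box_hprod charFp nzW); last exact: in_box_dy.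
split=> //; have := expn_gt0 p t; rewrite p_gt0.
by case: (p ^ t)%N => // n _; rewrite iterSr cy; exact: (iter_linop0 (opy (field_nontrivial F))).
Qed.

(** The power [Z] of [rho h] raises the order in [y], which is less than [p ^ t] for a
    nonzero function of the box. *)
Lemma rep_box_nilpotent (h : L) (D n : nat) (Z : A) : (D < e)%N ->
  yshift D e Z ->
  (forall v, iter (p ^ s) (@dx _) v = 0 -> ((rho h : A) ^+ n) v = Z v) ->
  forall v, box s t v -> ((rho h : A) ^+ (n * p ^ t)) v = 0.
Proof.
move=> lt_De hZ powZ v bv; rewrite exprM.
set B := _ ^+ n.
have box_iter k w : box s t w -> box s t (iter k (rho h : A) w).
  by move=> bw; elim: k => // k; apply: rep_box.
have bB m : box s t ((B ^+ m) v).
  elim: m => [//|m IH]; rewrite exprS linopME {1}/B linopXE.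
  exact: box_iter.
apply: (ysupp_box (bB _)).
elim: (p ^ t)%N => [//|m IH]; rewrite exprS linopME powZ; last by case: (bB m).
by move=> i j lt_j; apply: (hZ _ _ IH); lia.
Qed.

End BoxRepresentation.

(** * Linear conditions and the wreath product *)

(** A subspace cut out by finitely many linear conditions has finite
    codimension. The values of the conditions need only be known as a linear
    relation, not as a function. *)
Lemma finite_codim_relation (F : fieldType) (V : lmodType F) (S : V -> Prop)
    (m : nat) (R : V -> (nat -> F) -> Prop) :
  (forall k x y u v, R x u -> R y v -> R (k *: x + y) (fun i => k * u i + v i)) ->
  (forall x u, R x u -> (forall i, (i < m)%N -> u i = 0) -> S x) ->
  exists (n : nat) (b : 'I_n -> V), forall x u, R x u ->
    exists c : 'I_n -> F, S (x - \sum_(i < n) c i *: b i).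
Proof.
elim: m R => [|m IH] R linR R0.
  exists 0%N, (fun _ => 0) => x u Rx; exists (fun _ => 0).
  by rewrite big_ord0 subr0; apply: R0 Rx _.
pose R' x u := R x u /\ u m = 0.
have [||n [b hb]] := IH R'.
- move=> k x y u v [Rx ux] [Ry vy]; split; first exact: linR.
  by rewrite ux vy mulr0 addr0.
- move=> x u [Rx ux] u0; apply: R0 Rx _ => i.
  by rewrite ltnS leq_eqVlt => /orP[/eqP->|/u0].
have [[x0 [u0 [Rx0 u0m]]]|none] := pselect (exists x0 u0, R x0 u0 /\ u0 m != 0).
  exists n.+1, (fun i => if unlift ord0 i is Some j then b j else x0) => x u Rx.
  pose k := u m / u0 m.
  have [|c hc] := hb (- k *: x0 + x) (fun i => - k * u0 i + u i).
    by split; [exact: linR | rewrite mulNr divfK // addNr].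
  exists (fun i => if unlift ord0 i is Some j then c j else k).
  rewrite big_ord_recl unlift_none.
  rewrite (eq_bigr (fun i => c i *: b i)) => [|i _]; last by rewrite liftK.
  by rewrite opprD addrA -scaleNr [x + _]addrC.
exists n, b => x u Rx; apply: (hb x u); split=> //.
by apply/eqP/negP => /negP um; apply: none; exists x, u.
Qed.

Lemma dy_iter_dx (F : fieldType) (g : nat -> nat -> F^o) n :
  dy g = 0 -> dy (iter n (@dx _) g) = 0.
Proof.
move=> gy; have -> : dy (iter n (@dx _) g) = iter n (@dx _) (dy g).
  by elim: n => //= n <-.
by rewrite gy; exact: (iter_linop0 (opx (field_nontrivial F))).
Qed.

Section WreathSpan.
Variables (F : fieldType) (p : nat) (charFp : p \in [pchar F]).
Local Notation nzW := (word_space_nontrivial F).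
Local Notation W := (linop nzW).
Local Notation A := (linop (fun2_nontrivial nzW)).
Local Notation E := (assoc_rlie charFp A).
Local Notation coeff := (nat -> nat -> F^o).
Local Notation X := (opx nzW).
Local Notation Y := (opy nzW).
Local Notation M := (opm nzW).
Variables (P : rlieAlgType F p) (pi : {linear P -> assoc_rlie charFp W}).
Hypothesis piM : is_rlie_morphism pi.
Implicit Types (f g : coeff) (r : P) (Z : A).

Let R r : A := oplift (pi r : W).

(** The wreath product of [P] with the algebra of the derivations
    [(d / dx) ^ (p ^ i)] and [g (x) (d / dy) ^ (p ^ j)]. *)
Inductive wreath_gen : A -> Prop :=
  | wreath_x i : wreath_gen (X ^+ (p ^ i))
  | wreath_y g j : dy g = 0 -> wreath_gen (M g * Y ^+ (p ^ j))
  | wreath_m f r : wreath_gen (M f * R r).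

Let M_Yn g n : dy g = 0 -> Y ^+ n * M g = M g * Y ^+ n.
Proof.
move=> gy; apply/esym/commrX; rewrite /GRing.comm.
by rewrite opy_opm gy opm0 add0r.
Qed.

Let R_X r n : R r * X ^+ n = X ^+ n * R r.
Proof. by apply: commrX; rewrite /GRing.comm opx_oplift. Qed.
Let R_Y r n : R r * Y ^+ n = Y ^+ n * R r.
Proof. by apply: commrX; rewrite /GRing.comm opy_oplift. Qed.
Let R_M r f : R r * M f = M f * R r.
Proof. by rewrite opm_oplift. Qed.
Let X_Y m n : X ^+ m * Y ^+ n = Y ^+ n * X ^+ m.
Proof. by apply: commrX; apply/esym/commrX; apply/esym/opxy. Qed.

Let comm_sym (B : A -> Prop) (Z Z' : A) : lspan B (Z * Z' - Z' * Z) -> lspan B (Z' * Z - Z * Z').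
Proof. by move=> h; rewrite -opprB; apply: lspanN. Qed.

Let comm_xy i g j : dy g = 0 ->
  lspan wreath_gen (X ^+ (p ^ i) * (M g * Y ^+ (p ^ j)) - M g * Y ^+ (p ^ j) * X ^+ (p ^ i)).
Proof.
move=> gy; rewrite mulrA (opx_exp_opm charFp) mulrDl -!mulrA X_Y addrK.
by apply/lspan_gen/wreath_y/dy_iter_dx.
Qed.

Let comm_xm i f r :
  lspan wreath_gen (X ^+ (p ^ i) * (M f * R r) - M f * R r * X ^+ (p ^ i)).
Proof.
rewrite mulrA (opx_exp_opm charFp) mulrDl -!mulrA R_X addrK.
exact/lspan_gen/wreath_m.
Qed.

Let comm_ym g j f r : dy g = 0 ->
  lspan wreath_gen (M g * Y ^+ (p ^ j) * (M f * R r) - M f * R r * (M g * Y ^+ (p ^ j))).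
Proof.
move=> gy; rewrite -mulrA [Y ^+ _ * _]mulrA (opy_exp_opm charFp) mulrDl mulrDr.
rewrite -![M f * _ * _]mulrA [R r * (M g * _)]mulrA R_M -[M g * R r * _]mulrA R_Y.
rewrite ![M f * (M g * _)]mulrA [M f * M g]opmC -mulrA addrK mulrA -opm_hprod.
exact/lspan_gen/wreath_m.
Qed.

Lemma wreath_gen_lie (Z Z' : E) : wreath_gen Z -> wreath_gen Z' ->
  lspan (V := E) wreath_gen (lie Z Z').
Proof.
rewrite lie_assocE => -[i|g j gy|f r] [i'|g' j' gy'|f' r'].
- by rewrite -!exprD addnC subrr; left.
- exact: comm_xy.
- exact: comm_xm.
- exact/comm_sym/comm_xy.
- rewrite -!mulrA ![Y ^+ _ * (_ * _)]mulrA !M_Yn // -!mulrA -!exprD addnC.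
  by rewrite !mulrA opmC subrr; left.
- exact: comm_ym.
- exact/comm_sym/comm_xm.
- exact/comm_sym/comm_ym.
rewrite -!mulrA ![R _ * (_ * _)]mulrA !R_M -!mulrA ![M _ * (M _ * _)]mulrA.
rewrite [M f' * _]opmC -mulrBr -opm_hprod -!oplift_mul.
have -> : oplift ((pi r : W) * pi r') - oplift ((pi r' : W) * pi r) = R (lie r r').
  by rewrite /R piM.1 lie_assocE -scaleN1r addrC -oplift_linear scaleN1r addrC.
exact/lspan_gen/wreath_m.
Qed.

Lemma wreath_gen_ppow (Z : E) : wreath_gen Z -> lspan (V := E) wreath_gen (ppow Z).
Proof.
rewrite ppow_assocE => -[i|g j gy|f r].
- by rewrite -exprM -expnSr; apply/lspan_gen/wreath_x.
- rewrite exprMn_comm; last by rewrite /GRing.comm M_Yn.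
  rewrite (opm_exp_pchar charFp) -scalerAl mul1r -exprM -expnSr -[_ ^+ (p ^ j.+1)]mul1r -opm1.
  by apply/lspanZ/lspan_gen/wreath_y/dy_dpow0.
rewrite exprMn_comm; last by rewrite /GRing.comm R_M.
rewrite (opm_exp_pchar charFp) -scalerAl mul1r /R -oplift_exp -[oplift _]mul1r -opm1.
apply/lspanZ/lspan_gen; rewrite -[(pi r : W) ^+ p]/(ppow (pi r)) -piM.2.
exact: wreath_m.
Qed.

End WreathSpan.

(** * The action at the origin *)

Section WreathQuotient.
Variables (F : fieldType) (p : nat) (charFp : p \in [pchar F]).
Variables (L : rlieAlgType F p) (I : Type) (iota : I -> L).
Hypothesis iota_gen : generated_by iota.
Variables (x0 y0 : I).
Hypothesis neq_xy : x0 <> y0.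
Local Notation nzW := (word_space_nontrivial F).
Local Notation W := (linop nzW).
Local Notation A := (linop (fun2_nontrivial nzW)).
Local Notation E := (assoc_rlie charFp A).
Local Notation coeff := (nat -> nat -> F^o).
Local Notation X := (opx nzW).
Local Notation Y := (opy nzW).
Local Notation M := (opm nzW).
Variables (c : coeff) (e s t : nat) (rho : {linear L -> E}).
Hypotheses (cy : dy c = 0) (cx : iter (p ^ s) (@dx _) c = 0).
Hypotheses (rep : is_wreath_rep iota x0 y0 c e rho) (lt_e : (e < p ^ t)%N).
Hypothesis (lt_1 : (1 < p ^ s)%N).
Variables (P : rlieAlgType F p) (pi : {linear P -> assoc_rlie charFp W}).
Variable m : bool -> P.
Hypotheses (piM : is_rlie_morphism pi) (pi_m : forall b, pi (m b) = shift F [:: b]).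
Hypotheses (m_gen : generated_by m).

Let box (v : nat -> nat -> seq bool -> F^o) := in_box p s t v.

(** The graph of a homomorphism to [P], defined on the elements of [L] whose effect
    at the origin depends on the value at the origin only. *)
Definition acts_at_origin (x : L) (r : P) : Prop :=
  forall v, box v -> (rho x : A) v 0%N 0%N = (pi r : W) (v 0%N 0%N).

Let rhoM : is_rlie_morphism rho := rep.1.

Let rho_box x v : box v -> box ((rho x : A) v).
Proof. exact: (rep_box iota_gen cy cx rep lt_e lt_1). Qed.

Lemma acts_at_origin_lin k x y r r' : acts_at_origin x r -> acts_at_origin y r' ->
  acts_at_origin (k *: x + y) (k *: r + r').
Proof.
move=> hx hy v bv.
have -> : rho (k *: x + y) = k *: (rho x : A) + (rho y : A) :> A by exact: linearP.
have -> : pi (k *: r + r') = k *: (pi r : W) + (pi r' : W) :> W by exact: linearP.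
by rewrite !linopDE !linopZE -hx // -hy.
Qed.

Lemma acts_at_origin0 : acts_at_origin 0 0.
Proof. by move=> v _; rewrite !raddf0. Qed.

Lemma acts_at_origin_lie x y r r' : acts_at_origin x r -> acts_at_origin y r' ->
  acts_at_origin (lie x y) (lie r r').
Proof.
move=> hx hy v bv; rewrite rhoM.1 piM.1 !lie_assocE !linopDE !linopNE !linopME.
rewrite -[LHS]/((rho x : A) ((rho y : A) v) 0%N 0%N - (rho y : A) ((rho x : A) v) 0%N 0%N).
by rewrite hx ?hy ?(hy ((rho x : A) v)) ?hx //; apply: rho_box.
Qed.

Lemma acts_at_origin_ppow x r : acts_at_origin x r -> acts_at_origin (ppow x) (ppow r).
Proof.
move=> hx v bv; rewrite rhoM.2 piM.2 !ppow_assocE !linopXE.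
have box_iter n : box (iter n (rho x : A) v) by elim: n => //= n; apply: rho_box.
have it n : iter n (rho x : A) v 0%N 0%N = iter n (pi r : W) (v 0%N 0%N).
  by elim: n => //= n <-; apply: hx.
exact: it.
Qed.

Let box_const (w : seq bool -> F^o) :
  box (fun i j => if (i == 0%N) && (j == 0%N) then w else 0).
Proof.
have p_gt0 : (0 < p)%N := prime_gt0 (pcharf_prime charFp).
split; apply/funext => i; apply/funext => j.
  rewrite iter_dxE addn_eq0 [(p ^ s == 0)%N]eqn0Ngt expn_gt0 p_gt0 andbF.
  by [].
by rewrite iter_dyE addn_eq0 [(p ^ t == 0)%N]eqn0Ngt expn_gt0 p_gt0 !andbF.
Qed.

(** Constant functions take all values at the origin, and [P] acts faithfully. *)
Lemma acts_at_origin_uniq x r r' :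
  acts_at_origin x r -> acts_at_origin x r' -> r = r'.
Proof.
move=> hr hr'; apply: (free_embedding piM pi_m m_gen).
apply: linopP => w; have bw := box_const w.
by have := hr _ bw; rewrite (hr' _ bw).
Qed.

(** At the origin, an operator of the wreath product sees only the values at [(0, 0)],
    [(p ^ i, 0)] and [(0, p ^ j)] of a function of the box; [u] lists the coefficients
    for the second kind, then for the third. *)
Definition origin_formula (Z : A) (u : nat -> F) (r : P) : Prop :=
  forall v, box v -> Z v 0%N 0%N =
    \sum_(i < s) u i *: v (p ^ i)%N 0%N
    + \sum_(j < t) u (s + j)%N *: v 0%N (p ^ j)%N + (pi r : W) (v 0%N 0%N).

Lemma origin_formula_lin k Z Z' u u' r r' :
  origin_formula Z u r -> origin_formula Z' u' r' ->
  origin_formula (k *: Z + Z') (fun i => k * u i + u' i) (k *: r + r').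
Proof.
move=> h h' v bv; rewrite linopDE linopZE.
have -> : pi (k *: r + r') = k *: (pi r : W) + (pi r' : W) :> W by exact: linearP.
rewrite linopDE linopZE.
rewrite -[LHS]/(k *: Z v 0%N 0%N + Z' v 0%N 0%N) h // h' // !scalerDr !scaler_sumr.
have sumD n (a b : nat -> F) (w : nat -> seq bool -> F^o) :
    \sum_(i < n) (k * a i + b i) *: w i
    = \sum_(i < n) k *: (a i *: w i) + \sum_(i < n) b i *: w i.
  by rewrite -big_split; apply: eq_bigr => i _; rewrite scalerDl scalerA.
rewrite (sumD s u u' (fun i => v (p ^ i)%N 0%N)).
rewrite (sumD t (fun j => u (s + j)%N) (fun j => u' (s + j)%N) (fun j => v 0%N (p ^ j)%N)).
by rewrite addrACA; congr (_ + _); rewrite addrACA.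
Qed.

Let box_x v n : box v -> (p ^ s <= n)%N -> v n 0%N = 0.
Proof. by move=> [vx _] le_n; rewrite -(subnK le_n) -iter_dxE vx. Qed.
Let box_y v n : box v -> (p ^ t <= n)%N -> v 0%N n = 0.
Proof. by move=> [_ vy] le_n; rewrite -(subnK le_n) -iter_dyE vy. Qed.

Let p_gt1 : (1 < p)%N := prime_gt1 (pcharf_prime charFp).

Let sum_delta n k (a : F) (w : nat -> seq bool -> F^o) (u : nat -> F) :
  (forall i, (i < n)%N -> u i = if i == k then a else 0) ->
  ((n <= k)%N -> w k = 0) -> \sum_(i < n) u i *: w i = a *: w k.
Proof.
move=> uE w0; have [lt_k|le_k] := ltnP k n; last first.
  rewrite w0 // scaler0 big1 // => i _; rewrite uE // ltn_eqF ?scale0r //.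
  exact: leq_trans (ltn_ord i) le_k.
rewrite (bigD1 (Ordinal lt_k)) //= uE // eqxx big1 ?addr0 // => i ne_i.
by rewrite uE // -[_ == k]/(i == Ordinal lt_k) (negPf ne_i) scale0r.
Qed.

Lemma origin_formula_gen Z : wreath_gen pi Z ->
  exists u r, origin_formula Z u r.
Proof.
case=> [i|g j gy|f r].
- exists (fun l => if (l == i) && (l < s)%N then 1 else 0), 0 => v bv.
  rewrite raddf0 linop0E addr0 linopXE iter_dxE add0n.
  rewrite [X in _ + X]big1 ?addr0 => [|l _]; last first.
    by rewrite [(_ < s)%N]ltnNge leq_addr andbF scale0r.
  rewrite -[LHS]scale1r; apply/esym.
  apply: (@sum_delta s i 1 (fun l => v (p ^ l)%N 0%N)
    (fun l => if (l == i) && (l < s)%N then 1 else 0)) => [l lt_l|le_i].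
    by rewrite lt_l andbT.
  by apply: box_x => //; rewrite leq_exp2l.
- exists (fun l => if (l == s + j)%N then g 0%N 0%N else 0), 0 => v bv.
  rewrite raddf0 linop0E addr0 linopME linopXE opmE hprod_00 iter_dyE add0n.
  rewrite big1 ?add0r => [|l _]; last first.
    by rewrite ltn_eqF ?scale0r // (leq_trans (ltn_ord l) (leq_addr _ _)).
  apply/esym; apply: (@sum_delta t j (g 0%N 0%N) (fun l => v 0%N (p ^ l)%N)
    (fun l => if (s + l == s + j)%N then g 0%N 0%N else 0)) => [l _|le_j].
    by rewrite eqn_add2l.
  by apply: box_y => //; rewrite leq_exp2l.
exists (fun _ => 0), ((f 0%N 0%N : F) *: r) => v bv.
rewrite !big1 ?add0r => [|l _|l _]; rewrite ?scale0r //.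
have -> : pi ((f 0%N 0%N : F) *: r) = (f 0%N 0%N : F) *: (pi r : W) :> W.
  exact: linearZ_LR.
by [].
Qed.

Lemma origin_formula_rep x : exists u r, origin_formula (rho x : A) u r.
Proof.
have formula0 : origin_formula 0 (fun _ => 0) 0.
  move=> v _; rewrite raddf0 !linop0E addr0 !big1 ?addr0 // => l _; exact: scale0r.
suff : lspan (V := E) (wreath_gen pi) (rho x).
  elim=> [|k b Z /origin_formula_gen[u [r h]] _ [u' [r' h']]].
    by exists (fun _ => 0), 0.
  by exists (fun i => k * u i + u' i), (k *: r + r'); exact: origin_formula_lin.
have p_gt0 := ltnW p_gt1.
move: x; apply: (generated_ind iota_gen).
- by rewrite raddf0; left.
- by move=> k a b ha hb; rewrite linearP; apply: lspanD hb; apply: lspanZ.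
- move=> a b; rewrite rhoM.1; apply: lspan_lie => Z Z'.
  exact: wreath_gen_lie.
- move=> a; rewrite rhoM.2; apply: lspan_ppow p_gt0 _ _.
    by move=> Z Z'; exact: wreath_gen_lie.
  by move=> Z; exact: wreath_gen_ppow.
move=> y; rewrite rep.2 /gen_image.
have [_|_] := asboolP (y = x0).
  by apply: lspan_gen; rewrite -[X]expr1 -(expn0 p); exact: wreath_x.
have [_|_] := asboolP (y = y0); last by left.
apply: lspanD.
  by apply: lspan_gen; rewrite -[Y]expr1 -(expn0 p); exact: wreath_y.
by apply: lspanD; apply: lspan_gen; rewrite -pi_m; exact: wreath_m.
Qed.

Lemma acts_at_origin_codim : exists (n : nat) (b : 'I_n -> L),
  forall x, exists (d : 'I_n -> F) r, acts_at_origin (x - \sum_(i < n) d i *: b i) r.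
Proof.
have [||n [b hb]] := @finite_codim_relation F L (fun x => exists r, acts_at_origin x r)
    (s + t) (fun x u => exists r, origin_formula (rho x : A) u r).
- move=> k x y u v [r hr] [r' hr']; exists (k *: r + r').
  have -> : rho (k *: x + y) = k *: (rho x : A) + (rho y : A) :> A by exact: linearP.
  exact: origin_formula_lin.
- move=> x u [r hx] u0; exists r => v bv; rewrite hx //.
  rewrite !big1 ?add0r // => l _; rewrite u0 ?scale0r //.
    by rewrite ltn_add2l.
  exact: leq_trans (ltn_ord l) (leq_addr _ _).
exists n, b => x; have [u [r hx]] := origin_formula_rep x.
by apply: (hb x u); exists r.
Qed.

(** A form of the image of [iota y0] that is preserved by the brackets needed below. *)
Let yelt (g f0 f1 : coeff) : A :=
  M g * Y + (M f0 * oplift (shift F [:: false]) + M f1 * oplift (shift F [:: true])).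

Let yelt_x g f0 f1 : commutator X (yelt g f0 f1) = yelt (dx g) (dx f0) (dx f1).
Proof.
have commM f (Z : A) : X * Z = Z * X -> commutator X (M f * Z) = M (dx f) * Z.
  by move=> XZ; rewrite /commutator mulrA opx_opm mulrDl -!mulrA XZ addrK.
by rewrite /yelt !commutatorDr (commM _ Y (opxy _)) !(commM _ _ (opx_oplift _)).
Qed.

Let yelt_y (C g f0 f1 : coeff) : dy C = 0 -> dy g = 0 ->
  commutator (M C * Y) (yelt g f0 f1)
  = yelt 0 (hprod C (dy f0)) (hprod C (dy f1)).
Proof.
move=> Cy gy.
have commM f (Z : W) : commutator (M C * Y) (M f * oplift Z)
    = M (hprod C (dy f)) * oplift Z.
  rewrite /commutator -mulrA [Y * _]mulrA opy_opm mulrDl mulrDr opm_hprod !mulrA.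
  rewrite -[X in _ + X - _]mulrA opy_oplift -[M f * _ * _]mulrA.
  rewrite -[oplift Z * M C]opm_oplift !mulrA [M f * M C]opmC.
  by rewrite addrK.
by rewrite /yelt !commutatorDr !commM opm_opy_comm // opm0 mul0r.
Qed.

Let rho_x : rho (iota x0) = X.
Proof. by rewrite rep.2 /gen_image asboolT. Qed.

Let rho_y : rho (iota y0) = yelt c (dpow F 0 e) (dpow F 1 e).
Proof. by rewrite rep.2 /gen_image asboolF ?asboolT //; apply: nesym. Qed.

Let rho_iter_lie n x y : (rho (iter n (lie x) y) : A)
  = iter n (commutator (rho x : A)) (rho y : A).
Proof. by elim: n => //= n <-; rewrite rhoM.1. Qed.

Let iter_yelt_x n (g f0 f1 : coeff) : iter n (commutator X) (yelt g f0 f1)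
  = yelt (iter n (@dx _) g) (iter n (@dx _) f0) (iter n (@dx _) f1).
Proof. by elim: n => //= n ->; rewrite yelt_x. Qed.

Let iter_yelt_y n (C g f0 f1 : coeff) : dy C = 0 -> dy g = 0 ->
  iter n.+1 (commutator (M C * Y)) (yelt g f0 f1)
  = yelt 0 (hprod (hpow C n.+1) (iter n.+1 (@dy _) f0))
           (hprod (hpow C n.+1) (iter n.+1 (@dy _) f1)).
Proof.
move=> Cy gy; elim: n => [|n IH].
  by rewrite /= yelt_y // /hpow /= [hprod C (dpow F 0 0)]hprodC hprod1.
have hpow_y k : dy (hpow C k) = 0.
  elim: k => [|k IHk]; first exact: dy_dpow0.
  by rewrite /= dy_hprod Cy hprod0l add0r IHk hprodC hprod0l.
have hprod_y k f : dy (hprod (hpow C k) f) = hprod (hpow C k) (dy f).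
  by rewrite dy_hprod hpow_y hprod0l add0r.
rewrite iterS IH yelt_y // !hprod_y.
by rewrite -[hpow C n.+2]/(hprod C (hpow C n.+1)) -!hprodA.
Qed.

Variable j : nat.
Hypotheses (j_gt1 : (1 < j)%N) (cj : c j 0%N != 0) (e_gt0 : (0 < e)%N).

(** The element [x = ad (iota x0) ^ j (iota y0)] acts as [C d / dy] with
    [C (0) != 0], so that [ad (x) ^ e] strips the factor [y ^ e / e!] off the
    two letters. *)
Lemma acts_at_origin_onto r : exists x, acts_at_origin x r.
Proof.
pose C : coeff := iter j (@dx _) c.
have Cy : dy C = 0 by apply: dy_iter_dx.
have C0 : C 0%N 0%N = c j 0%N by rewrite /C iter_dxE.
pose x := iter j (lie (iota x0)) (iota y0).
have dpow_kill a : (a < j)%N -> iter j (@dx _) (dpow F a e) = 0.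
  move=> lt_a; apply/funext => k; apply/funext => l.
  by rewrite iter_dxE /dpow gtn_eqF // (leq_trans lt_a) ?leq_addl.
have rhox : (rho x : A) = M C * Y.
  rewrite /x rho_iter_lie rho_x rho_y iter_yelt_x /yelt !dpow_kill //; last exact: ltnW.
  by rewrite opm0 !mul0r !addr0.
have strip y g f0 f1 : (rho y : A) = yelt g f0 f1 -> dy g = 0 ->
    forall v, (rho (iter e (lie x) y) : A) v 0%N 0%N =
      (c j 0%N : F) ^+ e *: (f0 0%N e *: shift F [:: false] (v 0%N 0%N)
        + f1 0%N e *: shift F [:: true] (v 0%N 0%N)).
  move=> rhoy gy v; rewrite rho_iter_lie rhox rhoy.
  rewrite -{1}(prednK e_gt0) iter_yelt_y // prednK //.
  rewrite /yelt opm0 mul0r add0r linopDE !linopME.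
  rewrite -[LHS]/((hprod (hpow C e) (iter e (@dy _) f0) 0%N 0%N : F)
      *: (shift F [:: false] (v 0%N 0%N))
    + (hprod (hpow C e) (iter e (@dy _) f1) 0%N 0%N : F)
      *: (shift F [:: true] (v 0%N 0%N))).
  by rewrite !hprod_00 hpow_00 C0 !iter_dyE add0n scalerDr !scalerA.
have ce0 : (c j 0%N : F) ^+ e != 0 by rewrite expf_neq0.
have unscale y (b : bool) : (forall v, (rho y : A) v 0%N 0%N =
      (c j 0%N : F) ^+ e *: shift F [:: b] (v 0%N 0%N)) ->
    exists x, acts_at_origin x (m b).
  move=> hy; exists (((c j 0%N : F) ^+ e)^-1 *: y + 0); rewrite -[m b]addr0.
  rewrite -[X in acts_at_origin _ (X + 0)]scale1r -(mulVf ce0) -scalerA.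
  apply: acts_at_origin_lin acts_at_origin0 => v _; rewrite hy.
  have -> : pi ((c j 0%N : F) ^+ e *: m b) = (c j 0%N : F) ^+ e *: (pi (m b) : W) :> W.
    exact: linearZ_LR.
  by rewrite pi_m.
move: r; apply: (generated_ind m_gen).
- by exists 0; exact: acts_at_origin0.
- move=> k a b [y hy] [z hz].
  by exists (k *: y + z); exact: acts_at_origin_lin.
- by move=> a b [y hy] [z hz]; exists (lie y z); exact: acts_at_origin_lie.
- by move=> a [y hy]; exists (ppow y); exact: acts_at_origin_ppow.
case.
  apply: (unscale (iter e (lie x) (lie (iota x0) (iota y0)))) => v.
  rewrite (@strip _ (dx c) (dx (dpow F 0 e)) (dx (dpow F 1 e))).
  - by rewrite /dx /dpow /= eqxx scale0r add0r scale1r.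
  - by rewrite rhoM.1 lie_assocE rho_x rho_y -yelt_x.
  - exact: (@dy_iter_dx _ _ 1).
apply: (unscale (iter e (lie x) (iota y0))) => v.
rewrite (@strip _ c (dpow F 0 e) (dpow F 1 e)) ?rho_y //.
by rewrite /dpow /= eqxx scale1r scale0r addr0.
Qed.

End WreathQuotient.

(** * The largest ideal inside a subalgebra of an ideal *)

Section Core.
Variables (F : fieldType) (p : nat) (charFp : p \in [pchar F]).
Variables (G : rlieAlgType F p) (H : rideal G) (N : G -> Prop).
Hypotheses (NH : forall x, N x -> x \in H) (N0 : N 0).
Hypothesis N_lin : forall k x y, N x -> N y -> N (k *: x + y).
Hypothesis N_lie : forall h x, h \in H -> N x -> N (lie h x).
Hypothesis N_ppow : forall x, N x -> N (ppow x).
Implicit Types (w u v : seq G) (x y e : G).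

Let p_gt1 : (1 < p)%N := prime_gt1 (pcharf_prime charFp).

Let N_add x y : N x -> N y -> N (x + y).
Proof. by move=> Nx Ny; rewrite -[x]scale1r; apply: N_lin. Qed.
Let N_scale k x : N x -> N (k *: x).
Proof. by move=> Nx; rewrite -[_ *: _]addr0; apply: N_lin. Qed.

Definition ad_word w x : G := foldr (fun e y => lie e y) x w.

Lemma ad_word_cat u v x : ad_word (u ++ v) x = ad_word u (ad_word v x).
Proof. exact: foldr_cat. Qed.

Lemma ad_word_lin w k x y : ad_word w (k *: x + y) = k *: ad_word w x + ad_word w y.
Proof. by elim: w => //= e w ->; rewrite lieDr lieZr. Qed.

Lemma ad_word0 w : ad_word w 0 = 0.
Proof. by elim: w => //= e w ->; rewrite lie0r. Qed.

Lemma ad_wordD w x y : ad_word w (x + y) = ad_word w x + ad_word w y.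
Proof. by have := ad_word_lin w 1 x y; rewrite !scale1r. Qed.

Lemma ad_wordN w x : ad_word w (- x) = - ad_word w x.
Proof. by have := ad_word_lin w (-1) x 0; rewrite ad_word0 !addr0 !scaleN1r. Qed.

Definition killed_upto d x : Prop :=
  x \in H /\ forall w, (size w <= d)%N -> N (ad_word w x).

(** By the Leibniz rule the letters of [w] are shared between [x] and [y]; those given
    to [x] bring it into [N], those given to [y] keep it in [H]. *)
Lemma ad_word_lie w x y : killed_upto (size w) x -> y \in H ->
  N (ad_word w (lie x y)).
Proof.
elim/last_ind: w x y => [|w e IH] x y [Hx Nx] Hy.
  by rewrite lieC -scaleN1r; apply/N_scale/N_lie => //; apply: (Nx [::]).
rewrite size_rcons in Nx; rewrite -cats1 ad_word_cat /= lie_derivation ad_wordD.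
apply: N_add; apply: IH => //.
- split; first exact: rideal_lie.
  move=> u le_u; have := Nx (rcons u e).
  by rewrite size_rcons -cats1 ad_word_cat; apply.
- by split=> // u le_u; apply: Nx; apply: leqW.
- exact: rideal_lie.
Qed.

(** The last letter [e] of a word turns [ppow x] into [- ad (x) ^ p (e)], which is a
    bracket of [x] with an element of [H], as [p > 1]; the [d] other letters are
    dealt with by [ad_word_lie]. *)
Lemma killed_upto_ppow d x : killed_upto d x -> killed_upto d.+1 (ppow x).
Proof.
move=> [Hx Nx]; split; first exact: rsub_ppow.
case/lastP => [_|w e]; first exact/N_ppow/(Nx [::]).
rewrite size_rcons ltnS => le_w; rewrite -cats1 ad_word_cat /=.
rewrite lieC ppow_ad ad_wordN -scaleN1r; apply: N_scale.
rewrite -[X in iter X](subnK p_gt1) addn2 iterS; apply: ad_word_lie.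
  by split=> // u le_u; apply: Nx (leq_trans le_u le_w).
elim: (p - 2)%N => [|n IH]; last by rewrite iterS; exact: rideal_lie.
by rewrite /= lieC rpredN; exact: rideal_lie.
Qed.

Definition core_pred : {pred G} := fun x => `[< forall d, killed_upto d x >].

Let core_submod : submod_closed core_pred.
Proof.
split=> [|k x y /asboolP hx /asboolP hy]; apply/asboolP => d.
  by split=> [|w _]; rewrite ?rpred0 ?ad_word0.
have [[Hx Nx] [Hy Ny]] := (hx d, hy d).
split=> [|w le_w]; first by rewrite rpredD ?rpredZ.
by rewrite ad_word_lin; apply: N_lin; [apply: Nx | apply: Ny].
Qed.

Let core_lie x y : y \in core_pred -> lie x y \in core_pred.
Proof.
move=> /asboolP hy; apply/asboolP => d; have [Hy Ny] := hy d.+1.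
split=> [|w le_w]; first exact: rideal_lie.
by have := Ny (rcons w x); rewrite size_rcons -cats1 ad_word_cat; apply.
Qed.

Let core_ppow : {in core_pred, forall x, ppow x \in core_pred}.
Proof.
move=> x /asboolP hx; apply/asboolP => -[|d]; last exact: killed_upto_ppow.
have [Hx Nx] := killed_upto_ppow (hx 0%N).
by split=> // w; rewrite leqn0 => /eqP w0; apply: Nx; rewrite w0.
Qed.

(** The largest restricted ideal of [G] contained in [N]. *)
Definition core : rideal G :=
  @RIdeal F p G (RSubalg core_submod (fun x y _ => @core_lie x y) core_ppow) core_lie.

Lemma core_sub x : x \in core -> N x.
Proof. by move=> /asboolP/(_ 0%N)[_ /(_ [::])]; apply. Qed.

Section Stabilization.
Variables (m : nat) (b : 'I_m -> G).
Hypothesis codimH : forall x, exists c : 'I_m -> F, x - \sum_(i < m) c i *: b i \in H.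

Section Step.
Variables (x : G) (n : nat).
Hypothesis IH : forall w, (size w < n)%N -> N (ad_word w x).

(** Letters commute modulo shorter words, as [lie f e] is a single letter. *)
Let move_letter t u v e : size (t ++ e :: u ++ v) = n ->
  N (ad_word (t ++ e :: u ++ v) x) -> N (ad_word (t ++ u ++ e :: v) x).
Proof.
elim/last_ind: u v => [//|u f IHu] v sz hN.
rewrite cat_rcons in sz hN; rewrite cat_rcons.
have -> : ad_word (t ++ u ++ f :: e :: v) x = ad_word (t ++ u ++ e :: f :: v) x
    + ad_word (t ++ u ++ lie f e :: v) x.
  rewrite !ad_word_cat /= lie_derivation addrC !ad_wordD.
  by [].
apply: N_add; first exact: IHu.
by apply: IH; rewrite -sz !size_cat /= !size_cat /=; lia.
Qed.

Let perm_word t w w' : perm_eq w w' -> size (t ++ w) = n ->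
  N (ad_word (t ++ w) x) -> N (ad_word (t ++ w') x).
Proof.
elim: w t w' => [|e w IHw] t w' perm_w sz hN.
  by move: perm_w; rewrite perm_sym => /perm_nilP ->.
have ew' : e \in w' by rewrite -(perm_mem perm_w) mem_head.
case/splitPr: ew' perm_w => u v; rewrite perm_sym -cat1s perm_catCA /=.
rewrite perm_cons perm_sym => perm_w.
apply: move_letter.
  by rewrite -sz !size_cat /= (perm_size perm_w) size_cat.
rewrite -cat_rcons; apply: IHw => //; rewrite cat_rcons //.
Qed.

Let word_H u h v : h \in H -> size (u ++ h :: v) = n ->
  N (ad_word (u ++ h :: v) x).
Proof.
move=> Hh sz; apply: (perm_word (t := [::]) (w := h :: u ++ v)).
- by rewrite perm_sym -cat1s perm_catCA.
- by rewrite -sz cat0s /= !size_cat /= addnS.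
apply: N_lie => //; apply: IH.
by rewrite -sz !size_cat /= addnS.
Qed.

Let sum_count (s : seq 'I_m) : (\sum_(i < m) count_mem i s)%N = size s.
Proof.
elim: s => [|j s IHs] /=; first by rewrite big1.
rewrite big_split /= IHs -[RHS]add1n; congr (_ + _)%N.
rewrite (bigD1 j) //= eqxx big1 // => i /negPf ne_ij.
by rewrite eq_sym ne_ij.
Qed.

(** A long word in the [b i] repeats one of them [p] times, and [ad (b i) ^ p]
    is the single letter [ppow (b i)]. *)
Let word_b (s : seq 'I_m) : (m * p.-1 < n)%N -> size s = n ->
  N (ad_word (map b s) x).
Proof.
move=> lt_n sz.
have [i le_i] : exists i, (p <= count_mem i s)%N.
  apply/existsP; apply: contraLR lt_n; rewrite negb_exists => /forallP small.
  rewrite -leqNgt -sz -sum_count.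
  apply: (@leq_trans (\sum_(i < m) p.-1)%N); last by rewrite sum_nat_const card_ord.
  by apply: leq_sum => i _; have := small i; rewrite -ltnNge; case: (p) p_gt1.
pose s' := nseq (count_mem i s - p) i ++ [seq j <- s | j != i].
have perm_s : perm_eq (nseq p i ++ s') s.
  rewrite catA -nseqD subnKC //; have /all_pred1P := filter_all (pred1 i) s.
  by rewrite size_filter => <-; apply/permPl/perm_filterC.
apply: (perm_word (t := [::]) (perm_map b perm_s)).
  by rewrite size_map (perm_size perm_s).
rewrite map_cat cat0s ad_word_cat map_nseq.
have -> (y : G) : ad_word (nseq p (b i)) y = lie (ppow (b i)) y.
  have it q : ad_word (nseq q (b i)) y = iter q (lie (b i)) y.
    by elim: q => //= q ->.
  by rewrite ppow_ad it.
apply: (IH (w := ppow (b i) :: map b s')).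
have := perm_size perm_s; rewrite size_cat size_nseq sz /= size_map => <-.
by rewrite -[X in (X < _)%N]add1n ltn_add2r.
Qed.

Lemma word_killed w : x \in H -> (m * p.-1 < n)%N -> size w = n -> N (ad_word w x).
Proof.
move=> Hx lt_n sz.
suff words u (s : seq 'I_m) : size (u ++ map b s) = n -> N (ad_word (u ++ map b s) x).
  by have := words w [::]; rewrite cats0; apply.
elim/last_ind: u s => [|u e IHu] s sz_us.
  by apply: word_b => //; rewrite -sz_us size_map.
rewrite cat_rcons in sz_us; rewrite cat_rcons.
have sz_letter e' : size (u ++ e' :: map b s) = n by rewrite -sz_us !size_cat.
have [c hc] := codimH e.
have letterD e1 e2 : ad_word (u ++ (e1 + e2) :: map b s) x
    = ad_word (u ++ e1 :: map b s) x + ad_word (u ++ e2 :: map b s) x.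
  by rewrite !ad_word_cat /= lieDl ad_wordD.
have letterZ k e1 : ad_word (u ++ (k *: e1) :: map b s) x
    = k *: ad_word (u ++ e1 :: map b s) x.
  by rewrite !ad_word_cat /= lieZl -[X in ad_word u X]addr0 ad_word_lin ad_word0 addr0.
rewrite -[e](subrK (\sum_(i < m) c i *: b i)) letterD; apply: N_add.
  exact: word_H.
elim/big_ind: _ => [|e1 e2 h1 h2|i _].
- by rewrite -(scale0r (0 : G)) letterZ scale0r.
- by rewrite letterD; apply: N_add.
by rewrite letterZ; apply/N_scale/(IHu (i :: s)); rewrite sz_letter.
Qed.

End Step.

(** Long words reduce to shorter ones by [word_killed]: once its letters are expanded
    along [H] and the [b i], a word either has a letter in [H] or is covered by
    [word_b]. *)
Lemma killed_upto_core x : killed_upto (m * p.-1) x -> x \in core.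
Proof.
move=> [Hx Nx]; apply/asboolP => d; split=> // w _.
elim/ltn_ind: (size w) {-2}w (erefl (size w)) => n IH {}w sz_w.
have [le_w|lt_w] := leqP (size w) (m * p.-1); first exact: Nx.
apply: (word_killed (n := n)) => //; last by rewrite -sz_w.
by move=> v lt_v; apply: (IH _ lt_v).
Qed.

(** Each [p]-th power gains one order, and the orders stabilize at [m * p.-1]. *)
Lemma core_absorbs x : N x -> iter (m * p.-1) ppow x \in core.
Proof.
move=> Nx; apply: killed_upto_core; elim: (m * p.-1)%N => [|d IH].
  by split=> [|w]; [exact: NH | rewrite leqn0 => /nilP ->].
exact: killed_upto_ppow.
Qed.

End Stabilization.
End Core.

(** * Largeness through relations, and free subalgebras *)

Section LargeByRelation.
Variables (F : fieldType) (p : nat) (Q P : rlieAlgType F p) (R : Q -> P -> Prop).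
Hypothesis R0 : R 0 0.
Hypothesis R_lin : forall k x y r r', R x r -> R y r' -> R (k *: x + y) (k *: r + r').
Hypothesis R_lie : forall x y r r', R x r -> R y r' -> R (lie x y) (lie r r').
Hypothesis R_ppow : forall x r, R x r -> R (ppow x) (ppow r).
Hypothesis R_fun : forall r, R 0 r -> r = 0.

Definition relation_pred : {pred Q} := fun x => `[< exists r, R x r >].

Let dom_submod : submod_closed relation_pred.
Proof.
split=> [|k x y /asboolP[r hr] /asboolP[r' hr']]; apply/asboolP.
  by exists 0.
by exists (k *: r + r'); apply: R_lin.
Qed.

Let dom_lie : {in relation_pred &, forall x y, lie x y \in relation_pred}.
Proof.
by move=> x y /asboolP[r hr] /asboolP[r' hr']; apply/asboolP; exists (lie r r'); apply: R_lie.
Qed.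

Let dom_ppow : {in relation_pred, forall x, ppow x \in relation_pred}.
Proof. by move=> x /asboolP[r hr]; apply/asboolP; exists (ppow r); apply: R_ppow. Qed.

Definition relation_dom : rsubalg Q := RSubalg dom_submod dom_lie dom_ppow.

(** Homomorphisms are handled through their graphs, which descend to quotients
    without a choice of representatives. *)
Definition relation_map (x : subalg_type relation_dom) : P :=
  projT1 (cid (asboolW (subalg_valP x))).

Lemma relation_mapP x : R (val x) (relation_map x).
Proof. exact: (projT2 (cid (asboolW (subalg_valP x)))). Qed.

Lemma relation_map_eq x r : R (val x) r -> relation_map x = r.
Proof.
move=> hr; apply/eqP; rewrite -subr_eq0; apply/eqP/R_fun.
by have := R_lin (-1) hr (relation_mapP x); rewrite !scaleN1r addNr addrC.
Qed.

Let relation_map_linear : linear relation_map.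
Proof.
by move=> k x y; apply: relation_map_eq; apply: R_lin; apply: relation_mapP.
Qed.

HB.instance Definition _ :=
  GRing.isLinear.Build F (subalg_type relation_dom) P *:%R relation_map relation_map_linear.

Lemma large_by_relation : is_nonabelian_free P -> (forall r, exists x, R x r) ->
  finite_codim relation_dom -> large Q.
Proof.
move=> freeP onto codim; exists relation_dom; split=> //.
exists P, (relation_map : {linear _ -> _}); split=> //.
  split=> [x y|x]; apply: relation_map_eq.
    by apply: R_lie; apply: relation_mapP.
  by apply: R_ppow; apply: relation_mapP.
move=> r; have [x hx] := onto r.
have Dx : x \in relation_dom by apply/asboolP; exists r.
by exists (SubalgElt Dx); apply: relation_map_eq.
Qed.

End LargeByRelation.

Section LargeQuotient.
Variables (F : fieldType) (p : nat) (G P : rlieAlgType F p) (J : rideal G).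
Variable R : G -> P -> Prop.
Hypothesis R_lin : forall k x y r r', R x r -> R y r' -> R (k *: x + y) (k *: r + r').
Hypothesis R_lie : forall x y r r', R x r -> R y r' -> R (lie x y) (lie r r').
Hypothesis R_ppow : forall x r, R x r -> R (ppow x) (ppow r).
Hypothesis R_fun : forall r, R 0 r -> r = 0.
Hypothesis R_ideal : forall x, x \in J -> R x 0.
Local Open Scope quotient_scope.
Local Notation pi := (\pi_(rquot J) : {linear G -> rquot J}).

Let pi_ker x : pi x = 0 -> x \in J.
Proof.
move=> pix0; rewrite -[x]subr0 Quotient.idealrBE; apply/eqP.
by rewrite -[LHS]/(pi x) -[RHS]/(pi 0) pix0 raddf0.
Qed.

Lemma large_quotient : is_nonabelian_free P -> (forall r, exists x, R x r) ->
  (exists (n : nat) (b : 'I_n -> G), forall x, exists (c : 'I_n -> F) r,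
      R (x - \sum_(i < n) c i *: b i) r) -> large (rquot J).
Proof.
move=> freeP onto [n [b codim]].
pose RQ (y : rquot J) r := exists2 x, y = pi x & R x r.
have [piM piP] := pi_is_rlie_morphism J.
have RQ0 : RQ 0 0 by exists 0; [rewrite raddf0 | apply: R_ideal; rewrite rpred0].
have RQ_lin k x y r r' : RQ x r -> RQ y r' -> RQ (k *: x + y) (k *: r + r').
  move=> [x' -> hx] [y' -> hy]; exists (k *: x' + y'); last exact: R_lin.
  by rewrite linearP.
have RQ_lie x y r r' : RQ x r -> RQ y r' -> RQ (lie x y) (lie r r').
  move=> [x' -> hx] [y' -> hy]; exists (lie x' y'); last exact: R_lie.
  by rewrite piM.
have RQ_ppow x r : RQ x r -> RQ (ppow x) (ppow r).
  by move=> [x' -> hx]; exists (ppow x'); [rewrite piP | apply: R_ppow].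
have RQ_fun r : RQ 0 r -> r = 0.
  move=> [x /esym/pi_ker/R_ideal hx hr]; apply: R_fun.
  by have := R_lin (-1) hx hr; rewrite scaler0 add0r scaleN1r addNr.
apply: (@large_by_relation F p (rquot J) P RQ RQ0 RQ_lin RQ_lie RQ_ppow RQ_fun) => //.
  by move=> r; have [x hx] := onto r; exists (pi x), x.
exists n, (fun i => pi (b i)) => y.
have [c [r hr]] := codim (repr y); exists c; apply/asboolP; exists r.
exists (repr y - \sum_(i < n) c i *: b i) => //.
have -> : \sum_(i < n) c i *: (pi (b i) : rquot J) = pi (\sum_(i < n) c i *: b i).
  by rewrite linear_sum; apply: eq_bigr => i _; rewrite linearZ.
by rewrite linearB /= reprK.
Qed.

End LargeQuotient.

Section FreeOfRankTwo.
Variables (F : fieldType) (p : nat) (L : rlieAlgType F p).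
Variables (I : Type) (iota : I -> L) (x0 y0 : I).
Hypotheses (free_iota : is_free_on iota) (neq_xy : x0 <> y0).

Definition two_gen_pred : {pred L} := fun x =>
  `[< forall S : rsubalg L, iota x0 \in S -> iota y0 \in S -> x \in S >].

Let two_gen_submod : submod_closed two_gen_pred.
Proof.
split=> [|k x y /asboolP hx /asboolP hy]; apply/asboolP => S Sx Sy.
  exact: rpred0.
by rewrite rpredD ?rpredZ ?hx ?hy.
Qed.

Let two_gen_lie : {in two_gen_pred &, forall x y, lie x y \in two_gen_pred}.
Proof.
move=> x y /asboolP hx /asboolP hy; apply/asboolP => S Sx Sy.
by apply: rsub_lie; [apply: hx | apply: hy].
Qed.

Let two_gen_ppow : {in two_gen_pred, forall x, ppow x \in two_gen_pred}.
Proof. by move=> x /asboolP hx; apply/asboolP => S Sx Sy; apply/rsub_ppow/hx. Qed.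

Definition two_gen : rsubalg L := RSubalg two_gen_submod two_gen_lie two_gen_ppow.

Let two_gen_mem (b : bool) : iota (if b then y0 else x0) \in two_gen.
Proof. by apply/asboolP => S; case: b. Qed.

Definition two_gens (b : bool) : subalg_type two_gen := SubalgElt (two_gen_mem b).

Lemma two_gens_generate : generated_by two_gens.
Proof.
move=> S hS x.
pose SL : {pred L} := fun y => `[< exists2 z, z \in S & val z = y >].
have subL : submod_closed SL.
  split=> [|k a b /asboolP[a' ha <-] /asboolP[b' hb <-]]; apply/asboolP.
    by exists 0; rewrite ?rpred0.
  by exists (k *: a' + b') => //; rewrite rpredD ?rpredZ.
have lieL : {in SL &, forall a b, lie a b \in SL}.
  move=> a b /asboolP[a' ha <-] /asboolP[b' hb <-]; apply/asboolP.
  by exists (lie a' b') => //; apply: rsub_lie.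
have ppowL : {in SL, forall a, ppow a \in SL}.
  by move=> a /asboolP[a' ha <-]; apply/asboolP; exists (ppow a') => //; apply: rsub_ppow.
have /asboolP/(_ (RSubalg subL lieL ppowL)) := subalg_valP x.
have genL b : val (two_gens b) \in RSubalg subL lieL ppowL.
  by apply/asboolP; exists (two_gens b).
by move=> /(_ (genL false) (genL true))/asboolP[z hz /val_inj <-].
Qed.

Lemma morphism_eq (M : rlieAlgType F p) (A : rlieAlgType F p) (X : Type) (g : X -> A)
    (f f' : {linear A -> M}) : generated_by g ->
  is_rlie_morphism f -> is_rlie_morphism f' ->
  (forall i, f (g i) = f' (g i)) -> f =1 f'.
Proof.
move=> gen [fM fP] [f'M f'P] eq_g x.
move: x; apply: (generated_ind gen) => [|k a b ha hb|a b ha hb|a ha|//].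
- by rewrite !raddf0.
- by rewrite !linearP ha hb.
- by rewrite fM f'M ha hb.
- by rewrite fP f'P ha.
Qed.

(** A map on the two generators extends to [L] by sending the other ones to zero. *)
Lemma two_gens_free : is_free_on two_gens.
Proof.
move=> M h.
have [f [[fM fP] f_iota _]] := free_iota (fun i =>
  if `[< i = x0 >] then h false else if `[< i = y0 >] then h true else 0).
pose f2 : {linear subalg_type two_gen -> M} := f \o \val.
have f2M : is_rlie_morphism f2 by split=> [x y|x]; rewrite /= ?fM ?fP.
have f2_gen b : f2 (two_gens b) = h b.
  rewrite /= f_iota; case: b; last by rewrite asboolT.
  by rewrite asboolF ?asboolT //; apply: nesym.
exists f2; split=> // g gM g_gen.
by apply: (morphism_eq two_gens_generate gM f2M) => b; rewrite g_gen f2_gen.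
Qed.

End FreeOfRankTwo.

(** * Nilpotent images and the final descent *)

Section Wreath.
Variables (F : fieldType) (p : nat) (charFp : p \in [pchar F]).
Variables (L : rlieAlgType F p).

(** [R] is the graph of a homomorphism from a subalgebra of finite codimension
    onto [P], here [acts_at_origin], and [N] is the annihilator of a box. Since the
    homomorphism kills [N], it descends to the quotient by any ideal inside [N]. *)
Lemma free_wreath_relation (k : nat) (h : 'I_k -> L) : is_nonabelian_free L ->
  exists (P : rlieAlgType F p) (R : L -> P -> Prop) (N : L -> Prop),
  [/\ [/\ is_nonabelian_free P,
      forall a x y r r', R x r -> R y r' -> R (a *: x + y) (a *: r + r'),
      forall x y r r', R x r -> R y r' -> R (lie x y) (lie r r') &
      forall x r, R x r -> R (ppow x) (ppow r)],
    [/\ forall r, R 0 r -> r = 0, forall r, exists x, R x r &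
      exists (n : nat) (b : 'I_n -> L), forall x, exists (c : 'I_n -> F) r,
        R (x - \sum_(i < n) c i *: b i) r],
    [/\ N 0, forall a x y, N x -> N y -> N (a *: x + y),
        forall x y, N y -> N (lie x y) & forall x, N x -> N (ppow x)],
    forall x, N x -> R x 0 &
    exists n, forall l, N (iter n ppow (h l))].
Proof.
move=> [I [iota [free_iota [x0 [y0 neq_xy]]]]].
have iota_gen := free_generated free_iota.
have p_gt1 : (1 < p)%N := prime_gt1 (pcharf_prime charFp).
have [s [c [cy cx [j /andP[j_gt1 lt_j] cj] [D hD]]]] :=
  wreath_parameters charFp iota_gen x0 y0 h.
(* As [e < p ^ e], the number [e] also serves as the exponent [t] of the box. *)
pose e := D.+1.
have lt_e : (e < p ^ e)%N by apply: ltn_expl.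
have lt_1 : (1 < p ^ s)%N by apply: ltn_trans lt_j.
have [rho [rhoM rho_gen _]] := free_iota _ (gen_image charFp x0 y0 c e).
have rep : is_wreath_rep iota x0 y0 c e rho by split.
pose P : rlieAlgType F p := subalg_type (two_gen iota x0 y0).
have freeP := two_gens_free free_iota neq_xy.
have genP : generated_by (two_gens iota x0 y0) := @two_gens_generate _ _ _ _ _ _ _.
have [pi [piM pi_m _]] :=
  freeP (assoc_rlie charFp (linop (word_space_nontrivial F))) (fun b => shift F [:: b]).
pose R (x : L) (r : P) := acts_at_origin s e rho pi x r.
pose N (x : L) := forall v, in_box p s e v -> (rho x : linop _) v = 0.
exists P, R, N; split.
- split.
  + by exists bool, (two_gens iota x0 y0); split=> //; exists true, false.
  + by move=> a x y r r'; apply: acts_at_origin_lin.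
  + move=> x y r r'; exact: (acts_at_origin_lie iota_gen cy cx rep lt_e lt_1 piM).
  + move=> x r; exact: (acts_at_origin_ppow iota_gen cy cx rep lt_e lt_1 piM).
- split.
  + move=> r hr; apply: (acts_at_origin_uniq piM pi_m genP hr).
    exact: acts_at_origin0.
  + exact: (acts_at_origin_onto iota_gen neq_xy cy cx rep lt_e lt_1 piM pi_m genP j_gt1 cj).
  exact: (acts_at_origin_codim iota_gen s e cy rep piM pi_m).
- split.
  + by move=> v _; rewrite raddf0.
  + move=> a x y Nx Ny v bv.
    have -> : rho (a *: x + y) = a *: (rho x : linop _) + (rho y : linop _) :> linop _.
      exact: linearP.
    by rewrite linopDE linopZE Nx // Ny // scaler0 addr0.
  + move=> x y Ny v bv; rewrite rhoM.1 lie_assocE linopDE linopNE !linopME.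
    have bxv := rep_box iota_gen cy cx rep lt_e lt_1 x bv.
    by rewrite (Ny _ bv) (Ny _ bxv) raddf0; exact: subrr.
  + move=> x Nx v bv; rewrite rhoM.2 ppow_assocE.
    by rewrite -[X in _ ^+ X](prednK (ltnW p_gt1)) exprSr linopME Nx // raddf0.
- by move=> x Nx v bv; rewrite Nx // !raddf0.
exists (s.+1 + e)%N => l v bv.
have [Z hZ powZ] := hD e rho rep l.
have -> : rho (iter (s.+1 + e) ppow (h l)) = (rho (h l) : linop _) ^+ (p ^ s.+1 * p ^ e) :> linop _.
  rewrite -expnD; elim: (s.+1 + e)%N => [|n IH]; first by rewrite expr1.
  by rewrite iterS rhoM.2 ppow_assocE IH -exprM expnSr.
exact: (rep_box_nilpotent iota_gen cy cx rep lt_e lt_1 (leqnn _) hZ powZ bv).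
Qed.

End Wreath.

Local Open Scope classical_set_scope.

Theorem theorem2 (F : fieldType) (p : nat) (charFp : p \in [pchar F])
    (perfF : perfect_field F) (G : rlieAlgType F p) (H : rideal G)
    (codimH : finite_codim H)
    (freeH : maps_onto_nonabelian_free (subalg_type H))
    (k : nat) (g : 'I_k -> G) (gH : forall i, g i \in H) :
  finite_set
    [set n : nat | ~ large (rquot (rideal_gen (range (fun i => iter n ppow (g i)))))].
Proof.
have [L [phi [freeL [phiM phiP] phi_onto]]] := freeH.
have [mH [bH codH]] := codimH.
have [P [RL [NL [[freeP RL_lin RL_lie RL_ppow] [RL_fun RL_onto RL_cod]
   [NL0 NL_lin NL_lie NL_ppow] NRL [n0 hn0]]]]] :=
  free_wreath_relation charFp (fun i => phi (SubalgElt (gH i))) freeL.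
pose R (x : G) (r : P) := exists hx : x \in H, RL (phi (SubalgElt hx)) r.
pose N (x : G) := exists hx : x \in H, NL (phi (SubalgElt hx)).
have elt_eq x (hx : x \in H) (y : subalg_type H) : val y = x -> SubalgElt hx = y.
  by move=> yx; apply: val_inj.
have N0 : N 0 by exists (rpred0 _); rewrite (elt_eq _ _ 0) // raddf0.
have N_lin a x y : N x -> N y -> N (a *: x + y).
  move=> [hx Nx] [hy Ny]; exists (rpredD (rpredZ a hx) hy).
  by rewrite (elt_eq _ _ (a *: SubalgElt hx + SubalgElt hy)) // linearP; apply: NL_lin.
have N_lie u x : u \in H -> N x -> N (lie u x).
  move=> hu [hx Nx]; exists (rideal_lie u hx).
  by rewrite (elt_eq _ _ (lie (SubalgElt hu) (SubalgElt hx))) // phiM; apply: NL_lie.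
have N_ppow x : N x -> N (ppow x).
  move=> [hx Nx]; exists (rsub_ppow hx).
  by rewrite (elt_eq _ _ (ppow (SubalgElt hx))) // phiP; apply: NL_ppow.
have NH x : N x -> x \in H by case.
pose K := core charFp N0 N_lin N_lie N_ppow.
have iter_K d x : x \in K -> iter d ppow x \in K.
  by elim: d x => // d IH x xK; rewrite iterSr; apply/IH/(rsub_ppow xK).
(* The first [n0] powers lead into [N], the others from [N] into its core. *)
pose n1 := (mH * p.-1 + n0)%N.
have gK i : iter n1 ppow (g i) \in K.
  rewrite iterD; apply: (core_absorbs charFp NH N0 N_lin N_lie N_ppow codH).
  have Ng n : exists hx : iter n ppow (g i) \in H,
      phi (SubalgElt hx) = iter n ppow (phi (SubalgElt (gH i))).
    elim: n => [|n [hx IH]]; first by exists (gH i).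
    exists (rsub_ppow hx).
    by rewrite (elt_eq _ _ (ppow (SubalgElt hx))) // phiP IH.
  by have [hx hphi] := Ng n0; exists hx; rewrite hphi; exact: hn0.
apply: (@sub_finite_set _ _ `I_n1); last exact: finite_II.
move=> n /= not_large; rewrite ltnNge; apply/negP => le_n; apply: not_large.
set J := rideal_gen _.
have JK x : x \in J -> x \in K.
  move=> /asboolP; apply => _ [i _ <-].
  by rewrite -(subnK le_n) iterD; apply: iter_K.
have R_lin a x y r r' : R x r -> R y r' -> R (a *: x + y) (a *: r + r').
  move=> [hx Rx] [hy Ry]; exists (rpredD (rpredZ a hx) hy).
  by rewrite (elt_eq _ _ (a *: SubalgElt hx + SubalgElt hy)) // linearP; apply: RL_lin.
have R_lie x y r r' : R x r -> R y r' -> R (lie x y) (lie r r').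
  move=> [hx Rx] [hy Ry]; exists (rsub_lie hx hy).
  by rewrite (elt_eq _ _ (lie (SubalgElt hx) (SubalgElt hy))) // phiM; apply: RL_lie.
have R_ppow x r : R x r -> R (ppow x) (ppow r).
  move=> [hx Rx]; exists (rsub_ppow hx).
  by rewrite (elt_eq _ _ (ppow (SubalgElt hx))) // phiP; apply: RL_ppow.
apply: (large_quotient R_lin R_lie R_ppow) => //.
- by move=> r [hx]; rewrite (elt_eq _ _ 0) // raddf0; apply: RL_fun.
- by move=> x /JK xK; have [hx Nx] := core_sub (charFp := charFp) xK; exists hx; apply: NRL.
- move=> r; have [z hz] := RL_onto r; have [[x hx] phix] := phi_onto z.
  by exists x, hx; rewrite phix.
have [mL [bL codL]] := RL_cod.
have /choice[b' phib'] i := phi_onto (bL i).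
(* A complement of the subalgebra of [G] is spanned by a complement of [H] in [G]
   and by one of the subalgebra of [L], lifted to [H]. *)
pose glue T (u : 'I_mH -> T) (v : 'I_mL -> T) (i : 'I_(mH + mL)) :=
  match fintype.split i with inl j => u j | inr j => v j end.
exists (mH + mL)%N, (glue _ bH (fun j => val (b' j))).
move=> x; have [c hc] := codH x; have [d [r hr]] := codL (phi (SubalgElt hc)).
exists (glue _ c d), r.
have glueL T u v j : glue T u v (lshift mL j) = u j.
  by rewrite /glue -[lshift mL j]/(unsplit (inl j)) unsplitK.
have glueR T u v j : glue T u v (rshift mH j) = v j.
  by rewrite /glue -[rshift mH j]/(unsplit (inr j)) unsplitK.
pose y : subalg_type H := SubalgElt hc - \sum_(j < mL) d j *: b' j.
have val_y : val y = x - \sum_(i < mH + mL) glue _ c d i *: glue _ bH (fun j => val (b' j)) i.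
  have val_sum : val (\sum_(j < mL) d j *: b' j) = \sum_(j < mL) d j *: val (b' j).
    by rewrite raddf_sum.
  rewrite big_split_ord /= val_sum opprD [RHS]addrA.
  by congr (_ - _ - _); apply: eq_bigr => j _; rewrite ?glueL ?glueR.
have hy : val y \in H := valP y.
have phi_sum : phi (\sum_(j < mL) d j *: b' j) = \sum_(j < mL) d j *: bL j.
  by rewrite linear_sum; apply: eq_bigr => j _; rewrite linearZ phib'.
by rewrite -val_y; exists hy; rewrite (elt_eq _ _ y) // /y linearB phi_sum.
Qed.
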